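(* Let $(\Gamma,G)$ be a matched pair of a countable discrete group $\Gamma$ and a compact group $G$, with associated actions $\alpha$ of $\Gamma$ on $G$ and $\beta$ of $G$ on $\Gamma$, and let $\mathbb{G}$ be the bicrossed product. There are canonical group isomorphisms $$\mathrm{Int}(\mathbb{G})\simeq \mathrm{Sp}(G)\rtimes_\alpha\Gamma^\beta\quad\text{and}\quad \chi(\mathbb{G})\simeq G^\alpha\,{}_\beta\!\ltimes\mathrm{Sp}(\Gamma).$$ The second isomorphism is moreover a homeomorphism.
   Context: Matched pair $(\Gamma,G)$: $\Gamma$ and $G$ are closed subgroups of a locally compact group $H$ with $\Gamma\cap G=\{e\}$ and complement of $\Gamma G$ of Haar measure zero. Since $G$ is compact, $\Gamma G=H$, and $\gamma g=\alpha_\gamma(g)\beta_g(\gamma)$ defines a continuous left action $\alpha$ of $\Gamma$ on the space $G$ and a continuous right action $\beta$ of $G$ on the set $\Gamma$ (with finite orbits $\gamma\cdot G$). The bicrossed product $\mathbb{G}$ is the compact quantum group with $C_m(\mathbb{G})$ equal to the full crossed product of $C(G)$ by $\Gamma$ (generated by a copy $\alpha(C(G))$ of $C(G)$ and unitaries $u_\gamma$ with $u_\gamma\alpha(F)u_\gamma^*=\alpha(F\circ\alpha_{\gamma^{-1}})$), $\Delta_{\mathbb{G}}\circ\alpha=(\alpha\otimes\alpha)\circ\Delta_G$, $\Delta_{\mathbb{G}}(u_\gamma)=\sum_{r\in\gamma\cdot G}u_\gamma\alpha(v_{\gamma,r})\otimes u_r$, where $v_{\gamma,r}\in C(G)$ is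 the indicator function of $\{g\in G:\beta_g(\gamma)=r\}$. $\mathrm{Int}(\mathbb{G})=\{u\in\mathcal U(C_m(\mathbb{G})):\Delta_{\mathbb{G}}(u)=u\otimes u\}$ (a group under multiplication). $\chi(\mathbb{G})$ is the set of characters (unital $*$-homomorphisms to $\mathbb{C}$) of $C_m(\mathbb{G})$, a compact group with product $gh=(g\otimes h)\circ\Delta_{\mathbb{G}}$ and weak* topology. For a locally compact group $K$, $\mathrm{Sp}(K)$ is the locally compact abelian group of (continuous) one-dimensional unitary representations of $K$ with pointwise multiplication (equivalently the spectrum of $C^*(K)$). $\Gamma^\beta=\{\gamma\in\Gamma:\beta_g(\gamma)=\gamma\ \forall g\in G\}$ and $G^\alpha=\{g\in G:\alpha_\gamma(g)=g\ \forall\gamma\in\Gamma\}$ are subgroups of $\Gamma$ and $G$. $\Gamma^\beta$ acts on the right on $\mathrm{Sp}(G)$ by group automorphisms via $\gamma\cdot\omega=\omega\circ\alpha_\gamma$, and $G^\alpha$ acts on the left (continuously) on $\mathrm{Sp}(\Gamma)$ by group automorphisms via $g\cdot\mu=\mu\circ\beta_g$. The semi-direct products have group laws $(\omega,\gamma)(\mu,\delta)=((\omega\circ\alpha_\delta)\mu,\gamma\delta)$ on $\mathrm{Sp}(G)\rtimes_\alpha\Gamma^\beta$ and $(g,\omega)(h,\mu)=(gh,\omega\cdot(\mu\circ\beta_g))$ on $G^\alpha\,{}_\beta\!\ltimes\mathrm{Sp}(\Gamma)$ (the latter with the product topology). *)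

(* Defs.v *)
From HB Require Import structures.
From mathcomp Require Import all_boot all_order all_algebra.
From mathcomp Require Import complex.
From mathcomp Require Import all_classical all_reals all_analysis.
Import Order.TTheory GRing.Theory Num.Theory.
Import numFieldNormedType.Exports.

Set Implicit Arguments.
Unset Strict Implicit.
Unset Printing Implicit Defensive.

Local Open Scope classical_set_scope.
Local Open Scope ring_scope.
Local Open Scope complex_scope.

(* Typing the complex numbers as a numClosedFieldType makes MathComp-Analysis *)
(* find their topology.                                                       *)
Definition Cplx (R : realType) : numClosedFieldType := R[i].

HB.mixin Record isTopologicalGroup G of Group G & Topological G := {
  mulg_continuous : continuous (fun p : G * G => (p.1 * p.2)%g);
  invg_continuous : continuous (fun x : G => (x^-1)%g)
}.

#[short(type="topologicalGroupType")]
HB.structure Definition TopologicalGroup :=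
  {G of Group G & Topological G & isTopologicalGroup G}.

(* Alias of H, pointed by the unit, since the library only puts generated     *)
(* sigma-algebras on pointed types.                                           *)
Definition pointed_group (H : topologicalGroupType) : Type := H.

HB.instance Definition _ (H : topologicalGroupType) :=
  Choice.copy (pointed_group H) H.
HB.instance Definition _ (H : topologicalGroupType) :=
  isPointed.Build (pointed_group H) (1%g : H).

Definition borel (H : topologicalGroupType) :=
  @g_sigma_algebraType (pointed_group H) (@open H).

Record left_haar (R : realType) (H : topologicalGroupType)
    (mu : {measure set (borel H) -> \bar R}) : Prop := {
  haar_left_invariant : forall (h : H) (B : set (borel H)), measurable B ->
    mu [set (h * x : H)%g | x in B] = mu B;
  haar_compact : forall K : set H, compact K -> (mu K < +oo)%E;
  haar_outer_regular : forall B : set (borel H), measurable B ->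
    mu B = ereal_inf [set mu U | U in [set U : set H | open U /\ B `<=` U]];
  haar_inner_regular : forall U : set H, open U ->
    mu U = ereal_sup [set mu K | K in [set K : set H | compact K /\ K `<=` U]];
  haar_neq0 : mu setT != 0%E
}.

(* [i] identifies K with a closed subgroup of H, as a topological group: an   *)
(* injective continuous closed map is a homeomorphism onto a closed subset.   *)
Definition closed_subgroup_embedding (K H : topologicalGroupType) (i : K -> H) :=
  [/\ forall x y, i (x * y)%g = (i x * i y)%g,
      injective i, continuous i &
      forall F : set K, closed F -> closed (i @` F)].

Definition matched_pair (R : realType) (H Gam G : topologicalGroupType)
    (iGam : Gam -> H) (iG : G -> H) :=
  [/\ hausdorff_space H, locally_compact [set: H],
      closed_subgroup_embedding iGam, closed_subgroup_embedding iG &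
      range iGam `&` range iG = [set 1%g] /\
      exists2 mu : {measure set (borel H) -> \bar R}, left_haar mu &
        mu.-negligible (~` [set (iGam p.1 * iG p.2 : H)%g | p in [set: Gam * G]])].

(* [al c] is alpha_c and [be g] is beta_g.                                    *)
Definition matched_actions (H Gam G : topologicalGroupType)
    (iGam : Gam -> H) (iG : G -> H) (al : Gam -> G -> G) (be : G -> Gam -> Gam) :=
  forall (c : Gam) (g : G),
    (iGam c * iG g)%g = (iG (al c g) * iGam (be g c))%g.

(* Sp(K), as a subset of the functions from K to the complex numbers.         *)
Definition Sp (R : realType) (K : topologicalGroupType) : set (K -> Cplx R) :=
  [set w : K -> Cplx R | [/\ continuous w, forall x y, w (x * y)%g = w x * w y &
               forall x, `|w x| = 1]].

Definition fixed_beta (Gam G : topologicalGroupType) (be : G -> Gam -> Gam) :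
  set Gam := [set c | forall g, be g c = c].

Definition fixed_alpha (Gam G : topologicalGroupType) (al : Gam -> G -> G) :
  set G := [set g | forall c, al c g = g].

(* The norm is real-valued and carried by the mixin: the library's normed     *)
(* modules have Cplx-valued norms and cannot be joined with algebras.         *)
HB.mixin Record isCStarAlgebra (R : realType) A
    of GRing.Algebra (Cplx R) A := {
  star : A -> A;
  starK : forall a : A, star (star a) = a;
  starD : forall a b : A, star (a + b) = star a + star b;
  starZ : forall (z : Cplx R) (a : A), star (z *: a) = (z^*)%R *: star a;
  starM : forall a b : A, star (a * b) = star b * star a;
  cnorm : A -> R;
  cnorm0_eq0 : forall a : A, cnorm a = 0 -> a = 0;
  cnormD : forall a b : A, cnorm (a + b) <= cnorm a + cnorm b;
  cnormZ : forall (z : Cplx R) (a : A), cnorm (z *: a) = Normc.normc z * cnorm a;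
  cnormM : forall a b : A, cnorm (a * b) <= cnorm a * cnorm b;
  cnorm_starM : forall a : A, cnorm (star a * a) = cnorm a ^+ 2;
  cnorm_complete : forall s : nat -> A,
    (forall e : R, 0 < e -> exists N, forall m n,
       (N <= m)%N -> (N <= n)%N -> cnorm (s m - s n) < e) ->
    exists l : A, forall e : R, 0 < e -> exists N, forall n,
       (N <= n)%N -> cnorm (s n - l) < e
}.

(* Unital nonzero complex C*-algebras.                                        *)
#[short(type="cstarAlgType")]
HB.structure Definition CStarAlgebra (R : realType) :=
  {A of GRing.Algebra (Cplx R) A & isCStarAlgebra R A}.

Section CStarTheory.
Variable R : realType.
Local Notation C := (Cplx R).
Implicit Types A B T : cstarAlgType R.

Definition norm_dense A (S : set A) :=
  forall (a : A) (e : R), 0 < e -> exists2 b, S b & cnorm (a - b) < e.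

Definition star_subalgebra A (S : set A) :=
  [/\ S 1, forall (z : C) a b, S a -> S b -> S (z *: a + b),
      forall a b, S a -> S b -> S (a * b) & forall a, S a -> S (star a)].

(* The smallest closed star-subalgebra containing X is the whole of A.        *)
Definition cstar_generated A (X : set A) :=
  forall S : set A, star_subalgebra S -> X `<=` S -> norm_dense S.

Definition unital_star_hom A B (f : A -> B) :=
  [/\ forall (z : C) a b, f (z *: a + b) = z *: f a + f b,
      forall a b, f (a * b) = f a * f b, f 1 = 1 &
      forall a, f (star a) = star (f a)].

Definition character A : set (A -> C) :=
  [set f : A -> C | [/\ forall (z : C) a b, f (z *: a + b) = z * f a + f b,
               forall a b, f (a * b) = f a * f b, f 1 = 1 &
               forall a, f (star a) = ((f a)^*)%R]].

Definition state A : set (A -> C) :=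
  [set f : A -> C | [/\ forall (z : C) a b, f (z *: a + b) = z * f a + f b,
               forall a, 0 <= f (star a * a) & f 1 = 1]].

Definition unitary A (v : A) := star v * v = 1 /\ v * star v = 1.

(* Unital star-homomorphisms C(X) -> B, for X compact; the values of [f] on   *)
(* discontinuous functions are irrelevant.                                    *)
Definition star_hom_of_functions (X : topologicalType) B (f : (X -> C) -> B) :=
  [/\ forall (z : C) (F F' : X -> C), continuous F -> continuous F' ->
        f (fun x => z * F x + F' x) = z *: f F + f F',
      forall F F' : X -> C, continuous F -> continuous F' ->
        f (fun x => F x * F' x) = f F * f F',
      f (fun=> 1) = 1 &
      forall F : X -> C, continuous F -> f (fun x => ((F x)^*)%R) = star (f F)].

(* A list [s] of pairs stands for the sum of the elementary tensors           *)
(* p.1 (x) p.2, for p in s.                                                   *)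
Definition tensor_eval A B T (t : A -> B -> T) (s : seq (A * B)) : T :=
  \sum_(p <- s) t p.1 p.2.

Definition product_functional A B (phi : A -> C) (psi : B -> C)
  (s : seq (A * B)) : C := \sum_(p <- s) phi p.1 * psi p.2.

Definition tensor_mul A B (s s' : seq (A * B)) : seq (A * B) :=
  [seq (p.1 * q.1, p.2 * q.2) | p <- s, q <- s'].

Definition tensor_star A B (s : seq (A * B)) : seq (A * B) :=
  [seq (star p.1, star p.2) | p <- s].

(* M bounds the operator (pi_phi (x) pi_psi)(s), for the GNS representations  *)
(* of phi and psi: the class of y in H_phi (x) H_psi has squared norm         *)
(* (phi (x) psi)(y^* y), and these classes are dense.                         *)
Definition gns_bound A B (phi : A -> C) (psi : B -> C) (s : seq (A * B)) (M : R) :=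
  forall y : seq (A * B),
    product_functional phi psi
      (tensor_mul (tensor_star (tensor_mul s y)) (tensor_mul s y))
    <= (M ^+ 2)%:C *
       product_functional phi psi (tensor_mul (tensor_star y) y).

(* [N] is the spatial norm of s, i.e., its operator norm in the tensor        *)
(* product of the universal representations (direct sums of all the GNS       *)
(* representations) of A and B.                                               *)
Definition spatial_norm A B (s : seq (A * B)) (N : R) :=
  let bound M := 0 <= M /\ forall (phi : A -> C) (psi : B -> C),
    state phi -> state psi -> gns_bound phi psi s M in
  bound N /\ forall M, bound M -> N <= M.

(* [T], with the elementary tensors [t a b], is the completion of the         *)
(* algebraic tensor product of A and B for the spatial norm.                  *)
Record is_min_tensor A B T (t : A -> B -> T) : Prop := {
  tensor_linearl : forall (z : C) a a' b, t (z *: a + a') b = z *: t a b + t a' b;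
  tensor_linearr : forall (z : C) a b b', t a (z *: b + b') = z *: t a b + t a b';
  tensor_mulE : forall a a' b b', t a b * t a' b' = t (a * a') (b * b');
  tensor_starE : forall a b, star (t a b) = t (star a) (star b);
  tensor_1 : t 1 1 = 1;
  tensor_injective : forall n (a : 'I_n -> A) (b : 'I_n -> B),
    (forall z : 'I_n -> C, \sum_i z i *: b i = 0 -> forall i, z i = 0) ->
    \sum_i t (a i) (b i) = 0 -> forall i, a i = 0;
  tensor_dense : norm_dense (range (tensor_eval t));
  tensor_norm : forall s, spatial_norm s (cnorm (tensor_eval t s))
}.

(* f (x) g; characters being continuous, there is at most one such [k].       *)
Definition tensor_character A B T (t : A -> B -> T) (f : A -> C) (g : B -> C) :
    T -> C :=
  xget (fun=> 0) [set k | character k /\ forall a b, k (t a b) = f a * g b].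

End CStarTheory.

Section Bicrossed.
Variable R : realType.
Local Notation C := (Cplx R).
Variables Gam G : topologicalGroupType.
Variables (al : Gam -> G -> G) (be : G -> Gam -> Gam).

Record covariant_pair (B : cstarAlgType R)
    (a : (G -> C) -> B) (u : Gam -> B) : Prop := {
  cov_hom : star_hom_of_functions a;
  cov_unitary : forall c, unitary (u c);
  cov_mul : forall c d, u (c * d)%g = u c * u d;
  cov_conj : forall c (F : G -> C), continuous F ->
    u c * a F * star (u c) = a (fun g => F (al (c^-1)%g g))
}.

Record is_full_crossed_product (A : cstarAlgType R)
    (a : (G -> C) -> A) (u : Gam -> A) : Prop := {
  fcp_cov : covariant_pair a u;
  fcp_generated :
    cstar_generated ([set a F | F in [set F : G -> C | continuous F]] `|` range u);
  fcp_universal : forall (B : cstarAlgType R) (a' : (G -> C) -> B) (u' : Gam -> B),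
    covariant_pair a' u' ->
    exists2 f : A -> B, unital_star_hom f &
      (forall F : G -> C, continuous F -> f (a F) = a' F) /\
      (forall c, f (u c) = u' c)
}.

(* In [comult_functions], [aa] is a (x) a on C(G * G) = C(G) (x) C(G).        *)
Record is_bicrossed_comult (A T : cstarAlgType R)
    (a : (G -> C) -> A) (u : Gam -> A) (t : A -> A -> T) (Delta : A -> T) : Prop := {
  comult_hom : unital_star_hom Delta;
  comult_functions : exists2 aa : (G * G -> C) -> T, star_hom_of_functions aa &
    (forall F F' : G -> C, continuous F -> continuous F' ->
       aa (fun p => F p.1 * F' p.2) = t (a F) (a F')) /\
    (forall F : G -> C, continuous F ->
       Delta (a F) = aa (fun p => F (p.1 * p.2)%g));
  comult_unitaries : forall c : Gam, Delta (u c) =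
    \sum_(r \in range (fun g => be g c))
      t (u c * a (\1_[set g | be g c = r] : G -> C)) (u r)
}.

Definition intrinsic_group (A T : cstarAlgType R) (t : A -> A -> T)
    (Delta : A -> T) : set A :=
  [set v | unitary v /\ Delta v = t v v].

Definition char_mul (A T : cstarAlgType R) (t : A -> A -> T) (Delta : A -> T)
    (f g : A -> C) : A -> C :=
  tensor_character t f g \o Delta.

(* The semi-direct product of Sp(G) and Gam^beta.                             *)
Definition sd_left : set ((G -> C) * Gam) := @Sp R G `*` fixed_beta be.

Definition sd_left_mul (p q : (G -> C) * Gam) : (G -> C) * Gam :=
  ((fun g => p.1 (al q.2 g) * q.1 g), (p.2 * q.2)%g).

(* The semi-direct product of G^alpha and Sp(Gam).                            *)
Definition sd_right : set (G * (Gam -> C)) := fixed_alpha al `*` @Sp R Gam.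

Definition sd_right_mul (p q : G * (Gam -> C)) : G * (Gam -> C) :=
  ((p.1 * q.1)%g, (fun c => p.2 c * q.2 (be p.1 c))).

End Bicrossed.

Definition group_on (T : Type) (X : set T) (op : T -> T -> T) :=
  [/\ forall x y, X x -> X y -> X (op x y),
      forall x y z, X x -> X y -> X z -> op x (op y z) = op (op x y) z &
      exists e, [/\ X e, forall x, X x -> op e x = x /\ op x e = x &
        forall x, X x -> exists2 y, X y & op y x = e /\ op x y = e]].

Definition group_isomorphism (S T : Type) (X : set S) (opX : S -> S -> S)
    (Y : set T) (opY : T -> T -> T) (f : S -> T) :=
  [/\ group_on X opX, group_on Y opY, set_bij X Y f &
      forall x y, X x -> X y -> f (opX x y) = opY (f x) (f y)].

Definition homeomorphism_on (S T : topologicalType) (X : set S) (Y : set T)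
    (f : S -> T) :=
  [/\ set_bij X Y f, {within X, continuous f} &
      exists2 f' : T -> S, forall x, X x -> f' (f x) = x &
        {within Y, continuous f'}].

(* Main.v *)
Require Import Defs.
From HB Require Import structures.
From mathcomp Require Import all_boot all_order all_algebra.
From mathcomp Require Import complex.
From mathcomp Require Import all_classical all_reals all_analysis.
From mathcomp Require Import finmap.
From mathcomp Require Import ring lra.
Import Order.TTheory GRing.Theory Num.Theory.
Import numFieldNormedType.Exports.
Import Normc.

Set Implicit Arguments.
Unset Strict Implicit.
Unset Printing Implicit Defensive.

Local Open Scope classical_set_scope.
Local Open Scope ring_scope.

(** Injectivity, surjectivity and the shape of both groups are read off from
    functionals on the full crossed product.

    The universal property is applied to two C*-algebras.  The complex numbers
    give, for (g, mu) in G^alpha x Sp(Gamma), the character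
    u_c a(F) |-> mu(c) F(g).  The bounded operators on l^2(Gamma) give, for each
    g in G, the regular representation u_d delta_c = delta_(dc),
    a(F) delta_c = F(alpha_c(g)) delta_c, hence "Fourier coefficients"
    x |-> x_c(g) = (x delta_1)(c) which map u_d a(F) to F(g) if c = d and to 0
    otherwise, are continuous in g and satisfy Parseval's identity.

    For a state phi and h in G, Parseval's identity shows that phi (x) E_h, with
    E_h(x) = x_1(h), extends to a state of the tensor product; it sees the
    second copy of C(G) as evaluation at h.  Evaluating it on
    (p (x) u_d)^* Delta(x), for x = u_c a(F) and then for all x by density,
    gives for a group-like unitary v the identity
    v_c(g) v_d(h) = [beta_g(c) = d] v_c(gh).  So exactly one coefficient w = v_c
    is nonzero, c is fixed by beta and w lies in Sp(G); and
    phi(p^* v) = phi(p^* u_c a(w)) for all phi and p, so v = u_c a(w).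

    A character of the crossed product restricts to a point evaluation on C(G)
    by compactness, and the point is fixed by alpha by covariance. *)

(** * C*-algebras and positive functionals *)

(** The coefficients only see [v] through the regular representations, which need not be faithful on
    the full crossed product, so equal coefficients alone do not yield v = u_c a(w). The remedy is
    the asymmetry of phi (x) E_h: group-likeness puts a second copy of [v] in the other leg, where
    regular coefficients suffice, while the first leg is tested by an arbitrary state.

    The tensor norm is expressed through states, so a product functional extends to the completion
    once it is positive on finite sums of elementary tensors. Multiplicativity gives this for two
    characters, Parseval's identity when one factor is E_h. Boundedness of functionals comes from
    positivity, through square roots of 1 - k for selfadjoint k of norm below 1.

    On C(G), [Delta] is prescribed by functions F(xy) that are in general no finite sums of
    elementary tensors. A functional that is a point evaluation at h on the second copy of C(G)
    makes F(xy) comparable with F(xh). *)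

Section ComplexNumbers.
Variable R : realType.
Local Notation C := (Cplx R).
Implicit Types z w : C.

Lemma conj_conjc z : (z^*)%R = conjc z.
Proof. by []. Qed.

Lemma conjD z w : ((z + w)^*)%R = (z^*)%R + (w^*)%R.
Proof. exact: rmorphD. Qed.

Lemma conjM z w : ((z * w)^*)%R = (z^*)%R * (w^*)%R.
Proof. exact: rmorphM. Qed.

Lemma conjN z : ((- z)^*)%R = - (z^*)%R.
Proof. exact: rmorphN. Qed.

Lemma conjB z w : ((z - w)^*)%R = (z^*)%R - (w^*)%R.
Proof. exact: rmorphB. Qed.

Lemma conj0 : ((0 : C)^*)%R = 0.
Proof. exact: rmorph0. Qed.

Lemma conj1 : ((1 : C)^*)%R = 1.
Proof. exact: rmorph1. Qed.

Lemma conj_real (x : R) : ((x%:C%C : C)^*)%R = x%:C%C.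
Proof. exact: conjc_real. Qed.

Lemma conj_nonneg z : 0 <= z -> (z^*)%R = z.
Proof. by move=> /ger0_real/CrealP. Qed.

Lemma normr_normc z : `|z| = (normc z)%:C%C.
Proof. by case: z. Qed.

Lemma normc_ge0 z : 0 <= normc z.
Proof. by have := normr_ge0 z; rewrite normr_normc ler0c. Qed.

Lemma normc_real (x : R) : normc (x%:C%C : C) = `|x|.
Proof. by rewrite /= expr0n addr0 sqrtr_sqr. Qed.

Lemma normc_conj z : normc (z^*)%R = normc z.
Proof. by case: z => x y /=; rewrite sqrrN. Qed.

Lemma normC_sqr z : `|z| ^+ 2 = ((normc z) ^+ 2)%:C%C.
Proof. by rewrite normr_normc rmorphXn. Qed.

Lemma normc_le_sqr z (x : R) : 0 <= x -> `|z| ^+ 2 <= (x ^+ 2)%:C%C -> normc z <= x.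
Proof. by move=> x0; rewrite normC_sqr lecR ler_pXn2r // nnegrE normc_ge0. Qed.

Lemma normc_ge0E z : 0 <= z -> z = (normc z)%:C%C.
Proof. by move=> z0; rewrite -normr_normc ger0_norm. Qed.

Lemma normc_sqr z : (z^*)%R * z = ((normc z) ^+ 2)%:C%C.
Proof. by rewrite mulrC -normCK normr_normc rmorphXn. Qed.

Lemma normc_distr (z w : C) : normc (z - w) = normc (w - z).
Proof. by rewrite -normcN opprB. Qed.

Lemma real_of_ge0 z : 0 <= z -> z = (complex.Re z)%:C%C.
Proof. by case: z => x y; rewrite lecE /= => /andP[/eqP -> _]. Qed.

Lemma abs_Re z : `|complex.Re z| <= normc z.
Proof. by have := normc_ge_Re z; rewrite normr_normc lecR. Qed.

Lemma abs_Im z : `|complex.Im z| <= normc z.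
Proof.
case: z => x y /=; rewrite -sqrtr_sqr ler_wsqrtr // lerDr; exact: sqr_ge0.
Qed.

Lemma normc_le_ReIm z : normc z <= `|complex.Re z| + `|complex.Im z|.
Proof.
rewrite [z in normc z]complexE; apply: le_trans (le_normcD _ _) _.
rewrite normcM normc_real lerD2l.
have -> : normc ('i%C : R[i]) = 1 by rewrite /= expr0n expr1n add0r sqrtr1.
by rewrite mul1r normc_real.
Qed.

End ComplexNumbers.

Section CStarGeneralities.
Variables (R : realType) (A : cstarAlgType R).
Local Notation C := (Cplx R).
Implicit Types (a b x y k : A) (s : nat -> A).

Lemma cnorm0 : cnorm (0 : A) = 0 :> R.
Proof.
by have := @cnormZ R A 0 0; rewrite scale0r (@normc0 R) mul0r.
Qed.

Lemma cnormN x : cnorm (- x) = cnorm x :> R.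
Proof.
by rewrite -scaleN1r cnormZ normcN (@normc1 R) mul1r.
Qed.

Lemma cnorm_ge0 x : 0 <= cnorm x :> R.
Proof.
have := cnormD x (- x); rewrite subrr cnorm0 cnormN -mulr2n.
by rewrite pmulrn_lge0.
Qed.

Lemma cnormB x y : cnorm (x - y) <= cnorm x + cnorm y :> R.
Proof. by rewrite -(cnormN y) cnormD. Qed.

Lemma cnorm_distr x y : cnorm (x - y) = cnorm (y - x) :> R.
Proof. by rewrite -cnormN opprB. Qed.

Lemma cnorm_star x : cnorm (star x) = cnorm x :> R.
Proof.
have le (z : A) : cnorm z <= cnorm (star z) :> R.
  have [->|z0] := eqVneq (cnorm z) (0 : R); first exact: cnorm_ge0.
  have zp : 0 < cnorm z :> R by rewrite lt_def z0 cnorm_ge0.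
  by rewrite -(ler_pM2r zp) -expr2 -cnorm_starM cnormM.
by apply/eqP; rewrite eq_le le -{2}(starK x) le.
Qed.

Lemma star0 : star (0 : A) = 0.
Proof.
have := @starZ R A 0 0; rewrite scale0r => ->.
by rewrite rmorph0 scale0r.
Qed.

Lemma starN x : star (- x) = - star x.
Proof. by apply/eqP; rewrite -subr_eq0 opprK -starD addNr star0. Qed.

Lemma starB x y : star (x - y) = star x - star y.
Proof. by rewrite starD starN. Qed.

Lemma star1 : star (1 : A) = 1.
Proof. by rewrite -[LHS]mulr1 -{2}(starK 1) -starM mulr1 starK. Qed.

Lemma star_sum I (r : seq I) (F : I -> A) :
  star (\sum_(i <- r) F i) = \sum_(i <- r) star (F i).
Proof. by apply: (big_morph _ (@starD _ _) star0). Qed.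

Lemma cnorm1 : cnorm (1 : A) = 1 :> R.
Proof.
have n0 : cnorm (1 : A) != 0 :> R.
  by apply/eqP => /cnorm0_eq0/eqP; rewrite oner_eq0.
apply: (mulIf n0); rewrite mul1r -expr2 -cnorm_starM star1 mulr1 //.
Qed.

Definition converges s (l : A) :=
  forall e : R, 0 < e -> exists N, forall n, (N <= n)%N -> cnorm (s n - l) < e.

Lemma cvg_geometric (k c : R) : 0 <= k < 1 -> 0 <= c ->
  forall e : R, 0 < e -> exists N, forall n, (N <= n)%N -> c * k ^+ n < e.
Proof.
move=> /andP[k0 k1] c0 e e0.
have : (fun n => c * k ^+ n) @ \oo --> c * 0.
  by apply: cvgM; [exact: cvg_cst|apply: cvg_expr; rewrite ger0_norm].
rewrite mulr0 => /cvgrPdist_lt /(_ _ e0) [N _ hN].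
exists N => n Nn; have := hN n Nn; rewrite /= sub0r normrN.
by rewrite ger0_norm // mulr_ge0 // exprn_ge0.
Qed.

Lemma geometric_converges s (k : R) : 0 <= k < 1 ->
  (forall n, cnorm (s n.+1 - s n) <= k ^+ n) -> exists l, converges s l.
Proof.
move=> /andP[k0 k1] hs.
have k1' : 0 < 1 - k by rewrite subr_gt0.
(* The factor [1 - k ^+ m] makes the induction close: k^m + (1 - k^m) / (1 - k) = (1 - k^(m+1)) / (1
   - k). *)
have bnd n m : cnorm (s (n + m)%N - s n) <= (1 - k)^-1 * k ^+ n * (1 - k ^+ m).
  elim: m => [|m IH]; first by rewrite addn0 subrr cnorm0 expr0 subrr mulr0.
  have -> : s (n + m.+1)%N - s n = (s (n + m).+1 - s (n + m)%N)
     + (s (n + m)%N - s n) by rewrite addnS addrA subrK.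
  apply: le_trans (cnormD _ _) _; apply: le_trans (lerD (hs _) IH) _.
  rewrite exprD exprS le_eqVlt; apply/orP; left; apply/eqP; field.
  by rewrite gt_eqF.
apply: cnorm_complete => e e0.
have ik : 0 <= (1 - k)^-1 by rewrite invr_ge0 ltW.
have e2 : 0 < e / 2 by rewrite divr_gt0.
have k01 : 0 <= k < 1 by rewrite k0.
have [N hN] := cvg_geometric k01 ik e2.
exists N => m n Nm Nn.
have near j : (N <= j)%N -> cnorm (s j - s N) < e / 2.
  move=> Nj; rewrite -(subnKC Nj); apply: le_lt_trans (bnd _ _) _.
  apply: le_lt_trans (hN N (leqnn _)); rewrite ler_piMr //.
    by rewrite mulr_ge0 // exprn_ge0.
  by rewrite gerBl exprn_ge0.
have -> : s m - s n = (s m - s N) - (s n - s N) by rewrite opprB addrA subrK.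
apply: le_lt_trans (cnormB _ _) _; have := near m Nm; have := near n Nn; lra.
Qed.

(* Fixed point of [y := (k + y ^+ 2) / 2], so that [1 - y] squares to
   [1 - k]. *)
Lemma cstar_sqrt k : star k = k -> cnorm k < 1 :> R ->
  exists2 b, star b = b & b * b = 1 - k.
Proof.
move=> kk k1; set K : R := cnorm k in k1 *.
have K0 : 0 <= K by exact: cnorm_ge0.
pose h : C := (2^-1 : R)%:C%C.
have hn : normc h = 2^-1 by rewrite normc_real ger0_norm.
pose y := fix y n := if n is m.+1 then h *: (k + y m * y m) else 0.
have yS n : y n.+1 = h *: (k + y n * y n) by [].
have nhZ (x : A) : cnorm (h *: x) = 2^-1 * cnorm x :> R by rewrite cnormZ hn.
(* The ball of radius [K] is stable under the iteration because (K + K^2) / 2 <= K for K < 1. *)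
have yK n : cnorm (y n) <= K.
  elim: n => [|n IH]; first by rewrite cnorm0.
  rewrite yS nhZ; have := cnormD k (y n * y n); have := cnormM (y n) (y n).
  rewrite -/K => h1 h2; have y0 := cnorm_ge0 (y n); nra.
(* A difference of squares is split as p(p - q) + (p - q)q, which is valid without commutation; both
   outer factors have norm at most [K], and the 1/2 absorbs the two terms. *)
have dy n : cnorm (y n.+1 - y n) <= K ^+ n.
  elim: n => [|n IH].
    by rewrite expr0 /= subr0 mulr0 addr0 nhZ -/K; lra.
  have -> : y n.+2 - y n.+1 = h *: (y n.+1 * (y n.+1 - y n)
      + (y n.+1 - y n) * y n).
    rewrite (yS n.+1) {2}(yS n) -scalerBr; congr (_ *: _).
    rewrite mulrBr mulrBl addrA subrK opprD addrACA subrr add0r //.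
  rewrite nhZ exprS; have p0 : 0 <= K ^+ n by rewrite exprn_ge0.
  have := cnormD (y n.+1 * (y n.+1 - y n)) ((y n.+1 - y n) * y n).
  have := cnormM (y n.+1) (y n.+1 - y n); have := cnormM (y n.+1 - y n) (y n).
  have := yK n; have := yK n.+1.
  move: (cnorm_ge0 (y n)) (cnorm_ge0 (y n.+1)) (cnorm_ge0 (y n.+1 - y n)).
  move: IH p0; move: (cnorm (y n.+1 - y n)) (cnorm (y n)) (cnorm (y n.+1)) (K ^+ n).
  move=> d a b E dE p0 a0 b0 d0 bK aK h1 h2 h3.
  have : b * d <= K * E by apply: ler_pM.
  have : d * a <= E * K by apply: ler_pM.
  lra.
have K01 : 0 <= K < 1 by rewrite K0.
have [l hl] := geometric_converges K01 dy.
have small (x : A) : (forall e : R, 0 < e -> cnorm x < e) -> x = 0.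
  move=> hx; apply: (@cnorm0_eq0 R); apply/eqP; rewrite eq_le cnorm_ge0 andbT.
  by apply/ler_addgt0Pl => e e0; rewrite addr0 ltW // hx.
have sy n : star (y n) = y n.
  elim: n => [|n IH]; first by rewrite star0.
  rewrite yS starZ starD kk starM IH; congr (_ *: _).
  by rewrite conj_conjc conjc_real.
have sl : star l = l.
  apply/eqP; rewrite -subr_eq0; apply/eqP/small => e e0.
  have [N /(_ N (leqnn _)) hN] := hl _ (divr_gt0 e0 (ltr0Sn _ 1)).
  have -> : star l - l = star (l - y N) - (l - y N).
    by rewrite starB sy opprB addrA subrK.
  apply: le_lt_trans (cnormB _ _) _; rewrite cnorm_star cnorm_distr; lra.
have lE : l = h *: (k + l * l).
  apply/eqP; rewrite -subr_eq0; apply/eqP/small => e e0.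
  have lK : 0 < 1 + K + cnorm l by rewrite -addrA ltr_pwDl // addr_ge0 ?cnorm_ge0.
  have d0 : 0 < e / (2 * (1 + K + cnorm l)) by rewrite divr_gt0 // mulr_gt0.
  have [N hN] := hl _ d0.
  have h1 := hN N.+1 (leqnSn _); have h0 := hN N (leqnn _).
  have -> : l - h *: (k + l * l) = h *: (y N * (y N - l) + (y N - l) * l)
      - (y N.+1 - l).
    rewrite mulrBr mulrBl addrA subrK scalerBr yS !scalerDr opprD !opprB.
    by rewrite [RHS]addrC !opprD -!addrA addKr.
  have h2 := cnormB (h *: (y N * (y N - l) + (y N - l) * l)) (y N.+1 - l).
  apply: le_lt_trans h2 _; rewrite nhZ.
  have := cnormD (y N * (y N - l)) ((y N - l) * l).
  have := cnormM (y N) (y N - l); have := cnormM (y N - l) l.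
  have := yK N; move: h0 h1.
  move: (cnorm_ge0 (y N)) (cnorm_ge0 l) (cnorm_ge0 (y N - l)) lK d0.
  set p := cnorm (y N); set q := cnorm l; set r := cnorm (y N - l).
  set D := e / _ => p0 q0 r0 lK d0 rD r'D pK h3 h4 h5.
  have eD : e = D * (2 * (1 + K + q)) by rewrite /D divfK // gt_eqF // mulr_gt0.
  have h6 : p * r <= K * D by apply: ler_pM => //; exact: ltW.
  have h7 : r * q <= D * q by rewrite ler_wpM2r // ltW.
  have h8 : 0 <= D * q by rewrite mulr_ge0 // ltW.
  have h9 : 0 <= K * D by rewrite mulr_ge0 // ltW.
  rewrite eD; nra.
exists (1 - l); first by rewrite starB star1 sl.
have l2 : k + l * l = l + l.
  have -> : l + l = (2 : C) *: l by rewrite -[2%R]/(1 + 1) scalerDl scale1r.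
  rewrite {3}lE scalerA.
  suff -> : (2 : C) * h = 1 by rewrite scale1r.
  have -> : (2 : C) = (2 : R)%:C%C by rewrite rmorph_nat.
  by rewrite -rmorphM /= divff // rmorph1.
have -> : k = l + l - l * l by rewrite -l2 addrK.
rewrite mulrBr mulr1 mulrBl mul1r !opprB opprD -!addrA; congr (_ + _).
by rewrite addrCA.
Qed.

End CStarGeneralities.

(** * Positive sesquilinear forms and the Cauchy-Schwarz inequality *)

Section PositiveForms.
Variables (R : realType).
Local Notation C := (Cplx R).
Variables (V : lmodType C) (f : V -> V -> C).
Hypothesis fr : forall z x y y', f x (z *: y + y') = z * f x y + f x y'.
Hypothesis fl : forall z x x' y, f (z *: x + x') y = (z^*)%R * f x y + f x' y.
Hypothesis fp : forall x, 0 <= f x x.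

(** The value at z x + y is real, so the sum of the two cross terms is real for every scalar z; z =
    1 and z = i determine [f y x]. *)
Lemma posform_hermitian x y : f y x = ((f x y)^*)%R.
Proof.
have e1 (z : C) : f (z *: x + y) (z *: x + y) =
    (z^*)%R * z * f x x + f y y + ((z^*)%R * f x y + z * f y x).
  by rewrite fr !fl; ring.
have key (z : C) : (((z^*)%R * f x y + z * f y x)^*)%R
    = (z^*)%R * f x y + z * f y x.
  have h1 := conj_nonneg (fp (z *: x + y)); rewrite e1 in h1.
  have hz : 0 <= (z^*)%R * z * f x x + f y y.
    by rewrite addr_ge0 ?fp // mulr_ge0 ?fp // mulrC mul_conjC_ge0.
  by move: h1; rewrite conjD (conj_nonneg hz) => /addrI.
have k1 := key 1; have ki := key 'i%C.
have ci : (('i%C : C)^*)%R = - 'i%C by apply/eqP; rewrite eq_complex /= oppr0 !eqxx.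
rewrite !conjD !conjM !conj1 !mul1r in k1.
rewrite !conjD !conjM !conjCK ci in ki.
move: (f x y) (f y x) k1 ki => p q k1 ki.
have i0 : 'i%C != 0 :> C by rewrite eq_complex /= oner_eq0 andbF.
have k2 : (p^*)%R - (q^*)%R = q - p.
  by apply: (mulfI i0); rewrite !mulrBr; move: ki; rewrite !mulNr => ->; rewrite addrC.
have k3 : (p^*)%R + (p^*)%R = q + q.
  have -> : (p^*)%R + (p^*)%R = ((p^*)%R + (q^*)%R) + ((p^*)%R - (q^*)%R) by ring.
  by rewrite k1 k2; ring.
by apply/eqP; rewrite eq_sym -(eqr_pMn2r (ltn0Sn 1)) !mulr2n k3.
Qed.

Let CS0 x y : f y y != 0 -> `|f x y| ^+ 2 <= f x x * f y y.
Proof.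
move=> y0; have yp : 0 < f y y by rewrite lt_def y0 fp.
(* This vector is [f y y] times the component of x orthogonal to y, which avoids a division. *)
have := fp (f y y *: x + (- (f x y)^*)%R *: y).
have -> (z w : C) : f (z *: x + w *: y) (z *: x + w *: y) =
   (z^*)%R * z * f x x + (z^*)%R * w * f x y + (w^*)%R * z * f y x
   + (w^*)%R * w * f y y.
  have e a : f a (w *: y) = w * f a y.
    have fa0 : f a 0 = 0.
      by have := fr (-1) a 0 0; rewrite scaler0 addr0 mulN1r addNr.
    by rewrite -[w *: y]addr0 fr fa0 addr0.
  have e' a : f (w *: y) a = (w^*)%R * f y a.
    have fa0 : f 0 a = 0.
      by have := fl (-1) 0 0 a; rewrite scaler0 addr0 rmorphN1 mulN1r addNr.
    by rewrite -[w *: y]addr0 fl fa0 addr0.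
  by rewrite fr !fl !e !e'; ring.
rewrite (posform_hermitian x y) conjN conjCK (conj_nonneg (fp y)) normCK.
set p := f x y; set q := (p^*)%R => h.
have : 0 <= f y y * (f x x * f y y - p * q) by move: h; congr (_ <= _); ring.
by rewrite pmulr_rge0 // subr_ge0.
Qed.

Lemma posform_cauchy_schwarz x y : `|f x y| ^+ 2 <= f x x * f y y.
Proof.
have [y0|/CS0//] := eqVneq (f y y) 0.
have [x0|/CS0-/(_ y)] := eqVneq (f x x) 0; last first.
  by rewrite (posform_hermitian x y) norm_conjC mulrC.
(* When x and y are both isotropic, the value at this vector is -2 |f x y|^2, so positivity forces
   [f x y] to vanish. *)
rewrite x0 mul0r; have := fp (1 *: x + (- (f x y)^*)%R *: y).
have fa0 a : f a 0 = 0.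
  by have := fr (-1) a 0 0; rewrite scaler0 addr0 mulN1r addNr.
have f0a a : f 0 a = 0.
  by have := fl (-1) 0 0 a; rewrite scaler0 addr0 rmorphN1 mulN1r addNr.
rewrite -[_ *: y in X in 0 <= X]addr0 fr !fl.
rewrite !fr !fa0 !f0a x0 y0.
rewrite (posform_hermitian x y) conjN conjCK normCK conj1.
set p := f x y; set q := (p^*)%R => h.
have : 0 <= - (p * q + p * q) by move: h; congr (_ <= _); ring.
by rewrite oppr_ge0 -mulr2n pmulrn_lle0.
Qed.

End PositiveForms.

Section PositiveFunctionals.
Variables (R : realType) (A : cstarAlgType R).
Local Notation C := (Cplx R).
Implicit Types (phi : A -> C) (x y : A).

Definition positive_functional phi :=
  (forall (z : C) x y, phi (z *: x + y) = z * phi x + phi y) /\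
  forall x, 0 <= phi (star x * x).

Lemma state_positive phi : state phi -> positive_functional phi.
Proof. by case. Qed.

Section Linear.
Variable phi : A -> C.
Hypothesis lphi : forall (z : C) x y, phi (z *: x + y) = z * phi x + phi y.

Lemma lfun0 : phi 0 = 0.
Proof. by have := lphi (-1) 0 0; rewrite scaler0 addr0 mulN1r addNr. Qed.

Lemma lfunD x y : phi (x + y) = phi x + phi y.
Proof. by have := lphi 1 x y; rewrite scale1r mul1r. Qed.

Lemma lfunZ z x : phi (z *: x) = z * phi x.
Proof. by rewrite -[_ *: x]addr0 lphi lfun0 addr0. Qed.

Lemma lfunN x : phi (- x) = - phi x.
Proof. by rewrite -scaleN1r lfunZ mulN1r. Qed.

Lemma lfunB x y : phi (x - y) = phi x - phi y.
Proof. by rewrite lfunD lfunN. Qed.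

Lemma lfun_sum I (r : seq I) (F : I -> A) :
  phi (\sum_(i <- r) F i) = \sum_(i <- r) phi (F i).
Proof. by apply: (big_morph _ lfunD lfun0). Qed.
End Linear.

Section Positive.
Variable phi : A -> C.
Hypothesis pphi : positive_functional phi.
Let lphi := pphi.1.
Let form x y := phi (star x * y).

Let formr z x y y' : form x (z *: y + y') = z * form x y + form x y'.
Proof. by rewrite /form mulrDr -scalerAr lphi. Qed.

Let forml z x x' y : form (z *: x + x') y = (z^*)%R * form x y + form x' y.
Proof. by rewrite /form starD starZ mulrDl -scalerAl lphi. Qed.

Lemma pfun_cauchy_schwarz x y :
  `|phi (star x * y)| ^+ 2 <= phi (star x * x) * phi (star y * y).
Proof. exact: (posform_cauchy_schwarz formr forml pphi.2 x y). Qed.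

Lemma pfun_star x : phi (star x) = ((phi x)^*)%R.
Proof.
have := posform_hermitian formr forml pphi.2 1 x.
by rewrite /form star1 mul1r mulr1.
Qed.

Lemma pfun1_ge0 : 0 <= phi 1.
Proof. by have := pphi.2 1; rewrite star1 mul1r. Qed.

(** For r > cnorm x, the element 1 - star x x / r^2 has a selfadjoint square root by [cstar_sqrt],
    so phi is nonnegative on it; then r decreases to cnorm x. *)
Lemma pfun_le x : phi (star x * x) <= ((cnorm x) ^+ 2)%:C%C * phi 1.
Proof.
have [P0 O0] := (pphi.2 x, pfun1_ge0).
rewrite (real_of_ge0 P0) (real_of_ge0 O0) -rmorphM lecR.
set P := complex.Re _; set O := complex.Re _; set n : R := cnorm x.
have O0' : 0 <= O by move: (O0); rewrite {1}(real_of_ge0 O0) ler0c.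
have n0 : 0 <= n by exact: cnorm_ge0.
have key (r : R) : n < r -> P <= r ^+ 2 * O.
  move=> nr; have r0 : 0 < r by exact: le_lt_trans nr.
  pose z : C := ((r ^+ 2)^-1)%:C%C.
  have r2 : 0 < (r ^+ 2)^-1 by rewrite invr_gt0 exprn_gt0.
  have zk : star (z *: (star x * x)) = z *: (star x * x).
    by rewrite starZ conj_real starM starK.
  have k1 : cnorm (z *: (star x * x)) < 1.
    rewrite cnormZ normc_real gtr0_norm // cnorm_starM -ltr_pdivlMl //.
    by rewrite invrK mulr1 ltrXn2r.
  have [b sb bb] := cstar_sqrt zk k1.
  have := pphi.2 b; rewrite sb bb lfunB // lfunZ //.
  rewrite (real_of_ge0 P0) (real_of_ge0 O0) -rmorphM -rmorphB ler0c subr_ge0.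
  by rewrite -/P -/O -ler_pdivlMl // invrK.
apply/ler_addgt0Pl => e e0.
(* With t <= 1, (n + t)^2 <= n^2 + (2n + 1) t; the final [+ 1] keeps the denominator positive when
   [O] = 0. *)
pose t := Num.min 1 (e / ((2 * n + 1) * O + 1)).
have d0 : 0 < (2 * n + 1) * O + 1.
  by rewrite ltr_wpDl // mulr_ge0 // addr_ge0 // mulr_ge0.
have t0 : 0 < t by rewrite lt_min ltr01 divr_gt0.
apply: le_trans (key (n + t) _) _; first by rewrite ltrDl.
have t1 : t <= 1 by rewrite ge_min lexx.
have te : t * ((2 * n + 1) * O + 1) <= e.
  by rewrite -ler_pdivlMr // ge_min lexx orbT.
have : 0 <= (1 - t) * (t * O) by rewrite !mulr_ge0 // ?subr_ge0 // ltW.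
nra.
Qed.

Lemma pfun_bounded x : normc (phi x) <= cnorm x * normc (phi 1).
Proof.
apply: normc_le_sqr; first by rewrite mulr_ge0 ?cnorm_ge0 ?normc_ge0.
have := pfun_cauchy_schwarz 1 x; rewrite star1 !mul1r => /le_trans; apply.
apply: le_trans (ler_wpM2l pfun1_ge0 (pfun_le x)) _.
by rewrite {1 2}(normc_ge0E pfun1_ge0) -!rmorphM exprMn mulrCA -expr2.
Qed.

Lemma pfun_compress p : positive_functional (fun x => phi (star p * x * p)).
Proof.
split=> [z x y|x]; first by rewrite mulrDr mulrDl -scalerAr -scalerAl lphi.
by rewrite -!mulrA mulrA -starM pphi.2.
Qed.

End Positive.

Lemma state_bounded phi x : state phi -> normc (phi x) <= cnorm x.
Proof.
move=> h; have := pfun_bounded (state_positive h) x.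
by case: h => _ _ ->; rewrite (@normc1 R) mulr1.
Qed.

Lemma character_state phi : character phi -> state phi.
Proof.
case=> l m p1 s; split=> // x.
by rewrite m s mulrC mul_conjC_ge0.
Qed.

End PositiveFunctionals.

Section Density.
Variables (R : realType) (A : cstarAlgType R).
Local Notation C := (Cplx R).

Lemma dense_lfun_eq0 (S : set A) (L : A -> C) (c : R) : norm_dense S -> 0 <= c ->
  (forall x y, L (x - y) = L x - L y) -> (forall x, normc (L x) <= c * cnorm x) ->
  (forall x, S x -> L x = 0) -> forall x, L x = 0.
Proof.
move=> dS c0 LB Lc L0 x; apply: eq0_normc; apply/eqP; rewrite eq_le normc_ge0 andbT.
apply/ler_addgt0Pl => e e0; rewrite addr0.
have d0 : 0 < e / (c + 1) by rewrite divr_gt0 // ltr_wpDl.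
have [s Ss hs] := dS x _ d0.
have := Lc (x - s); rewrite LB (L0 s Ss) subr0 => /le_trans; apply.
apply: le_trans (_ : (c + 1) * (e / (c + 1)) <= _).
  by apply: ler_pM => //; [exact: cnorm_ge0|rewrite lerDl|exact: ltW].
by rewrite mulrC divfK // gt_eqF // ltr_wpDl.
Qed.

End Density.

(** * Spatial tensor products *)

Section Completeness.
Variable R : realType.
Local Notation C := (Cplx R).

Lemma real_complete (x : nat -> R) :
  (forall e : R, 0 < e -> exists N, forall m n,
     (N <= m)%N -> (N <= n)%N -> `|x m - x n| < e) ->
  exists l, forall e : R, 0 < e -> exists N, forall n, (N <= n)%N -> `|x n - l| < e.
Proof.
move=> hx; have : cauchy (x @ \oo).
  apply/cauchy_exP => e e0; have [N hN] := hx e e0; exists (x N).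
  by exists N => // n /= Nn; exact: hN.
move=> /cauchy_cvg/cvgrPdist_lt h; exists (lim (x @ \oo)) => e e0.
have [N _ hN] := h e e0; exists N => n Nn; rewrite distrC; exact: hN.
Qed.

Lemma Cplx_complete (z : nat -> C) :
  (forall e : R, 0 < e -> exists N, forall m n,
     (N <= m)%N -> (N <= n)%N -> normc (z m - z n) < e) ->
  exists l, forall e : R, 0 < e -> exists N, forall n, (N <= n)%N ->
    normc (z n - l) < e.
Proof.
move=> hz.
have [a ha] : exists l, forall e : R, 0 < e -> exists N, forall n,
    (N <= n)%N -> `|complex.Re (z n) - l| < e.
  apply: real_complete => e e0; have [N hN] := hz e e0; exists N => m n Nm Nn.
  apply: le_lt_trans (hN m n Nm Nn); apply: le_trans (abs_Re _).
  by case: (z m) (z n) => p q [].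
have [b hb] : exists l, forall e : R, 0 < e -> exists N, forall n,
    (N <= n)%N -> `|complex.Im (z n) - l| < e.
  apply: real_complete => e e0; have [N hN] := hz e e0; exists N => m n Nm Nn.
  apply: le_lt_trans (hN m n Nm Nn); apply: le_trans (abs_Im _).
  by case: (z m) (z n) => p q [].
exists (a +i* b)%C => e e0; have e2 : 0 < e / 2 by rewrite divr_gt0.
have [[N hN] [M hM]] := (ha _ e2, hb _ e2).
exists (maxn N M) => n; rewrite geq_max => /andP[Nn Mn].
apply: le_lt_trans (normc_le_ReIm _) _.
move: (hN n Nn) (hM n Mn); case: (z n) => p q /=; lra.
Qed.

End Completeness.

Section Tensor.
Variables (R : realType) (A B T : cstarAlgType R) (t : A -> B -> T).
Local Notation C := (Cplx R).
Hypothesis Ht : is_min_tensor t.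
Implicit Types s y : seq (A * B).

Lemma tensor_eval_cat s s' : tensor_eval t (s ++ s') = tensor_eval t s + tensor_eval t s'.
Proof. by rewrite /tensor_eval big_cat. Qed.

Lemma tensor0l b : t 0 b = 0.
Proof.
have := tensor_linearl Ht (-1) 0 0 b.
by rewrite scaler0 addr0 scaleN1r addNr.
Qed.

Lemma tensorZl z a b : t (z *: a) b = z *: t a b.
Proof. by rewrite -[_ *: a]addr0 tensor_linearl // tensor0l addr0. Qed.

Definition tensor_scale (z : C) s : seq (A * B) := [seq (z *: p.1, p.2) | p <- s].

Lemma tensor_eval_scale z s : tensor_eval t (tensor_scale z s) = z *: tensor_eval t s.
Proof.
rewrite /tensor_eval big_map scaler_sumr; apply: eq_bigr => p _.
by rewrite /= tensorZl.
Qed.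

Lemma tensor_mul1 s : tensor_mul s [:: (1, 1)] = s.
Proof.
by rewrite /tensor_mul; elim: s => //= -[a b] s IH; rewrite IH !mulr1.
Qed.

Lemma tensor_evalM s s' :
  tensor_eval t (tensor_mul s s') = tensor_eval t s * tensor_eval t s'.
Proof.
rewrite /tensor_eval /tensor_mul big_allpairs_dep mulr_suml; apply: eq_bigr => p _.
by rewrite mulr_sumr; apply: eq_bigr => q _; rewrite tensor_mulE.
Qed.

Lemma tensor_eval_star s : tensor_eval t (tensor_star s) = star (tensor_eval t s).
Proof.
rewrite /tensor_eval /tensor_star big_map star_sum.
by apply: eq_bigr => p _; rewrite tensor_starE.
Qed.

Section ProductFunctional.
Variables (phi : A -> C) (psi : B -> C).
Hypotheses (sphi : state phi) (spsi : state psi).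
Local Notation pf := (product_functional phi psi).
Let lphi : forall (z : C) a b, phi (z *: a + b) = z * phi a + phi b. Proof. by case: sphi. Qed.
Lemma product_functional_cat s s' : pf (s ++ s') = pf s + pf s'.
Proof. by rewrite /product_functional big_cat. Qed.

Lemma product_functional_scale z s : pf (tensor_scale z s) = z * pf s.
Proof.
rewrite /product_functional big_map mulr_sumr; apply: eq_bigr => p _ /=.
by rewrite lfunZ // mulrA.
Qed.

Lemma product_functional_starM s s' : pf (tensor_mul (tensor_star s) s') =
  \sum_(p <- s) \sum_(q <- s') phi (star p.1 * q.1) * psi (star p.2 * q.2).
Proof. by rewrite /product_functional /tensor_mul big_allpairs_dep big_map. Qed.

(** The only input beyond phi and psi being states. It is supplied by multiplicativity for two
    characters and by Parseval's identity for the coefficient states. *)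
Hypothesis pf_pos : forall s, 0 <= pf (tensor_mul (tensor_star s) s).

(** A variance inequality: positivity at s - z (1 (x) 1) with z = [pf s]. Formal sums are lists and
    not vectors, so the square is expanded by hand. *)
Lemma product_functional_sqr s : `|pf s| ^+ 2 <= pf (tensor_mul (tensor_star s) s).
Proof.
have [phi1 psi1] : phi 1 = 1 /\ psi 1 = 1 by case: sphi; case: spsi.
set z := pf s; have := pf_pos (s ++ [:: ((- z) *: 1, 1)]).
rewrite product_functional_starM big_cat big_seq1 /=.
under eq_bigr do rewrite big_cat big_seq1 /=.
rewrite big_split /= -product_functional_starM big_cat big_seq1 /=.
have -> : \sum_(p <- s) phi (star p.1 * (- z *: 1)) * psi (star p.2 * 1)
   = - z * (z^*)%R.
  rewrite {2}/z /product_functional rmorph_sum mulr_sumr; apply: eq_bigr => p _ /=.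
  rewrite -scalerAr !mulr1 lfunZ // -mulrA conjM.
  by rewrite (pfun_star (state_positive sphi)) (pfun_star (state_positive spsi)).
have -> : \sum_(p <- s) phi (star (- z *: 1) * p.1) * psi (star 1 * p.2)
   = - (z^*)%R * z.
  rewrite {3}/z /product_functional mulr_sumr; apply: eq_bigr => p _ /=.
  by rewrite starZ !star1 -scalerAl !mul1r lfunZ // -mulrA conjN.
rewrite starZ !star1 -scalerAl !mul1r scalerA lfunZ // phi1 psi1 !mulr1.
rewrite normCK conjN => h; rewrite -subr_ge0; move: h; congr (_ <= _); ring.
Qed.

(** The GNS bound tested on the cyclic vector y = 1 (x) 1 controls the functional at star s times
    s. *)
Lemma product_functional_bounded s : normc (pf s) <= cnorm (tensor_eval t s).
Proof.
apply: normc_le_sqr; first exact: cnorm_ge0.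
apply: le_trans (product_functional_sqr s) _.
have [[_ /(_ _ _ sphi spsi [:: (1, 1)])]] := tensor_norm Ht s.
rewrite tensor_mul1 (product_functional_starM [:: _]) !big_seq1 /= !star1 !mulr1.
by case: sphi => _ _ ->; case: spsi => _ _ ->; rewrite !mulr1.
Qed.

(** The estimate against every [s] pins down the extension by continuity; linearity, positivity and
    the values on elementary tensors are all deduced from it by approximation. *)
Lemma product_functional_ext :
  exists L : T -> C, forall x s, normc (L x - pf s) <= cnorm (x - tensor_eval t s).
Proof.
suff h (x : T) : exists z : C, forall s, normc (z - pf s) <= cnorm (x - tensor_eval t s).
  by have [L hL] := choice h; exists L.
have /choice[f hf] (n : nat) : exists s,
    cnorm (x - tensor_eval t s) < n.+1%:R^-1 :> R.
  have [|_ [s _ <-] hs] := tensor_dense Ht x (e := n.+1%:R^-1).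
    by rewrite invr_gt0.
  by exists s.
have dif s s' : normc (pf s - pf s') <= cnorm (tensor_eval t s - tensor_eval t s').
  have := product_functional_bounded (s ++ tensor_scale (-1) s').
  rewrite product_functional_cat product_functional_scale mulN1r.
  by rewrite tensor_eval_cat tensor_eval_scale scaleN1r.
have small (e : R) : 0 < e -> exists N, forall n, (N <= n)%N -> n.+1%:R^-1 < e.
  move=> e0; have [N _ hN] := near_infty_natSinv_lt (PosNum e0).
  by exists N => n Nn; exact: hN.
have [z hz] : exists l, forall e : R, 0 < e -> exists N, forall n, (N <= n)%N ->
    normc (pf (f n) - l) < e.
  apply: Cplx_complete => e e0; have [N hN] := small _ (divr_gt0 e0 (ltr0Sn _ 1)).
  exists N => m n Nm Nn; apply: le_lt_trans (dif _ _) _.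
  have -> : tensor_eval t (f m) - tensor_eval t (f n) =
     (x - tensor_eval t (f n)) - (x - tensor_eval t (f m)).
    by rewrite opprB [RHS]addrC addrA subrK.
  apply: le_lt_trans (cnormB _ _) _.
  rewrite [e]splitr; apply: ltrD; first exact: lt_trans (hf n) (hN n Nn).
  exact: lt_trans (hf m) (hN m Nm).
exists z => s; apply/ler_addgt0Pl => e e0.
have e2 : 0 < e / 2 by rewrite divr_gt0.
have [[N hN] [M hM]] := (hz _ e2, small _ e2).
pose n := maxn N M.
have h1 := hN n (leq_maxl _ _); have h2 := hM n (leq_maxr _ _).
have -> : z - pf s = (pf (f n) - pf s) - (pf (f n) - z).
  by rewrite opprB [RHS]addrC addrA subrK.
apply: le_trans (le_normcD _ _) _; rewrite normcN.
have h3 := dif (f n) s.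
have h4 : cnorm (tensor_eval t (f n) - tensor_eval t s) <=
    cnorm (x - tensor_eval t s) + cnorm (x - tensor_eval t (f n)) :> R.
  have -> : tensor_eval t (f n) - tensor_eval t s =
    (x - tensor_eval t s) - (x - tensor_eval t (f n)).
    by rewrite opprB [RHS]addrC addrA subrK.
  exact: cnormB.
have h5 := lt_trans (hf n) h2; lra.
Qed.

Lemma tensor_state : exists2 L : T -> C, state L & forall a b, L (t a b) = phi a * psi b.
Proof.
have [L hL] := product_functional_ext.
have uniq (z : C) : (forall e : R, 0 < e -> normc z <= e) -> z = 0.
  move=> h; apply: eq0_normc; apply/eqP; rewrite eq_le normc_ge0 andbT.
  by apply/ler_addgt0Pl => e e0; rewrite addr0 h.
have apx (x : T) (e : R) : 0 < e -> exists s, cnorm (x - tensor_eval t s) < e.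
  by move=> e0; have [_ [s _ <-] ?] := tensor_dense Ht x e0; exists s.
have Lev s : L (tensor_eval t s) = pf s.
  by apply/eqP; rewrite -subr_eq0; apply/eqP/uniq => e /ltW e0;
    rewrite (le_trans (hL _ s)) // subrr cnorm0.
have Lt a b : L (t a b) = phi a * psi b.
  have := Lev [:: (a, b)].
  by rewrite /tensor_eval /product_functional !big_seq1.
have Ll (z : C) (x y : T) : L (z *: x + y) = z * L x + L y.
  apply/eqP; rewrite -subr_eq0; apply/eqP/uniq => e e0.
  pose d := e / (2 * (normc z + 1)).
  have z0 := normc_ge0 z.
  have d0 : 0 < d by rewrite divr_gt0 // mulr_gt0 // ltr_wpDl.
  have ed : e = d * (2 * (normc z + 1)) by rewrite /d divfK // gt_eqF // mulr_gt0 // ltr_wpDl.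
  have [[s hs] [s' hs']] := (apx x d d0, apx y d d0).
  have h1 := hL (z *: x + y) (tensor_scale z s ++ s').
  rewrite product_functional_cat product_functional_scale in h1.
  have e1 : z *: x + y - tensor_eval t (tensor_scale z s ++ s') =
      z *: (x - tensor_eval t s) + (y - tensor_eval t s').
    by rewrite tensor_eval_cat tensor_eval_scale opprD addrACA -scalerBr.
  rewrite e1 in h1.
  have h2 := cnormD (z *: (x - tensor_eval t s)) (y - tensor_eval t s').
  rewrite cnormZ in h2.
  have -> : L (z *: x + y) - (z * L x + L y) =
     (L (z *: x + y) - (z * pf s + pf s')) - (z * (L x - pf s) + (L y - pf s')).
    by ring.
  have h3 := le_normcD (L (z *: x + y) - (z * pf s + pf s')) (- (z * (L x - pf s) + (L y - pf s'))).
  rewrite normcN in h3.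
  have h4 := le_normcD (z * (L x - pf s)) (L y - pf s').
  rewrite normcM in h4.
  have h5 := hL x s; have h6 := hL y s'.
  apply: le_trans h3 _; rewrite ed.
  have : normc z * cnorm (x - tensor_eval t s) <= normc z * d.
    by rewrite ler_wpM2l // ltW.
  have : normc z * normc (L x - pf s) <= normc z * d.
    by rewrite ler_wpM2l //; apply: le_trans h5 _; exact: ltW.
  lra.
exists L => //; split=> //; last first.
  rewrite -(tensor_1 Ht) Lt; case: sphi => _ _ ->; case: spsi => _ _ ->.
  by rewrite mulr1.
move=> x; pose q := L (star x * x).
have qe (e : R) : 0 < e -> exists2 p : C, 0 <= p & normc (q - p) <= e.
  move=> e0; have x0 := cnorm_ge0 x.
  (* If y is within d <= 1 of x, then star x x and star y y differ by at most d cnorm x + d (cnorm x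
     + 1). Hence [q] is a limit of nonnegative numbers. *)
  pose d := Num.min 1 (e / (2 * cnorm x + 1)).
  have c0 : 0 < 2 * cnorm x + 1 by rewrite ltr_wpDl // mulr_ge0.
  have d0 : 0 < d by rewrite lt_min ltr01 divr_gt0.
  have d1 : d <= 1 by rewrite ge_min lexx.
  have de : d * (2 * cnorm x + 1) <= e by rewrite -ler_pdivlMr // ge_min lexx orbT.
  have [s hs] := apx x d d0.
  exists (pf (tensor_mul (tensor_star s) s)); first exact: pf_pos.
  apply: le_trans (hL _ _) _; rewrite tensor_evalM tensor_eval_star.
  set y := tensor_eval t s in hs *.
  have -> : star x * x - star y * y = star x * (x - y) + star (x - y) * y.
    by rewrite starB mulrBr mulrBl addrA subrK.
  apply: le_trans (cnormD _ _) _.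
  have h1 := cnormM (star x) (x - y); have h2 := cnormM (star (x - y)) y.
  rewrite !cnorm_star in h1 h2.
  have h3 : cnorm y <= cnorm x + cnorm (x - y).
    by have := cnormB x (x - y); rewrite opprB addrC subrK.
  have := cnorm_ge0 y; have := cnorm_ge0 (x - y); move: hs d0 d1 de h1 h2 h3 x0.
  move: (cnorm x) (cnorm y) (cnorm (x - y)) => p r w hs d0 d1 de h1 h2 h3 x0 w0 r0.
  have : p * w <= p * d by rewrite ler_wpM2l // ltW.
  have : w * r <= d * (p + 1) by apply: ler_pM => //; lra.
  nra.
have Imq : complex.Im q = 0.
  apply/eqP; rewrite -normr_eq0 eq_le normr_ge0 andbT; apply/ler_addgt0Pl => e e0.
  have [p p0 hp] := qe e e0; rewrite addr0; apply: le_trans hp.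
  by apply: le_trans (abs_Im _); rewrite (real_of_ge0 p0); case: (q) => a b /=; rewrite subr0.
have Req : 0 <= complex.Re q.
  apply/ler_addgt0Pl => e e0; have [p p0 hp] := qe e e0.
  have := le_trans (abs_Re _) hp.
  have : 0 <= complex.Re p by move: (p0); rewrite {1}(real_of_ge0 p0) ler0c.
  by case: (q) (p) => a b [a' b'] /= h; rewrite ler_norml => /andP[] ; lra.
by rewrite -/q; move: Imq Req; case: (q) => a b /= -> ?; rewrite lecE /= eqxx.
Qed.

End ProductFunctional.

Lemma characters_tensor (f : A -> C) (g : B -> C) : character f -> character g ->
  exists2 k : T -> C, character k & forall a b, k (t a b) = f a * g b.
Proof.
move=> cf cg; have [sf sg] := (character_state cf, character_state cg).
have pfE s s' : product_functional f g (tensor_mul s s') =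
    product_functional f g s * product_functional f g s'.
  rewrite /product_functional /tensor_mul big_allpairs_dep mulr_suml.
  apply: eq_bigr => p _; rewrite mulr_sumr; apply: eq_bigr => q _ /=.
  by case: cf => _ -> _ _; case: cg => _ -> _ _; rewrite mulrACA.
have pfS s : product_functional f g (tensor_star s) = ((product_functional f g s)^*)%R.
  rewrite /product_functional /tensor_star big_map rmorph_sum; apply: eq_bigr => p _ /=.
  by rewrite conjM; case: cf => _ _ _ ->; case: cg => _ _ _ ->.
have [s|k sk kt] := tensor_state sf sg.
  by rewrite pfE pfS mulrC mul_conjC_ge0.
exists k => //; have [kl kp k1] := sk.
have kev s : k (tensor_eval t s) = product_functional f g s.
  rewrite /tensor_eval lfun_sum //; apply: eq_bigr => p _; exact: kt.
split=> //; last by move=> a; rewrite (pfun_star (state_positive sk)).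
have kb x : normc (k x) <= cnorm x := state_bounded x sk.
(* Multiplicativity passes to the completion one argument at a time; the 2 in the bound counts the
   two terms of [L]. *)
have M1 s (y : T) : k (tensor_eval t s * y) = k (tensor_eval t s) * k y.
  pose L (y : T) := k (tensor_eval t s * y) - k (tensor_eval t s) * k y.
  apply/eqP; rewrite -subr_eq0; apply/eqP; rewrite -/(L y).
  apply: (dense_lfun_eq0 (c := 2 * cnorm (tensor_eval t s)) (tensor_dense Ht)).
  - by rewrite mulr_ge0 // cnorm_ge0.
  - by move=> x z; rewrite /L mulrBr !(lfunB kl) mulrBr; ring.
  - move=> x; apply: le_trans (le_normcD _ _) _; rewrite normcN normcM.
    have h1 := kb (tensor_eval t s * x); have h2 := cnormM (tensor_eval t s) x.
    have h3 : normc (k (tensor_eval t s)) * normc (k x)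
      <= cnorm (tensor_eval t s) * cnorm x by apply: ler_pM => //; exact: normc_ge0.
    lra.
  - by move=> _ [s' _ <-]; rewrite /L -tensor_evalM !kev pfE subrr.
move=> x y; pose L (x : T) := k (x * y) - k x * k y.
apply/eqP; rewrite -subr_eq0; apply/eqP; rewrite -/(L x).
apply: (dense_lfun_eq0 (c := 2 * cnorm y) (tensor_dense Ht)).
- by rewrite mulr_ge0 // cnorm_ge0.
- by move=> a b; rewrite /L mulrBl !(lfunB kl) mulrBl; ring.
- move=> a; apply: le_trans (le_normcD _ _) _; rewrite normcN normcM.
  have h1 := kb (a * y); have h2 := cnormM a y.
  have h3 : normc (k a) * normc (k y) <= cnorm a * cnorm y.
    by apply: ler_pM => //; exact: normc_ge0.
  lra.
- by move=> _ [s _ <-]; rewrite /L M1 subrr.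
Qed.

Lemma tensor_character_ext (f : A -> C) (g : B -> C) : character f -> character g ->
  character (tensor_character t f g) /\ forall a b, tensor_character t f g (t a b) = f a * g b.
Proof.
move=> cf cg; have [k ck kt] := characters_tensor cf cg.
by rewrite /tensor_character; case: xgetP => [l _ []|/(_ k)[]].
Qed.

End Tensor.

Section Separation.
Variables (R : realType) (A T : cstarAlgType R) (t : A -> A -> T).
Local Notation C := (Cplx R).
Hypothesis Ht : is_min_tensor t.

(* An element killed by all states has spatial norm 0 in the tensor product,
   whose elementary tensors are faithful: no Hahn-Banach theorem is needed. *)
Lemma states_separate (x : A) :
  (forall phi : A -> C, state phi -> phi (star x * x) = 0) -> x = 0.
Proof.
move=> hx.
(* When phi (star c c) is nonzero, the normalized compression of phi by c is again a state, so it
   kills star x x; otherwise Cauchy-Schwarz does. A second Cauchy-Schwarz gives the mixed terms in a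
   and b. *)
have vanish (phi : A -> C) a b : state phi -> phi (star (x * a) * (x * b)) = 0.
  move=> sphi; have pphi := state_positive sphi.
  have key c : phi (star (x * c) * (x * c)) = 0.
    have [c0|c0] := eqVneq (phi (star c * c)) 0.
      have := pfun_cauchy_schwarz pphi c (star x * (x * c)); rewrite c0 mul0r.
      rewrite -normrX normr_le0 expf_eq0 /= => /eqP h.
      by rewrite starM -mulrA.
    have lphi := pphi.1.
    pose psi y := (phi (star c * c))^-1 * phi (star c * y * c).
    have spsi : state psi.
      split=> [z y y'|y|].
      - by rewrite /psi mulrDr mulrDl -scalerAr -scalerAl lphi; ring.
      - by rewrite mulr_ge0 ?invr_ge0 ?pphi.2 // (pfun_compress pphi c).2.
      - by rewrite /psi mulr1 mulVf.
    have := hx psi spsi => /eqP; rewrite mulf_eq0 invr_eq0 (negbTE c0) /= => /eqP.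
    by rewrite starM !mulrA.
  have := pfun_cauchy_schwarz pphi (x * a) (x * b); rewrite key mul0r.
  by rewrite -normrX normr_le0 expf_eq0 /= => /eqP.
have t0 : t x 1 = 0.
  apply: (@cnorm0_eq0 R); apply/eqP; rewrite eq_le cnorm_ge0 andbT.
  (* Zero is an admissible bound: every term of the left-hand product functional has a factor phi
     (star (x a) (x b)). *)
  have [_] := tensor_norm Ht [:: (x, 1)]; rewrite /tensor_eval big_seq1; apply.
  split=> // phi psi sphi spsi y; rewrite expr0n rmorph0 mul0r.
  rewrite product_functional_starM /tensor_mul /= cats0 big_map big1 // => p _.
  by rewrite big_map big1 // => q _ /=; rewrite vanish // mul0r.
have := @tensor_injective _ _ _ _ _ Ht 1 (fun=> x) (fun=> 1); apply => //; last exact: ord0.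
  move=> z; rewrite big_ord1 => /(congr1 cnorm); rewrite cnorm0 cnormZ cnorm1 mulr1.
  by move=> /eq0_normc h i; rewrite ord1.
by rewrite big_ord1.
Qed.

End Separation.

(** * Bounded operators on a Hilbert space *)

Section Hilbert.
Variable R : realType.
Local Notation C := (Cplx R).

(** Completeness is phrased with squared distances, the norm being defined afterwards.
    [hilbert_neq0] makes the identity operator nonzero, as the unit of a ring must be. *)
Record hilbert_space := HilbertSpace {
  hilbert_sort :> lmodType C;
  ip : hilbert_sort -> hilbert_sort -> C;
  ip_linear : forall (z : C) x y y', ip x (z *: y + y') = z * ip x y + ip x y';
  ip_conj : forall x y, ip y x = ((ip x y)^*)%R;
  ip_ge0 : forall x, 0 <= ip x x;
  ip_eq0 : forall x, ip x x = 0 -> x = 0;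
  ip_complete : forall s : nat -> hilbert_sort,
    (forall e : R, 0 < e -> exists N, forall m n, (N <= m)%N -> (N <= n)%N ->
       complex.Re (ip (s m - s n) (s m - s n)) < e) ->
    exists l, forall e : R, 0 < e -> exists N, forall n, (N <= n)%N ->
       complex.Re (ip (s n - l) (s n - l)) < e;
  hilbert_neq0 : exists x : hilbert_sort, x != 0
}.

Section Norm.
Variable V : hilbert_space.
Implicit Types x y : V.

Lemma ip_antilinear (z : C) x x' y : ip (z *: x + x') y = (z^*)%R * ip x y + ip x' y.
Proof. by rewrite ip_conj ip_linear conjD conjM -!ip_conj. Qed.

Lemma ip0r x : ip x 0 = 0.
Proof. by have := ip_linear (-1) x 0 0; rewrite scaler0 addr0 mulN1r addNr. Qed.

Lemma ip0l x : ip 0 x = 0.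
Proof. by rewrite ip_conj ip0r conj0. Qed.

Lemma ipDr x y y' : ip x (y + y') = ip x y + ip x y'.
Proof. by have := ip_linear 1 x y y'; rewrite scale1r mul1r. Qed.

Lemma ipDl x x' y : ip (x + x') y = ip x y + ip x' y.
Proof. by rewrite ip_conj ipDr conjD -!ip_conj. Qed.

Lemma ipZr z x y : ip x (z *: y) = z * ip x y.
Proof. by rewrite -[_ *: y]addr0 ip_linear ip0r addr0. Qed.

Lemma ipZl z x y : ip (z *: x) y = (z^*)%R * ip x y.
Proof. by rewrite ip_conj ipZr conjM -ip_conj. Qed.

Lemma ipNr x y : ip x (- y) = - ip x y.
Proof. by rewrite -scaleN1r ipZr mulN1r. Qed.

Lemma ipNl x y : ip (- x) y = - ip x y.
Proof. by rewrite ip_conj ipNr conjN -ip_conj. Qed.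

Lemma ipBr x y y' : ip x (y - y') = ip x y - ip x y'.
Proof. by rewrite ipDr ipNr. Qed.

Lemma ipBl x x' y : ip (x - x') y = ip x y - ip x' y.
Proof. by rewrite ipDl ipNl. Qed.

Lemma ip_inj x y : (forall z, ip z x = ip z y) -> x = y.
Proof.
move=> h; apply/eqP; rewrite -subr_eq0; apply/eqP/ip_eq0.
by rewrite ipBr h subrr.
Qed.

Definition hnorm x : R := Num.sqrt (complex.Re (ip x x)).

Let Re_ge0 x : 0 <= complex.Re (ip x x).
Proof. by have := ip_ge0 x; rewrite {1}(real_of_ge0 (ip_ge0 x)) ler0c. Qed.

Lemma hnorm_ge0 x : 0 <= hnorm x.
Proof. exact: sqrtr_ge0. Qed.

Lemma hnorm_sqr x : (hnorm x ^+ 2)%:C%C = ip x x.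
Proof. by rewrite /hnorm sqr_sqrtr // -real_of_ge0 // ip_ge0. Qed.

Lemma hnorm_Re x : complex.Re (ip x x) = hnorm x ^+ 2.
Proof. by rewrite /hnorm sqr_sqrtr. Qed.

Lemma hnorm0 : hnorm 0 = 0.
Proof. by rewrite /hnorm ip0r sqrtr0. Qed.

Lemma hnorm_eq0 x : hnorm x = 0 -> x = 0.
Proof. by move=> h; apply: ip_eq0; rewrite -hnorm_sqr h expr0n. Qed.

Lemma ip_cauchy_schwarz x y : normc (ip x y) <= hnorm x * hnorm y.
Proof.
apply: normc_le_sqr; first by rewrite mulr_ge0 ?hnorm_ge0.
have := posform_cauchy_schwarz (@ip_linear V) ip_antilinear (@ip_ge0 V) x y.
by rewrite exprMn rmorphM /= !hnorm_sqr.
Qed.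

Lemma hnormZ z x : hnorm (z *: x) = normc z * hnorm x.
Proof.
rewrite /hnorm ipZl ipZr mulrA normc_sqr -hnorm_sqr -rmorphM /= sqrtrM ?sqr_ge0 //.
by rewrite !sqrtr_sqr !ger0_norm ?hnorm_ge0 ?normc_ge0.
Qed.

Lemma hnormN x : hnorm (- x) = hnorm x.
Proof. by rewrite -scaleN1r hnormZ normcN normc1 mul1r. Qed.

Lemma hnormD x y : hnorm (x + y) <= hnorm x + hnorm y.
Proof.
rewrite -(ler_pXn2r (n := 2)) ?nnegrE ?addr_ge0 ?hnorm_ge0 //.
rewrite -hnorm_Re ipDl !ipDr (ip_conj x y) -!hnorm_sqr.
have h := ip_cauchy_schwarz x y; have h' := le_trans (ler_norm _) (abs_Re (ip x y)).
move: h h'; case: (ip x y) => a b /= h h'; nra.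
Qed.

Lemma hnormB x y : hnorm (x - y) <= hnorm x + hnorm y.
Proof. by rewrite -(hnormN y) hnormD. Qed.

Lemma hnorm_complete (s : nat -> V) :
  (forall e : R, 0 < e -> exists N, forall m n, (N <= m)%N -> (N <= n)%N ->
     hnorm (s m - s n) < e) ->
  exists l, forall e : R, 0 < e -> exists N, forall n, (N <= n)%N -> hnorm (s n - l) < e.
Proof.
move=> hs; have [|l hl] := @ip_complete V s.
  move=> e e0; have [|N hN] := hs (Num.sqrt e); first by rewrite sqrtr_gt0.
  by exists N => m n Nm Nn; have := hN m n Nm Nn; rewrite ltr_sqrt.
exists l => e e0; have [|N hN] := hl (e ^+ 2); first by rewrite exprn_gt0.
exists N => n Nn; have := hN n Nn; rewrite hnorm_Re ltr_pXn2r // nnegrE ?hnorm_ge0 //.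
exact: ltW.
Qed.

End Norm.

Section Operators.
Variable V : hilbert_space.
Implicit Types (f g : V -> V) (x y : V).

Definition is_adjoint f g := forall x y, ip (f x) y = ip x (g y).
Definition op_bound f (M : R) := 0 <= M /\ forall x, hnorm (f x) <= M * hnorm x.
(** The adjoint belongs to the definition: it forces linearity, by [is_adjoint_linear], and directly
    provides the involution. *)
Definition bounded_op f := (exists g, is_adjoint f g) /\ exists M, op_bound f M.

Lemma is_adjoint_sym f g : is_adjoint f g -> is_adjoint g f.
Proof. by move=> h x y; rewrite ip_conj -h -ip_conj. Qed.

Lemma is_adjoint_linear f g : is_adjoint f g ->
  forall (z : C) x y, f (z *: x + y) = z *: f x + f y.
Proof.
move=> /is_adjoint_sym h z x y; apply: ip_inj => w.
by rewrite -h ip_linear !h -ip_linear.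
Qed.

Lemma is_adjoint_unique f g g' : is_adjoint f g -> is_adjoint f g' -> g = g'.
Proof. by move=> h h'; apply/funext => y; apply: ip_inj => x; rewrite -h -h'. Qed.

(** The squared norm of g y equals <f (g y), y>, hence is at most M |g y| |y|; then |g y| is
    cancelled. *)
Lemma adjoint_bound f g M : is_adjoint f g -> op_bound f M -> op_bound g M.
Proof.
move=> h [M0 fM]; split=> // y.
have [->|g0] := eqVneq (hnorm (g y)) 0; first by rewrite mulr_ge0 ?hnorm_ge0.
have gp : 0 < hnorm (g y) by rewrite lt_def g0 hnorm_ge0.
rewrite -(ler_pM2r gp) -expr2 -hnorm_Re -h.
apply: le_trans (le_trans (ler_norm _) (abs_Re _)) _.
apply: le_trans (ip_cauchy_schwarz _ _) _.
by rewrite [leRHS]mulrAC ler_wpM2r ?hnorm_ge0.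
Qed.

Definition opnorm f : R := inf [set M | op_bound f M].

Lemma opnorm_le f M : op_bound f M -> opnorm f <= M.
Proof.
move=> fM; apply: ge_inf => //; exists 0 => N; by case.
Qed.

Lemma opnorm_bound f : (exists M, op_bound f M) -> op_bound f (opnorm f).
Proof.
move=> [M fM].
have lb (m : R) : (forall N, op_bound f N -> m <= N) -> m <= opnorm f.
  by move=> h; apply: lb_le_inf; [exists M|move=> N; exact: h].
split=> [|x]; first by apply: lb => N; case.
have [x0|x0] := eqVneq (hnorm x) 0.
  by case: fM => M0 /(_ x); rewrite x0 !mulr0.
have xp : 0 < hnorm x by rewrite lt_def x0 hnorm_ge0.
rewrite -ler_pdivrMr //; apply: lb => N [N0 /(_ x)].
by rewrite ler_pdivrMr.
Qed.

Lemma bounded_op_submod_closed :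
  [/\ bounded_op 0,
      forall (z : C) f g, bounded_op f -> bounded_op g -> bounded_op (z *: f + g) &
      forall f g, bounded_op f -> bounded_op g -> bounded_op (f \o g)].
Proof.
split.
- split; first by exists 0 => x y; rewrite ip0l ip0r.
  by exists 0; split=> // x; rewrite hnorm0 mul0r.
- move=> z f g [[f' hf] [M [M0 fM]]] [[g' hg] [N [N0 gN]]]; split.
    exists (fun y => (z^*)%R *: f' y + g' y) => x y.
    by rewrite ip_antilinear ip_linear hf hg.
  exists (normc z * M + N); split=> [|x].
    by rewrite addr_ge0 // mulr_ge0 // normc_ge0.
  apply: le_trans (hnormD _ _) _; rewrite hnormZ mulrDl -mulrA lerD //.
  by rewrite ler_wpM2l ?normc_ge0.
- move=> f g [[f' hf] [M [M0 fM]]] [[g' hg] [N [N0 gN]]]; split.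
    by exists (g' \o f') => x y /=; rewrite hf hg.
  exists (M * N); split=> [|x /=]; first by rewrite mulr_ge0.
  by apply: le_trans (fM _) _; rewrite -mulrA ler_wpM2l.
Qed.

Definition bounded_op_pred : {pred V -> V} := fun f => `[< bounded_op f >].

Lemma bounded_op_closed : submod_closed bounded_op_pred.
Proof.
have [h0 hl _] := bounded_op_submod_closed.
split=> [|z f g /asboolP hf /asboolP hg]; apply/asboolP; first exact: h0.
exact: hl.
Qed.

HB.instance Definition _ :=
  GRing.isSubmodClosed.Build C (V -> V) bounded_op_pred bounded_op_closed.

Record bop := Bop { bop_fun :> V -> V; _ : bounded_op_pred bop_fun }.

HB.instance Definition _ := [isSub for bop_fun].
HB.instance Definition _ := [Choice of bop by <:].
HB.instance Definition _ := [SubChoice_isSubLmodule of bop by <:].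

Implicit Types F G K : bop.

Lemma bopP F : bounded_op F.
Proof. by case: F => f h; exact/asboolP. Qed.

Definition mkbop f (h : bounded_op f) : bop := @Bop f (asboolT h).

Lemma bop_ext F G : (forall x, F x = G x) -> F = G.
Proof. by move=> h; apply/val_inj/funext. Qed.

Lemma bop_linear F (z : C) x y : F (z *: x + y) = z *: F x + F y.
Proof. by have [[g /is_adjoint_linear h] _] := bopP F. Qed.

Lemma bopD F x y : F (x + y) = F x + F y.
Proof. by have := bop_linear F 1 x y; rewrite !scale1r. Qed.

Lemma bop0 F : F 0 = 0.
Proof. by have := bop_linear F (-1) 0 0; rewrite scaler0 addr0 scaleN1r addNr. Qed.

Lemma bopZ F z x : F (z *: x) = z *: F x.
Proof. by have := bop_linear F z x 0; rewrite bop0 !addr0. Qed.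

Lemma id_bounded_op : bounded_op id.
Proof. by split; [exists id|exists 1; split=> // x; rewrite mul1r]. Qed.

Definition bop1 : bop := mkbop id_bounded_op.
Definition bop_mul F G : bop :=
  mkbop (let: And3 _ _ h := bounded_op_submod_closed in h F G (bopP F) (bopP G)).

Lemma bop_mulA : associative bop_mul. Proof. by move=> F G K; exact: bop_ext. Qed.
Lemma bop_mul1 : left_id bop1 bop_mul. Proof. by move=> F; exact: bop_ext. Qed.
Lemma bop_mulr1 : right_id bop1 bop_mul. Proof. by move=> F; exact: bop_ext. Qed.
Lemma bop_mulDl : left_distributive bop_mul +%R.
Proof. by move=> F G K; exact: bop_ext. Qed.
Lemma bop_mulDr : right_distributive bop_mul +%R.
Proof. by move=> F G K; apply: bop_ext => x /=; rewrite bopD. Qed.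
Lemma bop1_neq0 : bop1 != 0.
Proof.
have [x x0] := hilbert_neq0 V; apply/eqP => /(congr1 (fun F : bop => F x)) /= h.
by move: x0; rewrite h eqxx.
Qed.

HB.instance Definition _ := GRing.Zmodule_isNzRing.Build bop
  bop_mulA bop_mul1 bop_mulr1 bop_mulDl bop_mulDr bop1_neq0.

Lemma bop_scaleAl (z : C) F G : z *: (F * G) = (z *: F) * G.
Proof. exact: bop_ext. Qed.

HB.instance Definition _ := GRing.Lmodule_isLalgebra.Build C bop bop_scaleAl.

Lemma bop_scaleAr (z : C) F G : z *: (F * G) = F * (z *: G).
Proof. by apply: bop_ext => x /=; rewrite bopZ. Qed.

HB.instance Definition _ := GRing.Lalgebra_isAlgebra.Build C bop bop_scaleAr.

Lemma bop_adjoint F : exists G : bop, is_adjoint F G.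
Proof.
have [[g hg] [M fM]] := bopP F.
suff h : bounded_op g by exists (mkbop h).
split; first by exists F; exact: is_adjoint_sym.
by exists M; exact: adjoint_bound fM.
Qed.

Definition bop_star F : bop := projT1 (cid (bop_adjoint F)).

Lemma bop_starP F x y : ip (F x) y = ip x (bop_star F y).
Proof. by rewrite /bop_star; case: cid. Qed.

Lemma bop_star_unique F G : is_adjoint F G -> bop_star F = G.
Proof. by move=> h; apply/val_inj/(is_adjoint_unique _ h)/bop_starP. Qed.

Lemma bop_starK F : bop_star (bop_star F) = F.
Proof. by apply/bop_star_unique/is_adjoint_sym/bop_starP. Qed.

Lemma bop_starD F G : bop_star (F + G) = bop_star F + bop_star G.
Proof.
by apply: bop_star_unique => x y /=; rewrite ipDl ipDr !bop_starP.
Qed.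

Lemma bop_starZ (z : C) F : bop_star (z *: F) = (z^*)%R *: bop_star F.
Proof. by apply: bop_star_unique => x y /=; rewrite ipZl ipZr bop_starP. Qed.

Lemma bop_starM F G : bop_star (F * G) = bop_star G * bop_star F.
Proof. by apply: bop_star_unique => x y /=; rewrite !bop_starP. Qed.

Definition bop_norm F : R := opnorm F.

Lemma bop_normP F : op_bound F (bop_norm F).
Proof. by apply: opnorm_bound; case: (bopP F). Qed.

Lemma bop_norm_ge0 F : 0 <= bop_norm F.
Proof. by case: (bop_normP F). Qed.

Lemma bop_norm_eq0 F : bop_norm F = 0 -> F = 0.
Proof.
move=> h; apply: bop_ext => x /=; apply: hnorm_eq0; apply/eqP.
by rewrite eq_le hnorm_ge0 andbT; have [_ /(_ x)] := bop_normP F; rewrite h mul0r.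
Qed.

Lemma bop_normD F G : bop_norm (F + G) <= bop_norm F + bop_norm G.
Proof.
apply: opnorm_le; have [[f0 hf] [g0 hg]] := (bop_normP F, bop_normP G).
split=> [|x]; first exact: addr_ge0.
by apply: le_trans (hnormD _ _) _; rewrite mulrDl lerD.
Qed.

Lemma bop_normZ z F : bop_norm (z *: F) = normc z * bop_norm F.
Proof.
have le (w : C) G : bop_norm (w *: G) <= normc w * bop_norm G.
  apply: opnorm_le; have [g0 hg] := bop_normP G.
  split=> [|x]; first by rewrite mulr_ge0 ?normc_ge0.
  by rewrite /= hnormZ -mulrA ler_wpM2l ?normc_ge0.
apply/eqP; rewrite eq_le le /=.
have [->|z0] := eqVneq z 0; first by rewrite (@normc0 R) mul0r bop_norm_ge0.
have := le z^-1 (z *: F); rewrite scalerA mulVf // scale1r normcV ler_pdivlMl //.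
by rewrite lt_def normc_ge0 andbT; apply: contra_neq z0 => /eq0_normc.
Qed.

Lemma bop_normM F G : bop_norm (F * G) <= bop_norm F * bop_norm G.
Proof.
apply: opnorm_le; have [[f0 hf] [g0 hg]] := (bop_normP F, bop_normP G).
split=> [|x]; first exact: mulr_ge0.
by apply: le_trans (hf _) _; rewrite -mulrA ler_wpM2l.
Qed.

Lemma bop_norm_star F : bop_norm (bop_star F) <= bop_norm F.
Proof. by apply: opnorm_le; exact: adjoint_bound (bop_starP F) (bop_normP F). Qed.

Lemma bop_norm_starM F : bop_norm (bop_star F * F) = bop_norm F ^+ 2.
Proof.
apply/eqP; rewrite eq_le; apply/andP; split.
  apply: le_trans (bop_normM _ _) _; rewrite expr2.
  by rewrite ler_wpM2r ?bop_norm_ge0 ?bop_norm_star.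
set N := bop_norm (_ * _); have N0 : 0 <= N by exact: bop_norm_ge0.
rewrite -(sqr_sqrtr N0) ler_pXn2r ?nnegrE ?sqrtr_ge0 ?bop_norm_ge0 //.
apply: opnorm_le; split=> [|x]; first exact: sqrtr_ge0.
rewrite -(ler_pXn2r (n := 2)) ?nnegrE ?mulr_ge0 ?sqrtr_ge0 ?hnorm_ge0 //.
rewrite exprMn (sqr_sqrtr N0) -hnorm_Re bop_starP.
apply: le_trans (le_trans (ler_norm _) (abs_Re _)) _.
apply: le_trans (ip_cauchy_schwarz _ _) _; rewrite mulrC expr2 mulrA.
by rewrite ler_wpM2r ?hnorm_ge0 //; have [_ /(_ x)] := bop_normP (bop_star F * F).
Qed.

Lemma bop_complete (s : nat -> bop) :
  (forall e : R, 0 < e -> exists N, forall m n, (N <= m)%N -> (N <= n)%N ->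
     bop_norm (s m - s n) < e) ->
  exists l, forall e : R, 0 < e -> exists N, forall n, (N <= n)%N -> bop_norm (s n - l) < e.
Proof.
(* Stated for an arbitrary sequence so as to apply also to the adjoints: the limit operator must
   come with an adjoint, which is the pointwise limit of the adjoints. *)
have ptw (s' : nat -> bop) : (forall e : R, 0 < e -> exists N, forall m n,
      (N <= m)%N -> (N <= n)%N -> bop_norm (s' m - s' n) < e) ->
    exists L : V -> V, forall e : R, 0 < e -> exists N, forall n x, (N <= n)%N ->
      hnorm (s' n x - L x) <= e * hnorm x.
  move=> hs.
  have /choice[L hL] (x : V) : exists l, forall e : R, 0 < e -> exists N, forall n,
      (N <= n)%N -> hnorm (s' n x - l) < e.
    apply: hnorm_complete => e e0.
    have x1 : 0 < hnorm x + 1 by rewrite ltr_wpDl ?hnorm_ge0.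
    have [N hN] := hs _ (divr_gt0 e0 x1); exists N => m n Nm Nn.
    have [_ /(_ x) /= h] := bop_normP (s' m - s' n).
    apply: le_lt_trans h _.
    apply: le_lt_trans (_ : e / (hnorm x + 1) * hnorm x < _).
      by rewrite ler_wpM2r ?hnorm_ge0 // ltW // hN.
    by rewrite mulrAC ltr_pdivrMr // ltr_pM2l // ltrDl.
  exists L => e e0; have [N hN] := hs e e0; exists N => n x Nn.
  apply/ler_addgt0Pl => d d0; have [M hM] := hL x d d0.
  pose m := maxn N M.
  have -> : s' n x - L x = (s' m x - L x) + (s' n x - s' m x).
    by rewrite [RHS]addrC addrA subrK.
  apply: le_trans (hnormD _ _) _; apply: lerD.
    by rewrite ltW // hM // leq_maxr.
  have [_ /(_ x) /= h] := bop_normP (s' n - s' m).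
  by apply: le_trans h _; rewrite ler_wpM2r ?hnorm_ge0 // ltW // hN // leq_maxl.
move=> hs; have [L hL] := ptw s hs.
have [|L' hL'] := ptw (fun n => bop_star (s n)).
  move=> e e0; have [N hN] := hs e e0; exists N => m n Nm Nn.
  apply: le_lt_trans (hN m n Nm Nn); rewrite -[- bop_star _]scaleN1r.
  have -> : (-1 : C) = ((-1)^*)%R by rewrite conjN conj1.
  by rewrite -bop_starZ -bop_starD scaleN1r bop_norm_star.
have adj : is_adjoint L L'.
  move=> x y; apply/eqP; rewrite -subr_eq0; apply/eqP; apply: eq0_normc; apply/eqP.
  rewrite eq_le normc_ge0 andbT; apply/ler_addgt0Pl => e e0; rewrite addr0.
  have xy : 0 < 2 * (hnorm x * hnorm y) + 1.
    by rewrite ltr_wpDl // !mulr_ge0 ?hnorm_ge0.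
  have d0 : 0 < e / (2 * (hnorm x * hnorm y) + 1) by rewrite divr_gt0.
  have [[N hN] [M hM]] := (hL _ d0, hL' _ d0).
  pose n := maxn N M.
  have := hN n x (leq_maxl _ _); have := hM n y (leq_maxr _ _).
  have -> : ip (L x) y - ip x (L' y) =
     ip x (bop_star (s n) y - L' y) - ip (s n x - L x) y.
    by rewrite ipBl ipBr bop_starP; ring.
  have := ip_cauchy_schwarz x (bop_star (s n) y - L' y).
  have := ip_cauchy_schwarz (s n x - L x) y.
  have := le_normcD (ip x (bop_star (s n) y - L' y)) (- ip (s n x - L x) y).
  rewrite normcN.
  set d := e / _ => h1 h2 h3 h4 h5; apply: le_trans h1 _.
  have -> : e = d * (2 * (hnorm x * hnorm y) + 1) by rewrite /d divfK // gt_eqF.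
  have h6 : hnorm (s n x - L x) * hnorm y <= d * hnorm x * hnorm y.
    by rewrite ler_wpM2r ?hnorm_ge0.
  have h7 : hnorm x * hnorm (bop_star (s n) y - L' y) <= hnorm x * (d * hnorm y).
    by rewrite ler_wpM2l ?hnorm_ge0.
  move: h2 h3 h6 h7 d0; rewrite -/d; lra.
have bL : bounded_op L.
  split; first by exists L'.
  have [N /(_ N _ (leqnn _)) hN] := hL 1 ltr01.
  exists (1 + bop_norm (s N)); split=> [|x]; first by rewrite addr_ge0 ?bop_norm_ge0.
  have -> : L x = s N x - (s N x - L x) by rewrite opprB addrC subrK.
  apply: le_trans (hnormB _ _) _; rewrite mulrDl addrC lerD ?hN //.
  by case: (bop_normP (s N)).
exists (mkbop bL) => e e0; have [N hN] := hL _ (divr_gt0 e0 (ltr0Sn _ 1)).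
exists N => n Nn; apply: le_lt_trans (_ : e / 2 < _); last first.
  by rewrite ltr_pdivrMr // ltr_pMr // ltr1n.
by apply: opnorm_le; split=> [|x]; [rewrite divr_ge0 // ltW|exact: hN].
Qed.

HB.instance Definition _ := isCStarAlgebra.Build R bop
  bop_starK bop_starD bop_starZ bop_starM bop_norm_eq0 bop_normD bop_normZ
  bop_normM bop_norm_starM bop_complete.


End Operators.
End Hilbert.

(** * Square-summable families and the regular representation *)

Section Sums.
Variables (R : realType) (I : choiceType).
Local Notation C := (Cplx R).
Implicit Types (f g : I -> C) (F : {fset I}).

Lemma sum_fsubset (V : nmodType) (f : I -> V) F K : (F `<=` K)%fset ->
  \sum_(i <- F) f i = \sum_(i <- K) (if i \in F then f i else 0).
Proof.
move=> FK; rewrite -(big_fset_incl _ FK) => [|i _ /negbTE -> //].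
by rewrite big_seq [RHS]big_seq; apply: eq_bigr => i ->.
Qed.

(** Summation along the directed set of finite subsets is independent of any ordering, hence
    invariant under bijections of the index set. *)
Definition sums_to f (z : C) := forall e : R, 0 < e -> exists F0 : {fset I},
  forall F, (F0 `<=` F)%fset -> normc (\sum_(i <- F) f i - z) < e.

Lemma sums_unique f z w : sums_to f z -> sums_to f w -> z = w.
Proof.
move=> hz hw; apply/eqP; rewrite -subr_eq0; apply/eqP/eq0_normc/eqP.
rewrite eq_le normc_ge0 andbT; apply/ler_addgt0Pl => e e0; rewrite addr0.
have [[F hF] [F' hF']] := (hz _ (divr_gt0 e0 (ltr0Sn _ 1)), hw _ (divr_gt0 e0 (ltr0Sn _ 1))).
have h1 := hF (F `|` F')%fset (fsubsetUl _ _).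
have h2 := hF' (F `|` F')%fset (fsubsetUr _ _).
move: h1 h2; set s := \sum_(i <- _) _ => h1 h2.
have -> : z - w = (s - w) - (s - z) by ring.
have := le_normcD (s - w) (- (s - z)); rewrite normcN; lra.
Qed.

Lemma sums_linear f g (c z w : C) : sums_to f z -> sums_to g w ->
  sums_to (fun i => c * f i + g i) (c * z + w).
Proof.
move=> hz hw e e0; have c0 := normc_ge0 c.
have c1 : 0 < 2 * (normc c + 1) by rewrite mulr_gt0 // ltr_wpDl.
have d0 : 0 < e / (2 * (normc c + 1)) by rewrite divr_gt0.
have [[F hF] [F' hF']] := (hz _ d0, hw _ d0).
exists (F `|` F')%fset => K; rewrite fsubUset => /andP[/hF h1 /hF' h2].
rewrite big_split -mulr_sumr /=; move: h1 h2.
set s := \sum_(i <- _) f i; set s' := \sum_(i <- _) g i => h1 h2.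
have -> : c * s + s' - (c * z + w) = c * (s - z) + (s' - w) by ring.
apply: le_lt_trans (le_normcD _ _) _; rewrite normcM.
set d := e / _ in d0 h1 h2.
have -> : e = d * (2 * (normc c + 1)) by rewrite /d divfK // gt_eqF.
have : normc c * normc (s - z) <= normc c * d by rewrite ler_wpM2l // ltW.
have : 0 <= normc c * d by rewrite mulr_ge0 // ltW.
lra.
Qed.

Lemma eq_sums f g z : (forall i, f i = g i) -> sums_to f z -> sums_to g z.
Proof. by move=> /funext ->. Qed.

Lemma sums_conj f z : sums_to f z -> sums_to (fun i => ((f i)^*)%R) ((z^*)%R).
Proof.
move=> h e e0; have [F hF] := h e e0; exists F => K /hF.
by rewrite -normc_conj conjB rmorph_sum.
Qed.

Lemma sums_ge0 f z : (forall i, 0 <= f i) -> sums_to f z -> 0 <= z.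
Proof.
move=> f0 h.
have fin F : 0 <= \sum_(i <- F) f i by apply: sumr_ge0.
have Im0 : complex.Im z = 0.
  apply/eqP; rewrite -normr_eq0 eq_le normr_ge0 andbT; apply/ler_addgt0Pl => e e0.
  have [F /(_ F (fsubset_refl _)) hF] := h e e0; rewrite addr0 ltW //.
  apply: le_lt_trans hF; apply: le_trans (abs_Im _).
  rewrite (real_of_ge0 (fin F)); case: (z) => a b /=.
  by rewrite sub0r normrN.
have Re0 : 0 <= complex.Re z.
  apply/ler_addgt0Pl => e e0; have [F /(_ F (fsubset_refl _)) hF] := h e e0.
  have := le_lt_trans (abs_Re _) hF; have := fin F.
  rewrite {1}(real_of_ge0 (fin F)) ler0c; case: (z) (\sum_(i <- F) f i) => a b [a' b'] /=.
  by rewrite ltr_norml => ? /andP[]; lra.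
by move: Im0 Re0; case: (z) => a b /= -> ?; rewrite lecE /= eqxx.
Qed.

Lemma sums_real_ge0 (g : I -> R) (M : R) : (forall i, 0 <= g i) ->
  (forall F, \sum_(i <- F) g i <= M) -> exists z, sums_to (fun i => (g i)%:C%C) z.
Proof.
move=> g0 gM; pose S := [set \sum_(i <- F) g i | F in [set: {fset I}]].
have hS : has_sup S.
  by split; [exists (\sum_(i <- fset0) g i); exists fset0|exists M => _ [F _ <-]].
exists (sup S)%:C%C => e e0.
have [_ [F _ <-] hF] := sup_adherent e0 hS.
exists F => K FK.
have -> : \sum_(i <- K) (g i)%:C%C - (sup S)%:C%C = (\sum_(i <- K) g i - sup S)%:C%C :> C.
  by rewrite rmorphB rmorph_sum.
rewrite normc_real.
have h1 : \sum_(i <- K) g i <= sup S by apply: ub_le_sup; [case: hS|exists K].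
have h2 : \sum_(i <- F) g i <= \sum_(i <- K) g i.
  by rewrite (sum_fsubset _ FK); apply: ler_sum => i _; case: ifP.
rewrite ltr_norml; lra.
Qed.

Lemma sums_exists f (g : I -> R) (M : R) : (forall i, normc (f i) <= g i) ->
  (forall F, \sum_(i <- F) g i <= M) -> exists z, sums_to f z.
Proof.
move=> fg gM.
(* A real family dominated by g is the difference of the nonnegative families g + h and g; the
   partial sums of the former are at most 2 M. *)
have real (h : I -> R) : (forall i, `|h i| <= g i) -> exists z, sums_to (fun i => (h i)%:C%C) z.
  move=> hg.
  have [|F|z hz] := @sums_real_ge0 (fun i => g i + h i) (2 * M).
  - by move=> i; have := hg i; rewrite ler_norml; lra.
  - rewrite mulr_natl mulr2n; apply: le_trans (lerD (gM F) (gM F)).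
    rewrite -big_split; apply: ler_sum => i _ /=.
    by have := hg i; rewrite ler_norml; lra.
  have [|F|w hw] := @sums_real_ge0 g M.
  - by move=> i; apply: le_trans (fg i); exact: normc_ge0.
  - exact: gM.
  exists ((-1) * w + z); apply: eq_sums (sums_linear (-1) hw hz) => i.
  by rewrite rmorphD; ring.
have [|z hz] := real (fun i => complex.Re (f i)).
  by move=> i; apply: le_trans (fg i); exact: abs_Re.
have [|w hw] := real (fun i => complex.Im (f i)).
  by move=> i; apply: le_trans (fg i); exact: abs_Im.
exists ('i%C * w + z); apply: eq_sums (sums_linear 'i%C hw hz) => i.
by rewrite [in RHS](complexE (f i)) addrC.
Qed.

Lemma sums_reindex f z (s s' : I -> I) : cancel s s' -> cancel s' s ->
  sums_to f z -> sums_to (f \o s) z.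
Proof.
move=> ss' s's h e e0; have [F hF] := h e e0.
exists [fset s' i | i in F]%fset => K FK.
have := hF [fset s i | i in K]%fset.
rewrite big_imfset /=; last by move=> i j _ _; exact: (can_inj ss').
apply; apply/fsubsetP => i iF; rewrite -(s's i); apply: in_imfset.
by apply: (fsubsetP FK); apply: in_imfset.
Qed.

(** Replacing the terms indexed by [F] by 0 leaves a nonnegative family, whose sum is the difference
    of the two sides. *)
Lemma sums_le f z F : (forall i, 0 <= f i) -> sums_to f z -> \sum_(i <- F) f i <= z.
Proof.
move=> f0 hz; rewrite -subr_ge0.
apply: (@sums_ge0 (fun i => if i \in F then 0 else f i)).
  by move=> i; case: ifP.
move=> e e0; have [F0 hF0] := hz e e0; exists (F0 `|` F)%fset => K.
rewrite fsubUset => /andP[F0K FK]; have := hF0 K F0K.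
have -> : \sum_(i <- K) (if i \in F then 0 else f i) =
    \sum_(i <- K) f i - \sum_(i <- F) f i.
  rewrite (sum_fsubset _ FK) -sumrB; apply: eq_bigr => i _.
  by case: ifP; rewrite ?subrr ?subr0.
by rewrite opprB addrA subrK.
Qed.

Lemma sums_single f (i0 : I) : (forall i, i != i0 -> f i = 0) -> sums_to f (f i0).
Proof.
move=> h e e0; exists [fset i0]%fset => F; rewrite fsub1set => iF.
rewrite (big_fsetD1 i0) //= big_seq big1 ?addr0 ?subrr ?normc0 //.
by move=> i; rewrite !inE => /andP[/h].
Qed.

End Sums.

(** * The Hilbert space of square-summable families *)

Section SquareSummable.
Variables (R : realType) (I : choiceType).
Local Notation C := (Cplx R).
Implicit Types (x y : I -> C) (F : {fset I}).

Definition l2 x := exists M : R, forall F, \sum_(i <- F) normc (x i) ^+ 2 <= M.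

Lemma sqr_normcD (z w : C) : normc (z + w) ^+ 2 <= 2 * normc z ^+ 2 + 2 * normc w ^+ 2.
Proof.
have := le_normcD z w; have := sqr_ge0 (normc z - normc w).
have := normc_ge0 (z + w); nra.
Qed.

Lemma l2_linear (c : C) x y : l2 x -> l2 y -> l2 (c *: x + y).
Proof.
move=> [M hM] [N hN]; exists (2 * (normc c ^+ 2 * M) + 2 * N) => F.
apply: le_trans (_ : \sum_(i <- F) (2 * (normc c ^+ 2 * normc (x i) ^+ 2) + 2 * normc (y i) ^+ 2) <= _).
  by apply: ler_sum => i _; apply: le_trans (sqr_normcD _ _) _; rewrite normcM exprMn.
rewrite big_split -!mulr_sumr /= lerD // ler_wpM2l //.
by rewrite ler_wpM2l // sqr_ge0.
Qed.

Lemma l2_0 : l2 0.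
Proof. by exists 0 => F; rewrite big1 // => i _; rewrite normc0 expr0n. Qed.

Definition l2_pred : {pred I -> C} := fun x => `[< l2 x >].

Lemma l2_closed : submod_closed l2_pred.
Proof.
split=> [|c x y /asboolP hx /asboolP hy]; apply/asboolP; first exact: l2_0.
exact: l2_linear.
Qed.

HB.instance Definition _ := GRing.isSubmodClosed.Build C (I -> C) l2_pred l2_closed.

Record ell2 := Ell2 { ell2_fun :> I -> C; _ : l2_pred ell2_fun }.

HB.instance Definition _ := [isSub for ell2_fun].
HB.instance Definition _ := [Choice of ell2 by <:].
HB.instance Definition _ := [SubChoice_isSubLmodule of ell2 by <:].

Lemma ell2P (x : ell2) : l2 x.
Proof. by case: x => f h; exact/asboolP. Qed.

Definition mkell2 x (h : l2 x) : ell2 := @Ell2 x (asboolT h).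

Lemma ell2_ext (x y : ell2) : (forall i, x i = y i) -> x = y.
Proof. by move=> h; apply/val_inj/funext. Qed.

(** By [l2_ip_sums] the default value is never taken on square-summable families. *)
Definition l2_ip x y : C := xget 0 (sums_to (fun i => ((x i)^*)%R * y i)).

Lemma l2_ip_sums x y : l2 x -> l2 y -> sums_to (fun i => ((x i)^*)%R * y i) (l2_ip x y).
Proof.
move=> [M hM] [N hN]; rewrite /l2_ip; case: xgetP => [z -> //|h]; exfalso.
have [i|F|z /h//] := @sums_exists _ _ (fun i => ((x i)^*)%R * y i)
  (fun i => normc (x i) ^+ 2 + normc (y i) ^+ 2) (M + N).
  rewrite normcM normc_conj; have := sqr_ge0 (normc (x i) - normc (y i)).
  have := normc_ge0 (x i); have := normc_ge0 (y i); nra.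
by rewrite big_split /= lerD.
Qed.

Lemma l2_ipE x y z : sums_to (fun i => ((x i)^*)%R * y i) z -> l2_ip x y = z.
Proof.
move=> h; rewrite /l2_ip; case: xgetP => [w _ hw|/(_ z)//].
exact: sums_unique hw h.
Qed.

Definition ell2_ip (x y : ell2) := l2_ip x y.

Lemma ell2_ip_linear (z : C) (x y y' : ell2) :
  ell2_ip x (z *: y + y') = z * ell2_ip x y + ell2_ip x y'.
Proof.
apply: l2_ipE; have [hy hy'] := (l2_ip_sums (ell2P x) (ell2P y), l2_ip_sums (ell2P x) (ell2P y')).
by apply: eq_sums (sums_linear z hy hy') => i /=; rewrite -[(z *: _ + _) i]/(z * y i + y' i); ring.
Qed.

Lemma ell2_ip_conj (x y : ell2) : ell2_ip y x = ((ell2_ip x y)^*)%R.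
Proof.
apply: l2_ipE; apply: eq_sums (sums_conj (l2_ip_sums (ell2P x) (ell2P y))) => i.
by rewrite conjM conjCK mulrC.
Qed.

Let sqr_term x i : ((x i)^*)%R * x i = (normc (x i) ^+ 2)%:C%C.
Proof. exact: normc_sqr. Qed.

Let sqr_sum x F : (\sum_(i <- F) normc (x i) ^+ 2)%:C%C
  = \sum_(i <- F) ((x i)^*)%R * x i :> C.
Proof. by rewrite rmorph_sum; apply: eq_bigr => i _; rewrite sqr_term. Qed.

Lemma ell2_ip_ge0 (x : ell2) : 0 <= ell2_ip x x.
Proof.
apply: sums_ge0 (l2_ip_sums (ell2P x) (ell2P x)) => i.
by rewrite sqr_term ler0c sqr_ge0.
Qed.

Lemma ell2_ip_partial (x : ell2) F :
  \sum_(i <- F) normc (x i) ^+ 2 <= complex.Re (ell2_ip x x).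
Proof.
have h := sums_le F _ (l2_ip_sums (ell2P x) (ell2P x)).
rewrite -lecR -real_of_ge0 ?ell2_ip_ge0 // sqr_sum.
by apply: h => i; rewrite sqr_term ler0c sqr_ge0.
Qed.

Lemma ell2_ip_le (x : ell2) (M : R) :
  (forall F, \sum_(i <- F) normc (x i) ^+ 2 <= M) -> complex.Re (ell2_ip x x) <= M.
Proof.
move=> hM; apply/ler_addgt0Pl => e e0.
have [F /(_ F (fsubset_refl _))] := l2_ip_sums (ell2P x) (ell2P x) e0.
rewrite -sqr_sum -/(ell2_ip x x).
rewrite (real_of_ge0 (ell2_ip_ge0 x)) -rmorphB normc_real ltr_norml => /andP[h1 h2].
by have := hM F; move: h1 h2; rewrite /=; lra.
Qed.

Lemma ell2_ip_eq0 (x : ell2) : ell2_ip x x = 0 -> x = 0.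
Proof.
move=> h; apply: ell2_ext => i; apply: eq0_normc; apply/eqP.
have := ell2_ip_partial x [fset i]%fset; rewrite h big_seq_fset1 /= => le0.
by rewrite -sqrf_eq0 eq_le le0 sqr_ge0.
Qed.

Lemma ell2_complete (s : nat -> ell2) :
  (forall e : R, 0 < e -> exists N, forall m n, (N <= m)%N -> (N <= n)%N ->
     complex.Re (ell2_ip (s m - s n) (s m - s n)) < e) ->
  exists l, forall e : R, 0 < e -> exists N, forall n, (N <= n)%N ->
     complex.Re (ell2_ip (s n - l) (s n - l)) < e.
Proof.
move=> hs.
have part (e : R) : 0 < e -> exists N, forall m n F, (N <= m)%N -> (N <= n)%N ->
    \sum_(i <- F) normc (s m i - s n i) ^+ 2 < e.
  move=> e0; have [N hN] := hs e e0; exists N => m n F Nm Nn.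
  exact: le_lt_trans (ell2_ip_partial (s m - s n) F) (hN m n Nm Nn).
have /choice[l hl] (i : I) : exists z, forall e : R, 0 < e -> exists N, forall n,
    (N <= n)%N -> normc (s n i - z) < e.
  apply: Cplx_complete => e e0; have [|N hN] := part (e ^+ 2); first by rewrite exprn_gt0.
  exists N => m n Nm Nn; have := hN m n [fset i]%fset Nm Nn.
  by rewrite big_seq_fset1 ltr_pXn2r // nnegrE ?normc_ge0 // ltW.
have fin (e : R) (r : seq I) : 0 < e -> exists N, forall n, (N <= n)%N ->
    \sum_(i <- r) normc (s n i - l i) ^+ 2 <= e.
  elim: r e => [|i r IH] e e0; first by exists 0%N => n _; rewrite big_nil ltW.
  have e2 : 0 < e / 2 by rewrite divr_gt0.
  have [N hN] := IH _ e2.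
  have [|M hM] := hl i (Num.sqrt (e / 2)); first by rewrite sqrtr_gt0.
  exists (maxn N M) => n; rewrite geq_max big_cons => /andP[Nn Mn].
  have := hN n Nn; have := hM n Mn.
  rewrite -(ltr_pXn2r (n := 2)) ?nnegrE ?normc_ge0 ?sqrtr_ge0 // (sqr_sqrtr (ltW e2)).
  lra.
(* The rank N does not depend on F. The comparison goes through a later term [s m], with m depending
   on F; each of the two pieces contributes at most 2 e. *)
have lim (e : R) : 0 < e -> exists N, forall n F, (N <= n)%N ->
    \sum_(i <- F) normc (s n i - l i) ^+ 2 <= 4 * e.
  move=> e0; have [N hN] := part e e0; exists N => n F Nn.
  have [M hM] := fin e F e0; pose m := maxn N M.
  have h1 := hN n m F Nn (leq_maxl _ _); have h2 := hM m (leq_maxr _ _).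
  apply: le_trans (_ : \sum_(i <- F) (2 * normc (s n i - s m i) ^+ 2 + 2 * normc (s m i - l i) ^+ 2) <= _).
    apply: ler_sum => i _; have := sqr_normcD (s n i - s m i) (s m i - l i).
    by rewrite addrA subrK.
  rewrite big_split -!mulr_sumr /=; move: h1 h2; lra.
have l2l : l2 l.
  have [N /(_ N _ (leqnn _)) hN] := lim 1 ltr01.
  have h : l2 (fun i => s N i - l i) by exists (4 * 1).
  have := l2_linear (-1) h (ell2P (s N)); congr l2; apply/funext => i.
  rewrite -[LHS]/((-1) * (s N i - l i) + s N i); ring.
exists (mkell2 l2l) => e e0; have [|N hN] := lim (e / 8); first by rewrite divr_gt0.
exists N => n Nn; apply: le_lt_trans (_ : 4 * (e / 8) < _); last by lra.
by apply: ell2_ip_le => F; exact: hN.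
Qed.

Definition basis (i0 : I) : I -> C := fun i => if i == i0 then 1 else 0.

Lemma l2_basis i0 : l2 (basis i0).
Proof.
exists 1 => F; rewrite /basis; have [iF|iF] := boolP (i0 \in F).
  rewrite (big_fsetD1 i0) //= eqxx normc1 expr1n big_seq big1 ?addr0 //.
  by move=> i; rewrite !inE => /andP[/negbTE -> _]; rewrite normc0 expr0n.
rewrite big_seq big1 // => i iF'; case: eqP => [e|_]; last by rewrite normc0 expr0n.
by rewrite e (negbTE iF) in iF'.
Qed.

Definition ell2_basis i0 : ell2 := mkell2 (l2_basis i0).

Lemma ell2_neq0 (i0 : I) : exists x : ell2, x != 0.
Proof.
exists (ell2_basis i0); apply/eqP => /(congr1 (fun x : ell2 => x i0)).
rewrite /= /basis eqxx => h; move: (oner_neq0 C).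
by rewrite h; case/eqP.
Qed.

Definition ell2_hilbert (i0 : I) : hilbert_space R :=
  HilbertSpace ell2_ip_linear ell2_ip_conj ell2_ip_ge0 ell2_ip_eq0 ell2_complete
    (ell2_neq0 i0).

End SquareSummable.

Section EllTwoOperators.
Variables (R : realType) (I : choiceType) (i0 : I).
Local Notation C := (Cplx R).
Local Notation V := (ell2_hilbert R i0).

Lemma bounded_op_mul (m : I -> C) : (exists M, forall i, normc (m i) <= M) ->
  exists2 T : bop V, forall (x : V) i, T x i = m i * x i &
    forall (x : V) i, star T x i = ((m i)^*)%R * x i.
Proof.
move=> [M hM].
have M0 : 0 <= M by apply: le_trans (hM i0); exact: normc_ge0.
have sum_le (n : I -> C) (x : ell2 R I) (F : {fset I}) : (forall i, normc (n i) <= M) ->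
    \sum_(i <- F) normc (n i * x i) ^+ 2 <= M ^+ 2 * complex.Re (ell2_ip x x).
  move=> hn; apply: le_trans (ler_wpM2l (sqr_ge0 M) (ell2_ip_partial x F)).
  rewrite mulr_sumr; apply: ler_sum => i _; rewrite normcM exprMn.
  by rewrite ler_wpM2r ?sqr_ge0 // ler_pXn2r ?nnegrE ?normc_ge0.
have hl2 n (hn : forall i, normc (n i) <= M) (x : ell2 R I) : l2 (fun i => n i * x i).
  by exists (M ^+ 2 * complex.Re (ell2_ip x x)) => F; exact: sum_le.
have hM' i : normc ((m i)^*)%R <= M by rewrite normc_conj.
pose T (x : V) : V := mkell2 (hl2 m hM x).
pose T' (x : V) : V := mkell2 (hl2 (fun i => ((m i)^*)%R) hM' x).
have adj : is_adjoint T T'.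
  move=> x y; apply: (l2_ipE (x := T x)).
  apply: eq_sums (l2_ip_sums (ell2P x) (ell2P (T' y))) => i /=.
  by rewrite conjM; ring.
have bT : bounded_op T.
  split; first by exists T'.
  exists M; split=> // x; rewrite -(ler_pXn2r (n := 2)) ?nnegrE ?mulr_ge0 ?hnorm_ge0 //.
  rewrite exprMn -!hnorm_Re; apply: (ell2_ip_le (x := T x)) => F; exact: sum_le.
exists (mkbop bT) => // x i.
have -> : star (mkbop bT) x = T' x; last by [].
by rewrite /star /= (is_adjoint_unique (bop_starP (mkbop bT)) adj).
Qed.

Lemma bounded_op_perm (s s' : I -> I) : cancel s s' -> cancel s' s ->
  exists2 T : bop V, forall (x : V) i, T x i = x (s i) &
    forall (x : V) i, star T x i = x (s' i).
Proof.
move=> ss' s's.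
have sum_le (r r' : I -> I) (x : ell2 R I) (F : {fset I}) : cancel r r' -> cancel r' r ->
    \sum_(i <- F) normc (x (r i)) ^+ 2 <= complex.Re (ell2_ip x x).
  move=> rr' r'r; apply: le_trans (ell2_ip_partial x [fset r i | i in F]%fset).
  by rewrite big_imfset //= => i j _ _; exact: (can_inj rr').
have hl2 (r r' : I -> I) (rr' : cancel r r') (r'r : cancel r' r) (x : ell2 R I) : l2 (fun i => x (r i)).
  by exists (complex.Re (ell2_ip x x)) => F; exact: (sum_le r r').
pose T (x : V) : V := mkell2 (hl2 s s' ss' s's x).
pose T' (x : V) : V := mkell2 (hl2 s' s s's ss' x).
have adj : is_adjoint T T'.
  move=> x y; apply: (l2_ipE (x := T x)).
  apply: eq_sums (sums_reindex ss' s's (l2_ip_sums (ell2P x) (ell2P (T' y)))) => i /=.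
  by rewrite ss'.
have bT : bounded_op T.
  split; first by exists T'.
  exists 1; split=> // x; rewrite -(ler_pXn2r (n := 2)) ?nnegrE ?mulr_ge0 ?hnorm_ge0 //.
  rewrite mul1r -!hnorm_Re; apply: (ell2_ip_le (x := T x)) => F.
  exact: (sum_le s s').
exists (mkbop bT) => // x i.
have -> : star (mkbop bT) x = T' x; last by [].
by rewrite /star /= (is_adjoint_unique (bop_starP (mkbop bT)) adj).
Qed.

Lemma ell2_basisE (i j : I) : ell2_basis R i j = if j == i then 1 else 0.
Proof. by []. Qed.

Lemma ell2_ip_basis (i : I) (x : ell2 R I) : ell2_ip (ell2_basis R i) x = x i.
Proof.
apply: l2_ipE; have -> : x i = ((ell2_basis R i i)^*)%R * x i.
  by rewrite ell2_basisE eqxx conj1 mul1r.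
apply: (@sums_single _ _ (fun j => ((ell2_basis R i j)^*)%R * x j)) => j ji.
by rewrite ell2_basisE (negbTE ji) conj0 mul0r.
Qed.

End EllTwoOperators.

(** * Continuity of complex-valued functions *)

Section ContinuousFunctions.
Variables (R : realType) (X : topologicalType).
Local Notation C := (Cplx R).
Implicit Types f g : X -> C.

Lemma continuous_linear (z : C) f g : continuous f -> continuous g ->
  continuous (fun x => z * f x + g x).
Proof.
move=> cf cg x; apply: cvgD; last exact: cg.
by apply: cvgM; [exact: cvg_cst|exact: cf].
Qed.

Lemma continuous_mul f g : continuous f -> continuous g ->
  continuous (fun x => f x * g x).
Proof. by move=> cf cg x; apply: cvgM; [exact: cf|exact: cg]. Qed.

Lemma continuous_const (z : C) : continuous (fun _ : X => z).
Proof. by move=> x; exact: cvg_cst. Qed.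

(** A positive element of [C] is real, so the distances that control convergence may be taken in
    [R]. *)
Lemma cvg_normcP (T : Type) (F : set_system T) (FF : Filter F) (f : T -> C) (l : C) :
  (f @ F --> l) <-> (forall e : R, 0 < e -> \forall x \near F, normc (f x - l) < e).
Proof.
split=> [/cvgrPdist_lt h e e0|h].
  have e0' : 0 < (e%:C%C : C) by rewrite ltcR.
  near=> x; have : `|l - f x| < e%:C%C by near: x; exact: h.
  by rewrite distrC normr_normc ltcR.
apply/cvgrPdist_lt => e e0.
have eE : e = (complex.Re e)%:C%C by apply: real_of_ge0; exact: ltW.
have e0' : 0 < complex.Re e by move: (e0); rewrite {1}eE ltcR.
near=> x; rewrite distrC normr_normc eE ltcR; near: x; exact: h.
Unshelve. all: by end_near. Qed.

Lemma continuous_conj f : continuous f -> continuous (fun x => ((f x)^*)%R).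
Proof.
move=> cf x; apply/cvg_normcP => e e0.
have /cvg_normcP /(_ e e0) := cf x; apply: filterS => y.
by rewrite -conjB normc_conj.
Qed.

Lemma continuous_real (P : X -> R) : continuous P -> continuous (fun x => (P x)%:C%C : C).
Proof.
move=> cP x; apply/cvg_normcP => e e0.
have /cvgrPdist_lt /(_ e e0) := cP x; apply: filterS => y.
by rewrite -rmorphB normc_real distrC.
Qed.

Lemma continuous_normc f : continuous f -> continuous (fun x => normc (f x)).
Proof.
move=> cf x; apply/cvgrPdist_lt => e e0.
have /cvg_normcP /(_ e e0) := cf x; apply: filterS => y; apply: le_lt_trans.
have h1 := le_normcD (f y) (f x - f y); have h2 := le_normcD (f x) (f y - f x).
rewrite addrC subrK in h1; rewrite addrC subrK in h2.
by have := normc_distr (f x) (f y); rewrite ler_norml; lra.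
Qed.

Lemma compact_bounded_fun f : compact [set: X] -> continuous f ->
  exists M, forall x, normc (f x) <= M.
Proof.
move=> cX cf.
have : compact ((fun x => normc (f x)) @` [set: X]).
  apply: continuous_compact => //.
  by apply: continuous_subspaceT; exact: continuous_normc.
move=> /compact_bounded [M [_ hM]]; exists (M + 1) => x.
have := hM (M + 1); rewrite ltrDl => /(_ ltr01 (normc (f x))) /=.
by rewrite ger0_norm ?normc_ge0 //; apply; exists x.
Qed.

End ContinuousFunctions.

(** * Fourier coefficients of the full crossed product *)

Section CoefficientFunctionals.
Variables (R : realType) (Gam G : topologicalGroupType) (al : Gam -> G -> G).
Local Notation C := (Cplx R).
Hypothesis al1 : forall g, al 1%g g = g.
Hypothesis alM : forall c d g, al (c * d)%g g = al c (al d g).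
Variables (A : cstarAlgType R) (a : (G -> C) -> A) (u : Gam -> A).
Hypothesis HA : is_full_crossed_product al a u.
Hypothesis al_continuous : forall c, continuous (al c).
Hypothesis bdd : forall F : G -> C, continuous F -> exists M, forall g, normc (F g) <= M.

Lemma al_comp_continuous c (F : G -> C) : continuous F -> continuous (fun g => F (al c g)).
Proof. by move=> cF g; apply: continuous_comp; [exact: al_continuous|exact: cF]. Qed.

(* [coef c x] is the coefficient at [c] of [x delta_1], for the regular
   representation of the crossed product over the orbit of [g]. *)
Lemma coefficients (g : G) : exists coef : Gam -> A -> C,
  [/\ forall c z x y, coef c (z *: x + y) = z * coef c x + coef c y,
      forall c d (F : G -> C), continuous F -> coef c (u d * a F) = if c == d then F g else 0,
      forall c x, coef c x = coef 1%g (star (u c) * x) &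
      forall x y, sums_to (fun c => ((coef c x)^*)%R * coef c y) (coef 1%g (star x * y))].
Proof.
pose V := ell2_hilbert R (1%g : Gam).
(* Translation of the argument by d^-1 is the operator that sends delta_c to delta_(dc). *)
have hU (d : Gam) : exists T : bop V, (forall (x : V) c, T x c = x (d^-1 * c)%g) /\
    (forall (x : V) c, star T x c = x (d * c)%g).
  have [||T h h'] := @bounded_op_perm R _ (1%g : Gam) (fun c => (d^-1 * c)%g) (fun c => (d * c)%g).
  - by move=> c; rewrite mulgA mulgV mul1g.
  - by move=> c; rewrite mulgA mulVg mul1g.
  by exists T.
have mE (S T : bop V) x : (S * T) x = S (T x) by [].
have oE (x : V) : (1 : bop V) x = x by [].
have [U hU'] := choice hU.
(* The operator must be chosen for every F; on discontinuous functions, where covariance demands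
   nothing, it is 0. *)
have hM (F : G -> C) : exists T : bop V, continuous F ->
    (forall (x : V) c, T x c = F (al c g) * x c) /\
    (forall (x : V) c, star T x c = ((F (al c g))^*)%R * x c).
  have [cF|ncF] := pselect (continuous F); last by exists 0 => /ncF.
  have [|T h h'] := @bounded_op_mul R _ (1%g : Gam) (fun c => F (al c g)).
    by have [M hM] := bdd cF; exists M.
  by exists T.
have [M hM'] := choice hM.
have cov : covariant_pair al M U.
  split.
  - split.
    + move=> z F F' cF cF'; have cz : continuous (fun x => z * F x + F' x).
        exact: continuous_linear.
      apply: bop_ext => x; apply: ell2_ext => c.
      rewrite (hM' _ cz).1 -[(z *: M F + M F') x c]/(z * M F x c + M F' x c).
      by rewrite (hM' _ cF).1 (hM' _ cF').1; ring.
    + move=> F F' cF cF'; have cz : continuous (fun x => F x * F' x).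
        exact: continuous_mul.
      apply: bop_ext => x; apply: ell2_ext => c.
      rewrite (hM' _ cz).1 mE.
      by rewrite (hM' _ cF).1 (hM' _ cF').1 mulrA.
    + apply: bop_ext => x; apply: ell2_ext => c.
      by rewrite (hM' (fun=> 1) (@continuous_const R G 1)).1 mul1r.
    + move=> F cF; have cz : continuous (fun x => ((F x)^*)%R).
        exact: continuous_conj.
      apply: bop_ext => x; apply: ell2_ext => c.
      by rewrite (hM' _ cz).1 (hM' _ cF).2.
  - move=> c; split; apply: bop_ext => x; apply: ell2_ext => d.
      by rewrite mE oE (hU' c).2 (hU' c).1 mulgA mulVg mul1g.
    by rewrite mE oE (hU' c).1 (hU' c).2 mulgA mulgV mul1g.
  - move=> c d; apply: bop_ext => x; apply: ell2_ext => e.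
    by rewrite mE !(hU' _).1 invgM mulgA.
  - move=> c F cF; have cz : continuous (fun g => F (al (c^-1)%g g)).
      exact: al_comp_continuous.
    apply: bop_ext => x; apply: ell2_ext => e.
    by rewrite !mE (hU' c).1 (hM' _ cF).1 (hU' c).2 (hM' _ cz).1 mulgA mulgV mul1g alM.
have [pi [pil pim pi1 pis] [pia piu]] := fcp_universal HA cov.
pose xi : V := ell2_basis R (1%g : Gam).
exists (fun c x => pi x xi c); split.
- by move=> c z x y; rewrite pil.
- move=> c d F cF; rewrite pim pia // piu.
  rewrite mE (hU' d).1 (hM' _ cF).1 ell2_basisE.
  have [->|cd] := eqVneq c d; first by rewrite mulVg eqxx al1 mulr1.
  case: eqP => [e|_]; last by rewrite mulr0.
  by move: cd; rewrite -[c]mul1g -(mulgV d) -mulgA e mulg1 eqxx.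
- move=> c x; rewrite pim pis piu.
  by rewrite mE (hU' c).2 mulg1.
(* The coefficient at 1 of star x y is <pi x xi, pi y xi>, and Parseval's identity is the defining
   sum of this inner product. *)
- move=> x y; rewrite pim pis -ell2_ip_basis.
  have -> : ell2_ip xi ((star (pi x) * pi y) xi) = ell2_ip (pi x xi) (pi y xi).
    by rewrite mE; exact: (esym (bop_starP (pi x) xi (pi y xi))).
  exact: l2_ip_sums (ell2P (pi x xi)) (ell2P (pi y xi)).
Qed.

End CoefficientFunctionals.

(** * Matched pairs *)

(** Near-covering compactness is applied to the filter generated by the supersets of finite sets and
    to the relation that B contains x. It holds near each point because singletons are open, and
    uniformity over K puts K inside a finite set. *)
Lemma compact_discrete_finite (X : topologicalType) (K : set X) :
  (forall x : X, open [set x]) -> compact K -> finite_set K.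
Proof.
move=> oX; pose F : set_system (set X) :=
  filter_from (@finite_set X) (fun D => [set B : set X | D `<=` B]).
have FF : Filter F.
  apply: filter_from_filter => [|D E fD fE]; first by exists set0; exact: finite_set0.
  exists (D `|` E); first by rewrite finite_setU.
  by move=> B /= DEB; split=> x ?; apply: DEB; [left|right].
move=> /compact_near_coveringP /(_ _ F (fun B x => B x) FF) [x _|D fD hD].
  exists ([set x], [set B : set X | B x]).
    split; first exact: open_nbhs_nbhs (conj (oX x) erefl).
    by exists [set x]; [exact: finite_set1|move=> B /= xB; exact: xB].
  by move=> [y B] /= [->].
exact: sub_finite_set (hD D (@subset_refl _ D)) fD.
Qed.

Section TopologicalGroups.
Variable H : topologicalGroupType.
Implicit Types K L : set H.

(** A point x lies outside the product when k^-1 x avoids L for all k in K. This condition is open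
    in (k, x), and compactness of K makes it hold on one neighbourhood of x. *)
Lemma compact_mul_closed K L : compact K -> closed L ->
  closed [set (k * l : H)%g | k in K & l in L].
Proof.
move=> cK cL; rewrite -[X in closed X]setCK; apply: open_closedC.
rewrite openE => x nx; rewrite /interior.
have /compact_near_coveringP/(_ _ (nbhs x) (fun y k => ~ L (k^-1 * y)%g)) := cK.
have cont : continuous (fun p : H * H => (p.1^-1 * p.2)%g).
  move=> p; apply: (@continuous_comp _ _ _ (fun p : H * H => ((p.1^-1)%g, p.2))
    (fun p : H * H => (p.1 * p.2)%g)); last exact: mulg_continuous.
  apply: cvg_pair; last exact: cvg_snd.
  by apply: continuous_comp; [exact: cvg_fst|exact: invg_continuous].
move=> /(_ (nbhs_filter x)) near_cover.
suff /near_cover : forall k, K k -> \forall k' \near k & y \near nbhs x, ~ L (k'^-1 * y)%g.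
  apply: filterS => y hy [k Kk [l Ll ky]].
  by apply: (hy k Kk); rewrite -ky mulgA mulVg mul1g.
move=> k Kk.
have nL : (~` L) (k^-1 * x)%g.
  move=> Lk; apply: nx; exists k => //; exists (k^-1 * x)%g => //.
  by rewrite mulgA mulgV mul1g.
have oL : open (~` L) by exact: closed_openC.
have : nbhs (k, x) ((fun p : H * H => (p.1^-1 * p.2)%g) @^-1` (~` L)).
  by apply: cont; exact: open_nbhs_nbhs.
by [].
Qed.

End TopologicalGroups.

Section MatchedPair.
Variables (H Gam G : topologicalGroupType) (iGam : Gam -> H) (iG : G -> H).
Hypothesis embGam : closed_subgroup_embedding iGam.
Hypothesis embG : closed_subgroup_embedding iG.
Hypothesis interE : range iGam `&` range iG = [set 1%g].
Hypothesis Gam_discrete : forall c : Gam, open [set c].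
Hypothesis G_compact : compact [set: G].
Variables (al : Gam -> G -> G) (be : G -> Gam -> Gam).
Hypothesis Hact : matched_actions iGam iG al be.

Let iGamM x y : iGam (x * y)%g = (iGam x * iGam y)%g. Proof. by case: embGam. Qed.
Let iGM x y : iG (x * y)%g = (iG x * iG y)%g. Proof. by case: embG. Qed.

Let emb1 (K : topologicalGroupType) (i : K -> H) :
  (forall x y, i (x * y)%g = (i x * i y)%g) -> i 1%g = 1%g.
Proof. by move=> h; apply: (mulgI (i 1%g)); rewrite -h !mulg1. Qed.

Let iGam1 : iGam 1%g = 1%g := emb1 iGamM.
Let iG1 : iG 1%g = 1%g := emb1 iGM.

Let iGamV x : iGam (x^-1)%g = ((iGam x)^-1)%g.
Proof. by apply: (mulgI (iGam x)); rewrite -iGamM !mulgV iGam1. Qed.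

Let iGV x : iG (x^-1)%g = ((iG x)^-1)%g.
Proof. by apply: (mulgI (iG x)); rewrite -iGM !mulgV iG1. Qed.

(** Source of all the identities of the two actions: an element of [H] is factored in two ways and
    the factors are compared. *)
Lemma matched_factor_unique g g' c c' :
  (iG g * iGam c = iG g' * iGam c')%g -> g = g' /\ c = c'.
Proof.
move=> e.
have e' : (iG (g'^-1 * g) = iGam (c' * c^-1))%g.
  by rewrite iGM iGamM iGV iGamV -[X in (_ * X = _)%g](mulgK (iGam c)) e -!mulgA mulKg.
have /= : [set 1%g : H] (iG (g'^-1 * g)%g).
  by rewrite -interE; split; [rewrite e'; exists (c' * c^-1)%g|exists (g'^-1 * g)%g].
have [_ injGam _ _] := embGam; have [_ injG _ _] := embG.
move=> h; have h1 : (g'^-1 * g)%g = 1%g by apply: injG; rewrite h iG1.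
have h2 : (c' * c^-1)%g = 1%g by apply: injGam; rewrite -e' h iGam1.
split; first by rewrite -[g]mul1g -(mulgV g') -mulgA h1 mulg1.
by rewrite -[c']mulg1 -(mulVg c) mulgA h2 mul1g.
Qed.

Lemma matched_alM c d g : al (c * d)%g g = al c (al d g) /\
  be g (c * d)%g = (be (al d g) c * be g d)%g.
Proof.
apply: matched_factor_unique; rewrite -Hact !iGamM.
by rewrite -mulgA (Hact d g) mulgA (Hact c) mulgA.
Qed.

Lemma matched_beM c g h : al c (g * h)%g = (al c g * al (be g c) h)%g /\
  be (g * h)%g c = be h (be g c).
Proof.
apply: matched_factor_unique; rewrite -Hact !iGM.
by rewrite mulgA (Hact c g) -mulgA (Hact _ h) mulgA.
Qed.

Lemma matched_al1 g : al 1%g g = g /\ be g 1%g = 1%g.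
Proof. by apply: matched_factor_unique; rewrite -Hact iGam1 mul1g mulg1. Qed.

Lemma matched_be1 c : al c 1%g = 1%g /\ be 1%g c = c.
Proof. by apply: matched_factor_unique; rewrite -Hact iG1 mul1g mulg1. Qed.

Let all_closed (F : set Gam) : closed F.
Proof.
rewrite -[F]setCK; apply: open_closedC.
have -> : ~` F = \bigcup_(c in ~` F) [set c].
  by apply/seteqP; split=> [x Fx|x [c Fc ->]//]; exists x.
by apply: bigcup_open => c _; exact: Gam_discrete.
Qed.

(* The set is the preimage under [g |-> c g] of the product of the compact set G
   and of a closed subset of Gamma. *)
Lemma matched_be_closed c (F : set Gam) : closed [set g | F (be g c)].
Proof.
have [_ _ cGam clGam] := embGam; have [_ _ cG _] := embG.
have -> : [set g | F (be g c)] = (fun g => iGam c * iG g)%g @^-1`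
    [set (k * l : H)%g | k in range iG & l in iGam @` F].
  apply/seteqP; split=> g /=.
    move=> Fg; exists (iG (al c g)); first by exists (al c g).
    by exists (iGam (be g c)); [exists (be g c)|rewrite Hact].
  by case=> _ [x _ <-] [_ [d Fd <-]]; rewrite Hact => /matched_factor_unique [_ <-].
apply: closed_comp.
  move=> g _; apply: (@continuous_comp _ _ _ (fun g => (iGam c, iG g))
    (fun p : H * H => (p.1 * p.2)%g)); last exact: mulg_continuous.
  by apply: cvg_pair; [exact: cvg_cst|exact: cG].
have cK : compact (range iG).
  by apply: continuous_compact => //; exact: continuous_subspaceT.
exact: compact_mul_closed cK (clGam F (@all_closed F)).
Qed.

Lemma matched_be_open c (F : set Gam) : open [set g | F (be g c)].
Proof.
rewrite -[X in open X]setCK; apply: closed_openC.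
exact: (@matched_be_closed c (~` F)).
Qed.

(** In [H], alpha_c(g) is c g beta_g(c)^-1, and g |-> beta_g(c) is continuous into the discrete
    group; the closed embedding [iG] brings the continuity back to G. *)
Lemma matched_al_continuous c : continuous (al c).
Proof.
have [_ injG cG clG] := embG; have [_ _ cGam _] := embGam.
apply/continuous_closedP => F cF.
have -> : al c @^-1` F = (fun g => iGam c * iG g * (iGam (be g c))^-1)%g @^-1` (iG @` F).
  apply/seteqP; split=> g /=; rewrite Hact mulgK.
    by move=> Fg; exists (al c g).
  by case=> g' Fg' /injG <-.
apply: closed_comp; last exact: clG.
have cbe : continuous (fun g => be g c).
  by apply/continuousP => A _; exact: matched_be_open.
move=> g _; apply: (@continuous_comp _ _ _
    (fun g => (iGam c * iG g, (iGam (be g c))^-1)%g)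
    (fun p : H * H => (p.1 * p.2)%g)); last exact: mulg_continuous.
apply: cvg_pair.
  apply: (@continuous_comp _ _ _ (fun g => (iGam c, iG g))
    (fun p : H * H => (p.1 * p.2)%g)); last exact: mulg_continuous.
  by apply: cvg_pair; [exact: cvg_cst|exact: cG].
apply: (@continuous_comp _ _ _ (fun g => iGam (be g c)) (fun x : H => x^-1)%g); last exact: invg_continuous.
by apply: (@continuous_comp _ _ _ (fun g => be g c) iGam); [exact: cbe|exact: cGam].
Qed.

Lemma matched_orbit_finite c : finite_set (range (fun g => be g c)).
Proof.
have cbe : continuous (fun g => be g c).
  by apply/continuousP => A _; exact: matched_be_open.
have : compact (range (fun g => be g c)).
  by apply: continuous_compact => //; exact: continuous_subspaceT.
exact: compact_discrete_finite.
Qed.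

Lemma matched_G_hausdorff : hausdorff_space H -> hausdorff_space G.
Proof.
have [_ injG cG _] := embG => hH x y xy; apply: injG; apply: hH.
move=> A B Ax By; have [z [Az Bz]] := xy _ _ (cG x _ Ax) (cG y _ By).
by exists (iG z).
Qed.

End MatchedPair.

(** What remains of the matched pair once the ambient group has been used: the two actions, their
    cocycle-type product rules, and the topological facts. *)
Record matched_system (Gam G : topologicalGroupType) (al : Gam -> G -> G)
    (be : G -> Gam -> Gam) : Prop := {
  ms_al1 : forall g, al 1%g g = g;
  ms_alM : forall c d g, al (c * d)%g g = al c (al d g);
  ms_alMr : forall c g h, al c (g * h)%g = (al c g * al (be g c) h)%g;
  ms_al1r : forall c, al c 1%g = 1%g;
  ms_be1 : forall c, be 1%g c = c;
  ms_beM : forall g h c, be (g * h)%g c = be h (be g c);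
  ms_beMr : forall g c d, be g (c * d)%g = (be (al d g) c * be g d)%g;
  ms_be1r : forall g, be g 1%g = 1%g;
  ms_al_continuous : forall c, continuous (al c);
  ms_be_open : forall c (F : set Gam), open [set g | F (be g c)];
  ms_orbit_finite : forall c, finite_set (range (fun g => be g c));
  ms_hausdorff : hausdorff_space G;
  ms_compact : compact [set: G]
}.

Lemma matched_pair_system (R : realType) (H Gam G : topologicalGroupType)
    (iGam : Gam -> H) (iG : G -> H) (al : Gam -> G -> G) (be : G -> Gam -> Gam) :
  matched_pair R iGam iG -> (forall c : Gam, open [set c]) -> compact [set: G] ->
  matched_actions iGam iG al be -> matched_system al be.
Proof.
case=> hH _ eGam eG [inter _] dGam cG act.
have alM := matched_alM eGam eG inter act.
have beM := matched_beM eGam eG inter act.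
have al1 := matched_al1 eGam eG inter act.
have be1 := matched_be1 eGam eG inter act.
split.
- by move=> g; case: (al1 g).
- by move=> c d g; case: (alM c d g).
- by move=> c g h; case: (beM c g h).
- by move=> c; case: (be1 c).
- by move=> c; case: (be1 c).
- by move=> g h c; case: (beM c g h).
- by move=> g c d; case: (alM c d g).
- by move=> g; case: (al1 g).
- exact: (matched_al_continuous eGam eG inter dGam cG act).
- by move=> c F; exact: (matched_be_open eGam eG inter dGam cG act).
- exact: (matched_orbit_finite eGam eG inter dGam cG act).
- exact: (matched_G_hausdorff eG hH).
- exact: cG.
Qed.

(** * Continuous functions on a compact group *)

Section FunctionAlgebras.
Variables (R : realType) (X : topologicalType) (B : cstarAlgType R).
Local Notation C := (Cplx R).
Variables (f : (X -> C) -> B) (L : B -> C).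
Hypotheses (hf : star_hom_of_functions f) (pL : positive_functional L).

Lemma star_hom_sqr (F : X -> C) : continuous F ->
  star (f F) * f F = f (fun x => (normc (F x) ^+ 2)%:C%C).
Proof.
case: hf => _ fM _ fS cF; rewrite -(fS F cF) -(fM _ _ (continuous_conj cF) cF).
by congr f; apply/funext => x; rewrite normc_sqr.
Qed.

(** The pointwise square root of P is continuous, so the image of P is of the form star y y. *)
Lemma star_hom_pos (P : X -> R) : continuous P -> (forall x, 0 <= P x) ->
  0 <= L (f (fun x => (P x)%:C%C)).
Proof.
move=> cP P0.
have cS : continuous (fun x => (Num.sqrt (P x))%:C%C : C).
  apply: continuous_real => x; apply: (@continuous_comp _ _ _ P Num.sqrt); first exact: cP.
  exact: sqrt_continuous.
have := pL.2 (f (fun x => (Num.sqrt (P x))%:C%C)); rewrite star_hom_sqr //.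
congr (0 <= L (f _)); apply/funext => x.
by rewrite normc_real ger0_norm ?sqrtr_ge0 // sqr_sqrtr.
Qed.

Lemma star_hom_dominated (F : X -> C) (P : X -> R) : continuous F -> continuous P ->
  (forall x, normc (F x) ^+ 2 <= P x) ->
  L (star (f F) * f F) <= L (f (fun x => (P x)%:C%C)).
Proof.
move=> cF cP hP; rewrite star_hom_sqr //.
have cN : continuous (fun x => normc (F x) ^+ 2).
  by move=> x; apply: cvgM; exact: continuous_normc.
have cD : continuous (fun x => P x - normc (F x) ^+ 2).
  by move=> x; apply: cvgB; [exact: cP|exact: cN].
have P0 x : 0 <= P x - normc (F x) ^+ 2 by rewrite subr_ge0.
have := star_hom_pos cD P0.
have -> : (fun x => (P x - normc (F x) ^+ 2)%:C%C) =
    (fun x => (-1) * ((normc (F x) ^+ 2)%:C%C : C) + (P x)%:C%C).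
  by apply/funext => x; rewrite rmorphB; ring.
case: hf => fl _ _ _; rewrite (fl _ _ _ (continuous_real cN) (continuous_real cP)).
by rewrite pL.1 mulN1r addrC subr_ge0.
Qed.

Lemma star_hom_const (z : C) : L (f (fun=> z)) = z * L 1.
Proof.
case: hf => fl _ f1 _.
have := fl z (fun=> 1) (fun=> 0) (@continuous_const R X 1) (@continuous_const R X 0).
have -> : (fun x : X => z * 1 + 0) = (fun=> z) by apply/funext => x; rewrite mulr1 addr0.
have := fl 0 (fun=> 1) (fun=> 1) (@continuous_const R X 1) (@continuous_const R X 1).
have f0 : f (fun=> 0) = 0.
  have := fl (-1) (fun=> 0) (fun=> 0) (@continuous_const R X 0) (@continuous_const R X 0).
  have -> : (fun x : X => -1 * 0 + 0) = (fun=> 0 : C) by apply/funext => x; rewrite mulr0 addr0.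
  by rewrite scaleN1r addNr.
by move=> _ ->; rewrite f0 f1 addr0 (lfunZ pL.1).
Qed.

Lemma star_hom_bounded (F : X -> C) (M : R) : continuous F ->
  (forall x, normc (F x) ^+ 2 <= M) -> L (star (f F) * f F) <= M%:C%C * L 1.
Proof.
move=> cF hM; have cM : continuous (fun _ : X => M : R) by move=> x; exact: cvg_cst.
by have := star_hom_dominated cF cM hM; rewrite star_hom_const.
Qed.

End FunctionAlgebras.

Section Separation.
Variables (R : realType) (X : topologicalType).
Local Notation C := (Cplx R).
Hypotheses (hX : hausdorff_space X) (cX : compact [set: X]).

Lemma urysohn_point (x : X) (U : set X) : nbhs x U -> exists th : X -> R,
  [/\ continuous th, forall y, 0 <= th y, th x = 0 & forall y, ~ U y -> th y = 1].
Proof.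
move=> Ux; have := @normal_completely_regular R X (compact_normal hX cX) (hausdorff_accessible hX).
move=> /(_ x (~` U°)) [||].
- by apply: open_closedC; exact: open_interior.
- by move=> n; apply: n; exact: Ux.
- move=> uT [E sep]; have /(@uniform_separatorP X R) : uniform_separator [set x] (~` U°) by exists uT, E.
  move=> [th [cth h01 h0 h1]]; exists th; split=> //.
  + move=> y; have : `[0, 1]%classic (th y) by apply: h01; exists y.
    by rewrite /= in_itv /= => /andP[].
  + by apply: h0; exists x.
  + by move=> y Uy; apply: h1; exists y => // /interior_subset.
Qed.

Lemma continuous_functions_separate (x y : X) :
  (forall F : X -> C, continuous F -> F x = F y) -> x = y.
Proof.
move=> h; apply/eqP; apply: contraT => xy.
have Ux : nbhs x (~` [set y]).
  apply: open_nbhs_nbhs; split; last by move=> e; move: xy; rewrite e eqxx.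
  apply: closed_openC; apply: accessible_closed_set1; exact: hausdorff_accessible.
have [th [cth _ th0 th1]] := urysohn_point Ux.
have := h _ (continuous_real cth); rewrite th0 (th1 y) //; last by move=> n; exact: n.
by move=> [] /eqP; rewrite eq_sym oner_eq0.
Qed.

End Separation.

(** * Evaluating one leg of a function of two variables *)

Section Comultiplication.
Variables (R : realType) (G : topologicalGroupType) (A T : cstarAlgType R).
Local Notation C := (Cplx R).
Hypotheses (hG : hausdorff_space G) (cG : compact [set: G]).
Variables (t : A -> A -> T) (a : (G -> C) -> A) (aa : (G * G -> C) -> T).
Hypotheses (haa : star_hom_of_functions aa) (ha : star_hom_of_functions a).
Hypothesis aaE : forall F F' : G -> C, continuous F -> continuous F' ->
  aa (fun p => F p.1 * F' p.2) = t (a F) (a F').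

Lemma continuous_mulgl (F : G -> C) : continuous F ->
  continuous (fun p : G * G => F (p.1 * p.2)%g).
Proof.
by move=> cF p; apply: (@continuous_comp _ _ _ (fun p : G * G => (p.1 * p.2)%g) F);
  [exact: mulg_continuous|exact: cF].
Qed.

Lemma continuous_translate (h : G) (F : G -> C) : continuous F ->
  continuous (fun g => F (g * h)%g).
Proof.
move=> cF g; apply: (@continuous_comp _ _ _ (fun g => (g, h)) (fun p : G * G => F (p.1 * p.2)%g)).
  by apply: cvg_pair; [exact: cvg_id|exact: cvg_cst].
exact: (continuous_mulgl cF).
Qed.

Lemma continuous_fst (F : G -> C) : continuous F -> continuous (fun p : G * G => F p.1).
Proof.
by move=> cF p; apply: (@continuous_comp _ _ _ fst F); [exact: cvg_fst|exact: cF].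
Qed.

Lemma continuous_snd (X : topologicalType) (F : G -> X) :
  continuous F -> continuous (fun p : G * G => F p.2).
Proof.
by move=> cF p; apply: (@continuous_comp _ _ _ snd F); [exact: cvg_snd|exact: cF].
Qed.

(* [F (x y) - F (x h)] is, up to epsilon, dominated by a function of [y] alone
   that vanishes at [h]; this replaces the Stone-Weierstrass theorem. *)
Lemma comult_evaluation (L : T -> C) (h : G) (tau : T) (F : G -> C) :
  positive_functional L ->
  (forall F' : G -> C, continuous F' -> L (t 1 (a F')) = F' h * L 1) -> continuous F ->
  L (tau * aa (fun p => F (p.1 * p.2)%g)) = L (tau * t (a (fun g => F (g * h)%g)) 1).
Proof.
move=> pL hL cF.
have a1 : a (fun=> 1) = 1 by case: ha.
pose K (p : G * G) := (-1) * F (p.1 * h)%g + F (p.1 * p.2)%g.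
have cFh := @continuous_translate h F cF.
have cK : continuous K.
  by apply: continuous_linear; [exact: (continuous_fst cFh)|exact: continuous_mulgl].
have aK : aa K = aa (fun p => F (p.1 * p.2)%g) - t (a (fun g => F (g * h)%g)) 1.
  case: haa => aal _ _ _.
  rewrite (aal (-1) _ _ (continuous_fst cFh) (continuous_mulgl cF)) scaleN1r addrC.
  congr (_ - _); rewrite -a1 -(aaE cFh (@continuous_const R G 1)).
  by congr aa; apply/funext => p; rewrite mulr1.
apply/eqP; rewrite -subr_eq0 -(lfunB pL.1) -mulrBr -aK.
(* Cauchy-Schwarz removes [tau], leaving a statement about the positive function |K|^2, to which
   domination applies. *)
suff K0 : L (star (aa K) * aa K) = 0.
  have := pfun_cauchy_schwarz pL (star tau) (aa K).
  by rewrite starK K0 mulr0 -normrX normr_le0 expf_eq0.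
have [M hM] := compact_bounded_fun cG cF.
have M0 : 0 <= M by apply: le_trans (hM 1%g); exact: normc_ge0.
have KM p : normc (K p) ^+ 2 <= (2 * M) ^+ 2.
  rewrite ler_pXn2r ?nnegrE ?normc_ge0 ?mulr_ge0 //.
  apply: le_trans (le_normcD _ _) _; rewrite normcM normcN normc1 mul1r.
  by have := hM (p.1 * h)%g; have := hM (p.1 * p.2)%g; lra.
apply/eqP; rewrite eq_le pL.2 andbT.
have L1 := pfun1_ge0 pL.
rewrite [leLHS](real_of_ge0 (pL.2 _)) (_ : 0 = (0 : R)%:C%C) // lecR.
apply/ler_addgt0Pl => e e0; rewrite addr0.
pose d := e / (normc (L 1) + 1).
have d0 : 0 < d by rewrite divr_gt0 // ltr_wpDl // normc_ge0.
(* [K] vanishes on the slice y = h; compactness of the first factor yields a neighbourhood of h on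
   which |K|^2 < d uniformly. *)
have near_h : \forall y \near h, [set: G] `<=` (fun g => normc (K (g, y)) ^+ 2 < d).
  move: cG => /compact_near_coveringP; apply.
  move=> g _; have cN : {for (g, h), continuous (fun p => normc (K p) ^+ 2 : R)}.
    by apply: cvgM; exact: continuous_normc.
  have /cvgrPdist_lt/(_ d d0) := cN.
  apply: filterS => p /=; rewrite {1}/K /= mulN1r addNr normc0 expr0n sub0r normrN.
  by rewrite ger0_norm ?sqr_ge0 //; case: p.
have [th [cth th_ge0 thh th1]] := urysohn_point R hG cG near_h.
(* Near h the constant [d] dominates |K|^2; elsewhere [th] is 1 and the global bound (2M)^2 does. As
   th h = 0, the functional sends P to d L(1), at most e. *)
pose P (p : G * G) := d + (2 * M) ^+ 2 * th p.2.
have cP : continuous P.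
  move=> p; apply: cvgD; first exact: cvg_cst.
  by apply: cvgM; [exact: cvg_cst|exact: (continuous_snd cth)].
have KP p : normc (K p) ^+ 2 <= P p.
  have [lt|nlt] := pselect ([set: G] `<=` (fun g => normc (K (g, p.2)) ^+ 2 < d)).
    apply: le_trans (_ : d <= _); last by rewrite lerDl mulr_ge0 ?sqr_ge0.
    by have /= := lt p.1 I; case: (p) => ? ? /ltW.
  rewrite /P (th1 _ nlt) mulr1; apply: le_trans (KM p) _.
  by rewrite lerDr ltW.
have := star_hom_dominated haa pL cK cP KP.
have -> : aa (fun p => (P p)%:C%C) = aa (fun p => ((2 * M) ^+ 2)%:C%C * (th p.2)%:C%C + d%:C%C).
  by congr aa; apply/funext => p; rewrite -rmorphM -rmorphD /= addrC.
case: (haa) => aal _ aa1 _.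
have cth' : continuous (fun x => (th x)%:C%C : C) := continuous_real cth.
rewrite (aal _ _ _ (continuous_snd cth') (@continuous_const R _ _)) pL.1.
have -> : aa (fun p => (th p.2)%:C%C) = t 1 (a (fun g => (th g)%:C%C)).
  rewrite -a1 -(aaE (@continuous_const R G 1) cth').
  by congr aa; apply/funext => p; rewrite mul1r.
rewrite (hL _ cth') thh mul0r mulr0 add0r (star_hom_const haa pL).
rewrite (real_of_ge0 (pL.2 _)) {1}(normc_ge0E L1) -rmorphM lecR => /le_trans; apply.
by rewrite /d mulrAC ler_pdivrMr ?ltr_wpDl ?normc_ge0 // ler_pM2l // lerDl ler01.
Qed.

End Comultiplication.

Section StateExtension.
Variables (R : realType) (I : choiceType) (A T : cstarAlgType R) (t : A -> A -> T).
Local Notation C := (Cplx R).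
Hypothesis Ht : is_min_tensor t.

Lemma sums_sum (J : Type) (r : seq J) (f : J -> I -> C) (z : J -> C) :
  (forall j, sums_to (f j) (z j)) ->
  sums_to (fun i => \sum_(j <- r) f j i) (\sum_(j <- r) z j).
Proof.
move=> hf; elim: r => [|j r IH].
  rewrite big_nil => e e0; exists fset0 => F _.
  by rewrite big1 ?subrr ?normc0 // => i _; rewrite big_nil.
rewrite big_cons -[z j]mul1r; apply: eq_sums (sums_linear 1 (hf j) IH) => i.
by rewrite big_cons mul1r.
Qed.

Lemma sums_scale (f : I -> C) (c z : C) : sums_to f z -> sums_to (fun i => c * f i) (c * z).
Proof.
have s0 : sums_to (fun _ : I => 0 : C) 0.
  by move=> e e0; exists fset0 => F _; rewrite big1 ?subrr ?normc0.
move=> hf; rewrite -[c * z]addr0; apply: eq_sums (sums_linear c hf s0) => i.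
by rewrite addr0.
Qed.

(* Parseval's identity for psi turns positivity of phi (x) psi into that of
   phi on the slices of the tensor. *)
Lemma parseval_tensor_state (phi psi : A -> C) (coef : I -> A -> C) :
  state phi -> state psi ->
  (forall c (z : C) x y, coef c (z *: x + y) = z * coef c x + coef c y) ->
  (forall x y, sums_to (fun c => ((coef c x)^*)%R * coef c y) (psi (star x * y))) ->
  exists2 L : T -> C, state L & forall a b, L (t a b) = phi a * psi b.
Proof.
move=> sphi spsi coefl parseval; apply: (tensor_state Ht sphi spsi) => s.
have pphi := state_positive sphi; have lphi := pphi.1.
rewrite product_functional_starM.
apply: (@sums_ge0 _ _ (fun c => \sum_(p <- s) \sum_(q <- s)
    phi (star p.1 * q.1) * (((coef c p.2)^*)%R * coef c q.2))); last first.
  by apply: sums_sum => p; apply: sums_sum => q; exact: sums_scale.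
(* The slice of the tensor by the functional [coef c] on the second leg; the c-th Parseval term is
   phi (star y y). *)
move=> c; pose y := \sum_(p <- s) coef c p.2 *: p.1.
suff -> : \sum_(p <- s) \sum_(q <- s)
    phi (star p.1 * q.1) * (((coef c p.2)^*)%R * coef c q.2) = phi (star y * y) by exact: pphi.2.
rewrite /y star_sum mulr_suml lfun_sum //; apply: eq_bigr => p _.
rewrite mulr_sumr lfun_sum //; apply: eq_bigr => q _.
have -> : star (coef c p.2 *: p.1) * (coef c q.2 *: q.1) =
    (((coef c p.2)^*)%R * coef c q.2) *: (star p.1 * q.1).
  by rewrite starZ -scalerAl -scalerAr scalerA.
by rewrite (lfunZ lphi) mulrC.
Qed.

End StateExtension.

(** * The complex numbers as a C*-algebra *)

Section ScalarCStarAlgebra.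
Variable R : realType.
Local Notation C := (Cplx R).

Lemma scalar_conjZ (z : C) (x : C^o) : (((z *: x) : C)^*)%R = (z^*)%R *: ((x : C)^*)%R :> C^o.
Proof. exact: conjM. Qed.

Lemma scalar_conjM (x y : C^o) : ((x * y : C)^*)%R = ((y : C)^*)%R * ((x : C)^*)%R :> C^o.
Proof. by rewrite mulrC; exact: conjM. Qed.

Lemma scalar_normcZ (z : C) (x : C^o) : normc (z *: x : C) = normc z * normc (x : C).
Proof. exact: normcM. Qed.

Lemma scalar_cnorm_starM (x : C^o) : normc (((x : C)^*)%R * x : C) = normc (x : C) ^+ 2.
Proof. by rewrite normcM normc_conj. Qed.

Lemma scalar_normcM (x y : C^o) : normc (x * y : C) <= normc (x : C) * normc (y : C).
Proof. by rewrite normcM. Qed.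

HB.instance Definition _ := isCStarAlgebra.Build R C^o
  (@conjCK C) (@conjD R) scalar_conjZ scalar_conjM
  (@eq0_normc R) (@le_normcD R) scalar_normcZ scalar_normcM scalar_cnorm_starM
  (@Cplx_complete R).

End ScalarCStarAlgebra.

Lemma ptws_cvg (X : Type) (V : topologicalType) (F : set_system (X -> V)) (f : X -> V) :
  Filter F -> (forall x, (fun g : X -> V => g x) @ F --> f x) -> F --> (f : {ptws X -> V}).
Proof.
move=> FF h; apply/cvg_sup => x A [_ [[W oW <-] Wfx WA]].
apply: filterS WA _; apply: (h x); exact: open_nbhs_nbhs.
Qed.

(** * The bicrossed product *)

(** For the characters, this carries associativity, unit and inverses of [char_mul] over from the
    semi-direct product. *)
Lemma group_on_transfer (S U : Type) (X : set S) (opX : S -> S -> S)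
    (Y : set U) (opY : U -> U -> U) (f : S -> U) :
  group_on X opX -> set_bij X Y f ->
  (forall x y, X x -> X y -> f (opX x y) = opY (f x) (f y)) -> group_on Y opY.
Proof.
move=> [cl as_ [e [Xe idl inv]]] [fun_ inj sur] hom.
split.
- move=> y y' /sur [x Xx <-] /sur [x' Xx' <-]; rewrite -hom //.
  by apply: fun_; exact: cl.
- move=> y y' y'' /sur [x Xx <-] /sur [x' Xx' <-] /sur [x'' Xx'' <-].
  by rewrite -!hom ?as_ //; exact: cl.
- exists (f e); split; first exact: fun_.
    by move=> y /sur [x Xx <-]; rewrite -!hom //; have [-> ->] := idl x Xx.
  move=> y /sur [x Xx <-]; have [x' Xx' [h1 h2]] := inv x Xx.
  by exists (f x'); [exact: fun_|rewrite -!hom // h1 h2].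
Qed.

Section Bicrossed.
Variables (R : realType) (Gam G : topologicalGroupType).
Local Notation C := (Cplx R).
Variables (al : Gam -> G -> G) (be : G -> Gam -> Gam).
Hypothesis ms : matched_system al be.
Variables (A : cstarAlgType R) (a : (G -> C) -> A) (u : Gam -> A).
Hypothesis HA : is_full_crossed_product al a u.

Let cov : covariant_pair al a u := fcp_cov HA.
Let ha : star_hom_of_functions a := cov_hom cov.

Lemma continuous_al c (F : G -> C) : continuous F -> continuous (fun g => F (al c g)).
Proof.
by move=> cF g; apply: (@continuous_comp _ _ _ (al c) F);
  [exact: (ms_al_continuous ms)|exact: cF].
Qed.

Lemma a_linear (z : C) (F F' : G -> C) : continuous F -> continuous F' ->
  a (fun x => z * F x + F' x) = z *: a F + a F'.
Proof. by case: ha => h _ _ _; exact: h. Qed.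

Lemma a_mul (F F' : G -> C) : continuous F -> continuous F' ->
  a (fun x => F x * F' x) = a F * a F'.
Proof. by case: ha => _ h _ _; exact: h. Qed.

Lemma a_star (F : G -> C) : continuous F -> a (fun x => ((F x)^*)%R) = star (a F).
Proof. by case: ha => _ _ _ h; exact: h. Qed.

Lemma a_1 : a (fun=> 1) = 1.
Proof. by case: ha. Qed.

Lemma a_0 : a (fun=> 0) = 0.
Proof.
have := a_linear (-1) (@continuous_const R G 0) (@continuous_const R G 0).
have -> : (fun x : G => -1 * 0 + 0) = (fun=> 0 : C) by apply/funext => x; rewrite mulr0 addr0.
by rewrite scaleN1r addNr.
Qed.

Lemma u_starK c : star (u c) * u c = 1. Proof. by case: (cov_unitary cov c). Qed.
Lemma u_starV c : u c * star (u c) = 1. Proof. by case: (cov_unitary cov c). Qed.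

Lemma u_1 : u 1%g = 1.
Proof.
have := cov_mul cov 1%g 1%g; rewrite mulg1 => h.
by rewrite -[u 1%g]mul1r -(u_starK 1%g) -mulrA -h.
Qed.

Lemma u_inv c : star (u c) = u (c^-1)%g.
Proof.
have h : u (c^-1)%g * u c = 1 by rewrite -(cov_mul cov) mulVg u_1.
by rewrite -[LHS]mul1r -h -mulrA u_starV mulr1.
Qed.

Lemma a_u c (F : G -> C) : continuous F -> a F * u c = u c * a (fun g => F (al c g)).
Proof.
move=> cF; have := cov_conj cov (c^-1)%g cF; rewrite invgK u_inv invgK => <-.
by rewrite !mulrA -(cov_mul cov) mulgV u_1 mul1r.
Qed.

Lemma gen_mul c d (F F' : G -> C) : continuous F -> continuous F' ->
  (u c * a F) * (u d * a F') = u (c * d)%g * a (fun g => F (al d g) * F' g).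
Proof.
move=> cF cF'; rewrite (a_mul (@continuous_al d F cF) cF') (cov_mul cov).
by rewrite !mulrA -[u c * a F * u d]mulrA (a_u d cF) !mulrA.
Qed.

Lemma gen_star c (F : G -> C) : continuous F ->
  star (u c * a F) = u (c^-1)%g * a (fun g => ((F (al (c^-1)%g g))^*)%R).
Proof.
move=> cF; rewrite starM u_inv -(a_star cF) (a_u _ (continuous_conj cF)) //.
Qed.

Definition linear_subspace (P : set A) :=
  P 0 /\ forall (z : C) x y, P x -> P y -> P (z *: x + y).

(** An impredicative linear span: membership is itself the induction principle used in the density
    and continuity arguments. *)
Definition gen_span : set A := [set x | forall P : set A, linear_subspace P ->
  (forall c (F : G -> C), continuous F -> P (u c * a F)) -> P x].

Lemma gen_span_linear : linear_subspace gen_span.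
Proof.
by split=> [P [P0 _] _|z x y hx hy P lP hP]; [|apply: lP.2; [exact: hx|exact: hy]].
Qed.

Lemma gen_span_gen c (F : G -> C) : continuous F -> gen_span (u c * a F).
Proof. by move=> cF P _; apply. Qed.

Lemma gen_span_dense : norm_dense gen_span.
Proof.
apply: (fcp_generated HA); last first.
  move=> x [[F cF <-]|[c _ <-]].
    by rewrite -[a F]mul1r -u_1; exact: gen_span_gen.
  by rewrite -[u c]mulr1 -a_1; apply: gen_span_gen; exact: continuous_const.
split.
- by rewrite -[1]mulr1 -{1}u_1 -a_1; apply: gen_span_gen; exact: continuous_const.
- by move=> z x y hx hy; apply: gen_span_linear.2.
(* Induction on x with y fixed, then on y with x a generator; products of generators are generators
   by [gen_mul]. *)
- move=> x y hx hy; apply: (hx (fun x => gen_span (x * y))).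
    split; first by rewrite mul0r; exact: gen_span_linear.1.
    by move=> z x1 x2 h1 h2; rewrite mulrDl -scalerAl; apply: gen_span_linear.2.
  move=> c F cF; apply: (hy (fun y => gen_span (u c * a F * y))).
    split; first by rewrite mulr0; exact: gen_span_linear.1.
    by move=> z y1 y2 h1 h2; rewrite mulrDr -scalerAr; apply: gen_span_linear.2.
  move=> d F' cF'; rewrite (gen_mul _ _ cF cF'); apply: gen_span_gen.
  exact: (continuous_mul (@continuous_al d F cF) cF').
- move=> x hx; apply: (hx (fun x => gen_span (star x))).
    split; first by rewrite star0; exact: gen_span_linear.1.
    by move=> z x1 x2 h1 h2; rewrite starD starZ; apply: gen_span_linear.2.
  move=> c F cF; rewrite (gen_star _ cF); apply: gen_span_gen.
  exact: (continuous_conj (@continuous_al (c^-1)%g F cF)).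
Qed.

Lemma gen_lfun_eq0 (L : A -> C) (k : R) : 0 <= k ->
  (forall (z : C) x y, L (z *: x + y) = z * L x + L y) ->
  (forall x, normc (L x) <= k * cnorm x) ->
  (forall c (F : G -> C), continuous F -> L (u c * a F) = 0) -> forall x, L x = 0.
Proof.
move=> k0 lL bL L0; apply: (dense_lfun_eq0 gen_span_dense k0) => //.
  by move=> x y; rewrite (lfunB lL).
move=> x hx; apply: (hx [set x | L x = 0]) => //.
split; first exact: lfun0.
by move=> z y y' /= hy hy'; rewrite lL hy hy' mulr0 addr0.
Qed.

Lemma cnorm_u c : cnorm (u c) = 1 :> R.
Proof.
have h : cnorm (u c) ^+ 2 = 1 :> R by rewrite -cnorm_starM u_starK cnorm1.
by apply/eqP; rewrite -(@eqrXn2 _ 2) ?cnorm_ge0 // expr1n h.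
Qed.

Variable coef : G -> Gam -> A -> C.
Hypothesis coef_lin : forall g c (z : C) x y,
  coef g c (z *: x + y) = z * coef g c x + coef g c y.
Hypothesis coef_gen : forall g c d (F : G -> C), continuous F ->
  coef g c (u d * a F) = if c == d then F g else 0.
Hypothesis coef_u : forall g c x, coef g c x = coef g 1%g (star (u c) * x).
Hypothesis coef_parseval : forall g x y,
  sums_to (fun c => ((coef g c x)^*)%R * coef g c y) (coef g 1%g (star x * y)).

Lemma coef_state g : state (coef g 1%g).
Proof.
split.
- exact: coef_lin.
- move=> x; apply: sums_ge0 (coef_parseval g x x) => c.
  by rewrite mulrC mul_conjC_ge0.
- rewrite -[1]mulr1 -{1}u_1 -a_1 coef_gen ?eqxx //; exact: continuous_const.
Qed.

Lemma coef_bounded g c x : normc (coef g c x) <= cnorm x.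
Proof.
rewrite coef_u; apply: le_trans (state_bounded _ (coef_state g)) _.
by apply: le_trans (cnormM _ _) _; rewrite cnorm_star cnorm_u mul1r.
Qed.

(** [coef_bounded] is uniform in g, so the coefficient of x is a uniform limit of coefficients of
    elements of [gen_span], which are continuous. *)
Lemma coef_continuous c x : continuous (fun g => coef g c x).
Proof.
have span y : gen_span y -> continuous (fun g => coef g c y).
  move=> hy; apply: (hy [set y | continuous (fun g => coef g c y)]).
    split=> [|z y1 y2 h1 h2] /=.
      have -> : (fun g => coef g c 0) = (fun=> 0).
        by apply/funext => g; rewrite (lfun0 (coef_lin g c)).
      exact: continuous_const.
    have -> : (fun g => coef g c (z *: y1 + y2)) = (fun g => z * coef g c y1 + coef g c y2).
      by apply/funext => g; rewrite coef_lin.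
    exact: (@continuous_linear R G z _ _ h1 h2).
  move=> d F cF /=.
  have -> : (fun g => coef g c (u d * a F)) = (fun g => if c == d then F g else 0).
    by apply/funext => g; rewrite coef_gen.
  by case: eqP => _; [exact: cF|exact: continuous_const].
move=> g; apply/cvg_normcP => e e0.
have e3 : 0 < e / 3 by rewrite divr_gt0.
have [y Sy hy] := gen_span_dense x e3.
have /cvg_normcP /(_ _ e3) := span y Sy g; apply: filterS => h hh.
have -> : coef h c x - coef g c x =
    coef h c (x - y) - coef g c (x - y) + (coef h c y - coef g c y).
  by rewrite !(lfunB (coef_lin _ _)); ring.
have h1 := le_normcD (coef h c (x - y) - coef g c (x - y)) (coef h c y - coef g c y).
have h2 := le_normcD (coef h c (x - y)) (- coef g c (x - y)).
rewrite normcN in h2.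
have h3 := coef_bounded h c (x - y); have h4 := coef_bounded g c (x - y).
lra.
Qed.

Definition orbit_indicator (c r : Gam) : G -> C := \1_[set g | be g c = r].

Lemma orbit_indicatorE c r g : orbit_indicator c r g = if be g c == r then 1 else 0.
Proof.
rewrite /orbit_indicator indicE; case: eqP => h; first by rewrite mem_set.
by rewrite memNset.
Qed.

Lemma orbit_indicator_continuous c r : continuous (orbit_indicator c r).
Proof.
move=> g; apply/cvg_normcP => e e0.
have : nbhs g [set h | be h c = be g c].
  by apply: open_nbhs_nbhs; split=> //; exact: (ms_be_open ms c [set d | d = be g c]).
by apply: filterS => h /= hg; rewrite !orbit_indicatorE hg subrr normc0.
Qed.

Variables (T : cstarAlgType R) (t : A -> A -> T) (Delta : A -> T).
Hypothesis Ht : is_min_tensor t.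
Hypothesis HD : is_bicrossed_comult be a u t Delta.

Lemma Delta_lin (z : C) x y : Delta (z *: x + y) = z *: Delta x + Delta y.
Proof. by case: (comult_hom HD) => h _ _ _; exact: h. Qed.

Lemma Delta_mul x y : Delta (x * y) = Delta x * Delta y.
Proof. by case: (comult_hom HD). Qed.

Lemma Delta_1 : Delta 1 = 1.
Proof. by case: (comult_hom HD). Qed.

Lemma Delta_star x : Delta (star x) = star (Delta x).
Proof. by case: (comult_hom HD). Qed.

Lemma orbit_set c r : (r \in fset_set (range (fun g => be g c))) =
  `[< exists g, be g c = r >].
Proof.
rewrite in_fset_set; last exact: (ms_orbit_finite ms).
apply/idP/asboolP; first by move/set_mem => -[g _ <-]; exists g.
by case=> g <-; apply/mem_set; exists g.
Qed.

Lemma Delta_u c : Delta (u c) =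
  \sum_(r <- fset_set (range (fun g => be g c))) t (u c * a (orbit_indicator c r)) (u r).
Proof.
by rewrite (comult_unitaries HD) fsbig_finite //; exact: (ms_orbit_finite ms).
Qed.

(* Evaluating the second leg of [Delta (u c * a F)] at a functional [L] whose
   restriction to the second copy of C(G) is the evaluation at [h]. *)
Lemma comult_slice (L : T -> C) h (tau : T) c (F : G -> C) :
  positive_functional L ->
  (forall F' : G -> C, continuous F' -> L (t 1 (a F')) = F' h * L 1) -> continuous F ->
  L (tau * Delta (u c * a F)) = \sum_(r <- fset_set (range (fun g => be g c)))
    L (tau * t (u c * a (fun g => orbit_indicator c r g * F (g * h)%g)) (u r)).
Proof.
move=> pL hL cF; have [aa haa [aaE aaD]] := comult_functions HD.
have cFh := @continuous_translate R G h F cF.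
rewrite Delta_mul (aaD F cF) mulrA.
rewrite (comult_evaluation (ms_hausdorff ms) (ms_compact ms) haa ha aaE _ pL hL cF).
rewrite Delta_u mulr_sumr mulr_suml (lfun_sum pL.1); apply: eq_bigr => r _.
rewrite -mulrA (tensor_mulE Ht) mulr1 -mulrA.
by rewrite (a_mul (@orbit_indicator_continuous c r) cFh).
Qed.

(** * Slices of the comultiplication by a state and a coefficient *)

Section Slice.
Variables (phi : A -> C) (h : G) (L : T -> C).
Hypotheses (sphi : state phi) (sL : state L).
Hypothesis LE : forall x y, L (t x y) = phi x * coef h 1%g y.

Lemma slice_eval (F : G -> C) : continuous F -> L (t 1 (a F)) = F h * L 1.
Proof.
move=> cF; rewrite LE; have -> : a F = u 1%g * a F by rewrite u_1 mul1r.
rewrite (coef_gen _ _ _ cF) eqxx.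
by case: sphi => _ _ ->; case: sL => _ _ ->; rewrite mul1r mulr1.
Qed.

Lemma coef_u_u g c d : coef g c (u d) = if c == d then 1 else 0.
Proof.
by rewrite -[u d]mulr1 -a_1 (coef_gen _ _ _ (@continuous_const R G 1)).
Qed.

(** In the orbit sum for [Delta (u c)], the second leg contributes the coefficient of [u r] at d,
    which selects the term r = d. *)
Lemma slice_gen p d c (F : G -> C) : continuous F ->
  L (t (star p) (star (u d)) * Delta (u c * a F)) =
  phi (star p * (u c * a (fun g => orbit_indicator c d g * F (g * h)%g))).
Proof.
move=> cF; have [lphi _ _] := sphi.
rewrite (comult_slice _ _ (state_positive sL) slice_eval cF).
pose f r := phi (star p * (u c * a (fun g => orbit_indicator c r g * F (g * h)%g))).
rewrite (eq_bigr (fun r => f r * (if d == r then 1 else 0))); last first.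
  by move=> r _; rewrite (tensor_mulE Ht) LE -coef_u coef_u_u.
have [dO|dO] := boolP (d \in fset_set (range (fun g => be g c))).
  rewrite (big_fsetD1 d) //= eqxx mulr1 big_seq big1 ?addr0 // => r.
  by rewrite !inE eq_sym => /andP[/negbTE -> _]; rewrite mulr0.
rewrite big_seq big1 => [|r rO]; last first.
  by case: eqP => [dr|_]; [rewrite dr rO in dO|rewrite mulr0].
(* Outside the orbit of c no term of the sum is selected, and the indicator on the right-hand side
   is identically 0. *)
have -> : (fun g => orbit_indicator c d g * F (g * h)%g) = (fun=> 0).
  apply/funext => g; rewrite orbit_indicatorE; case: eqP => [e|_]; last by rewrite mul0r.
  by move: dO; rewrite orbit_set => /asboolP []; exists g.
by rewrite a_0 !mulr0 (lfun0 lphi).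
Qed.

(** [L \o Delta] is a positive functional with value 1 at 1, so [pfun_le] bounds it by the norm of
    x; Cauchy-Schwarz separates [tau]. *)
Lemma slice_bounded tau x : normc (L (tau * Delta x)) <= cnorm tau * cnorm x.
Proof.
have pL := state_positive sL.
have pLD : positive_functional (L \o Delta).
  split=> [z y y'|y] /=; first by rewrite Delta_lin pL.1.
  by rewrite Delta_mul Delta_star pL.2.
have L1 : L 1 = 1 by case: sL.
apply: normc_le_sqr; first by rewrite mulr_ge0 ?cnorm_ge0.
have := pfun_cauchy_schwarz pL (star tau) (Delta x); rewrite starK => /le_trans; apply.
have h1 := pfun_le pL (star tau); rewrite starK cnorm_star L1 mulr1 in h1.
have h2 := pfun_le pLD x; rewrite /= Delta_mul Delta_star Delta_1 L1 mulr1 in h2.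
rewrite exprMn rmorphM; apply: ler_pM => //; last exact: pL.2.
by have := pL.2 (star tau); rewrite starK.
Qed.

End Slice.

(** * Group-like unitaries *)

Section GroupLike.
Variable v : A.
Hypotheses (uv : unitary v) (Dv : Delta v = t v v).

Lemma group_like_coef g h c d :
  coef g c v * coef h d v = if be g c == d then coef (g * h)%g c v else 0.
Proof.
have sg := coef_state g; have sh := coef_state h.
have [L sL LE] := parseval_tensor_state Ht sg sh (coef_lin h) (coef_parseval h).
pose b : C := if be g c == d then 1 else 0.
have b1 : normc b <= 1 by rewrite /b; case: ifP; rewrite ?normc1 ?normc0.
(* This functional vanishes on generators and hence everywhere; group-likeness enters only when it
   is evaluated at [v]. *)
pose K x := L (t (star (u c)) (star (u d)) * Delta x) - b * coef (g * h)%g c x.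
have lL : forall (z : C) x y, L (z *: x + y) = z * L x + L y by case: sL.
have K0 : K v = 0.
  apply: (gen_lfun_eq0 (k := cnorm (t (star (u c)) (star (u d))) + 1)) => [||x|e F cF].
  - by rewrite addr_ge0 ?cnorm_ge0.
  - by move=> z x y; rewrite /K Delta_lin mulrDr -scalerAr lL coef_lin; ring.
  - have h1 := slice_bounded sL (t (star (u c)) (star (u d))) x.
    have h2 := coef_bounded (g * h)%g c x.
    apply: le_trans (le_normcD _ _) _; rewrite normcN normcM mulrDl mul1r lerD //.
    by rewrite -[leRHS]mul1r ler_pM ?normc_ge0.
  - rewrite /K (slice_gen sg sL LE _ _ _ cF) -coef_u.
    have cI := continuous_mul (@orbit_indicator_continuous e d) (@continuous_translate R G h F cF).
    rewrite (coef_gen _ _ _ cI) (coef_gen _ _ _ cF).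
    case: eqP => [<-|_]; last by rewrite mulr0 subrr.
    by rewrite orbit_indicatorE subrr.
move: K0; rewrite /K Dv (tensor_mulE Ht) LE -!coef_u => /eqP; rewrite subr_eq0 => /eqP ->.
by rewrite /b; case: ifP; rewrite ?mul1r ?mul0r.
Qed.

Lemma group_like_unique : exists c, forall d h, coef h d v = if d == c then coef h c v else 0.
Proof.
(* By Parseval and unitarity the squared moduli of the coefficients at g = 1 sum to 1. *)
have [c hc] : exists c, coef 1%g c v != 0.
  apply: contrapT => /forallNP nc.
  have := coef_parseval 1%g v v; case: uv => -> _.
  have -> : coef 1%g 1%g 1 = 1 by case: (coef_state 1%g).
  move=> hs; have : sums_to (fun c : Gam => ((coef 1%g c v)^*)%R * coef 1%g c v) 0.
    move=> e e0; exists fset0 => F _; rewrite big1 ?subrr ?normc0 // => c _.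
    by have /negP := nc c; rewrite negbK => /eqP ->; rewrite mulr0.
  by move=> /(sums_unique hs) /eqP; rewrite oner_eq0.
have e1 (d : Gam) (h : G) : coef 1%g c v * coef h d v = if c == d then coef h c v else 0.
  by rewrite group_like_coef (ms_be1 ms) mul1g.
(* The relation at h = 1 makes this nonzero scalar idempotent. *)
have c1 : coef 1%g c v = 1.
  by apply: (mulfI hc); rewrite e1 eqxx mulr1.
by exists c => d h; have := e1 d h; rewrite c1 mul1r eq_sym.
Qed.

Lemma group_like_form : exists p, sd_left be p /\ v = u p.2 * a p.1.
Proof.
have [c hc] := group_like_unique.
pose w g := coef g c v.
have cw : continuous w := @coef_continuous c v.
(* Only the term at [c] survives in Parseval's identity. *)
have w_sqr g : ((w g)^*)%R * w g = 1.
  have := coef_parseval g v v; case: uv => -> _.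
  have -> : coef g 1%g 1 = 1 by case: (coef_state g).
  move=> hs; apply: sums_unique hs.
  apply: (@sums_single _ _ (fun d => ((coef g d v)^*)%R * coef g d v)) => d /negbTE dc.
  by rewrite (hc d) dc mulr0.
have w0 g : w g != 0.
  by apply/eqP => e; have := w_sqr g; rewrite e mulr0 => /eqP; rewrite eq_sym oner_eq0.
have wn g : `|w g| = 1.
  have := w_sqr g; rewrite mulrC -normCK => /eqP.
  by rewrite -{1}(expr1n _ 2) eqrXn2 // => /eqP.
(* Otherwise the product w(g) w(1) of nonzero scalars would be 0. *)
have fixc g : be g c = c.
  have := group_like_coef g 1%g c c; rewrite mulg1 -/(w g) -/(w 1%g).
  by case: eqP => // _ /eqP; rewrite mulf_eq0 !(negbTE (w0 _)).
have wM g h : w (g * h)%g = w g * w h.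
  by have := group_like_coef g h c c; rewrite fixc eqxx.
have w1 : w 1%g = 1.
  by apply: (mulfI (w0 1%g)); rewrite -wM mulg1 mulr1.
exists (w, c); split; first by split=> //; split.
(* The difference [p] is tested against itself: the slice at h = 1 with p in the first leg gives phi
   (star p v) = phi (star p u_c a(w)), that is phi (star p p) = 0. *)
apply/eqP; rewrite -subr_eq0; apply/eqP; apply: (states_separate Ht) => phi sphi /=.
set p := v - _.
have [L sL LE] := parseval_tensor_state Ht sphi (coef_state 1%g) (coef_lin 1%g) (coef_parseval 1%g).
have pphi := state_positive sphi; have lphi := pphi.1.
have lL : forall (z : C) x y, L (z *: x + y) = z * L x + L y by case: sL.
pose K x := L (t (star p) (star (u c)) * Delta x) -
  phi (star p * (u c * a (fun g => coef g c x))).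
have K0 : K v = 0.
  apply: (gen_lfun_eq0 (k := cnorm (t (star p) (star (u c))) + cnorm (star p * u c))) => [||x|d F cF].
  - by rewrite addr_ge0 ?cnorm_ge0.
  - move=> z x y; rewrite /K Delta_lin mulrDr -scalerAr lL.
    have -> : (fun g => coef g c (z *: x + y)) = (fun g => z * coef g c x + coef g c y).
      by apply/funext => g; rewrite coef_lin.
    rewrite (a_linear z (@coef_continuous c x) (@coef_continuous c y)) !mulrDr -!scalerAr lphi.
    by ring.
  - have h1 := slice_bounded sL (t (star p) (star (u c))) x.
    apply: le_trans (le_normcD _ _) _; rewrite normcN mulrDl lerD //.
    apply: normc_le_sqr; first by rewrite mulr_ge0 ?cnorm_ge0.
    have := pfun_cauchy_schwarz pphi (star (star p * u c)) (a (fun g => coef g c x)).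
    rewrite starK -!mulrA => /le_trans; apply.
    rewrite !mulrA.
    have phi1 : phi 1 = 1 by case: sphi.
    have h2 := pfun_le pphi (star (star p * u c)).
    rewrite starK cnorm_star phi1 mulr1 in h2.
    (* The map x |-> a (coef _ c x) is controlled through the state phi, using the bound of the
       coefficients by cnorm x uniformly in g. *)
    have h3 := @star_hom_bounded _ _ _ a phi ha pphi (fun g => coef g c x) (cnorm x ^+ 2)
      (@coef_continuous c x).
    rewrite exprMn rmorphM; apply: ler_pM => //.
    + by have := pphi.2 (star (star p * u c)); rewrite starK.
    + exact: pphi.2.
    rewrite phi1 mulr1 in h3; apply: h3 => g.
    by rewrite ler_pXn2r ?nnegrE ?normc_ge0 ?cnorm_ge0 // coef_bounded.
  - rewrite /K (slice_gen sphi sL LE _ _ _ cF); apply/eqP; rewrite subr_eq0; apply/eqP.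
    congr (phi (_ * _)).
    have -> : (fun g => orbit_indicator d c g * F (g * 1)%g) =
        (fun g => if d == c then F g else 0).
      apply/funext => g; rewrite orbit_indicatorE mulg1.
      (* As c is fixed, its orbit is a single point, so no other d can be moved onto it. *)
      have -> : (be g d == c) = (d == c).
        apply/eqP/eqP => [e|->//]; rewrite -(ms_be1 ms d) -(mulgV g) (ms_beM ms) e.
        exact: fixc.
      by case: ifP; rewrite ?mul1r ?mul0r.
    have -> : (fun g => coef g c (u d * a F)) = (fun g => if d == c then F g else 0).
      by apply/funext => g; rewrite (coef_gen _ _ _ cF) eq_sym.
    by case: eqP => [->//|_]; rewrite a_0 !mulr0.
move: K0; rewrite /K Dv (tensor_mulE Ht) LE -coef_u -/(w 1%g) w1 mulr1 -(lfunB lphi) -mulrBr.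
by [].
Qed.

End GroupLike.

Lemma int_group_like p : sd_left be p -> intrinsic_group t Delta (u p.2 * a p.1).
Proof.
case: p => w c [[/= cw wM wn] /= fixc]; split.
  have ww : star (a w) * a w = 1.
    rewrite -(a_star cw) -(a_mul (continuous_conj cw) cw) -a_1.
    by congr a; apply/funext => g; rewrite mulrC -normCK wn expr1n.
  have ww' : a w * star (a w) = 1.
    rewrite -(a_star cw) -(a_mul cw (continuous_conj cw)) -a_1.
    by congr a; apply/funext => g; rewrite -normCK wn expr1n.
  split; rewrite starM; first by rewrite mulrA -[_ * u c]mulrA u_starK mulr1.
  by rewrite mulrA -[_ * star (a w)]mulrA ww' mulr1 u_starV.
have [aa haa [aaE aaD]] := comult_functions HD.
rewrite Delta_mul (aaD w cw).
have -> : aa (fun p => w (p.1 * p.2)%g) = t (a w) (a w).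
  by rewrite -(aaE w w cw cw); congr aa; apply/funext => q; rewrite wM.
have -> : Delta (u c) = t (u c) (u c).
  rewrite Delta_u.
  have -> : range (fun g => be g c) = [set c].
    by apply/seteqP; split=> [_ [g _ <-]|_ ->]; [exact: fixc|exists 1%g].
  rewrite fset_set1 big_seq_fset1.
  have -> : orbit_indicator c c = fun=> 1.
    by apply/funext => g; rewrite orbit_indicatorE fixc eqxx.
  by rewrite a_1 mulr1.
by rewrite (tensor_mulE Ht).
Qed.

Lemma sd_left_group : group_on (@sd_left R Gam G be) (@sd_left_mul R Gam G al).
Proof.
have fixV c : fixed_beta be c -> fixed_beta be (c^-1)%g.
  move=> fc g; apply: (mulIg c).
  (* With g written as alpha_c(d), the product rule for beta_d applied to c^-1 c = 1 yields
     beta_g(c^-1) c = 1. *)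
  have [d ->] : exists d, g = al c d.
    by exists (al (c^-1)%g g); rewrite -(ms_alM ms) mulgV (ms_al1 ms).
  by have := ms_beMr ms d (c^-1)%g c; rewrite mulVg (ms_be1r ms) fc => <-.
have alM c x y : fixed_beta be c -> al c (x * y)%g = (al c x * al c y)%g.
  by move=> fc; rewrite (ms_alMr ms) fc.
split.
- move=> [w c] [w' d] [[/= cw wM wn] /= fc] [[/= cw' wM' wn'] /= fd]; split.
    split.
    + exact: (continuous_mul (@continuous_al d w cw) cw').
    + by move=> x y /=; rewrite (alM _ _ _ fd) wM wM' mulrACA.
    + by move=> x; rewrite normrM wn wn' mulr1.
  by move=> g /=; rewrite (ms_beMr ms) fd fc.
- move=> [w c] [w' d] [w'' e] _ _ _; congr pair; last exact: mulgA.
  by apply/funext => g /=; rewrite (ms_alM ms) mulrA.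
- exists ((fun=> 1), 1%g); split.
  + split=> /=; last exact: (ms_be1r ms).
    by split=> [|x y|x]; [exact: continuous_const|rewrite mulr1|rewrite normr1].
  + move=> [w c] [[/= cw wM wn] /= fc]; split; congr pair; rewrite /= ?mul1g ?mulg1 //.
      by apply/funext => g; rewrite mul1r.
    by apply/funext => g; rewrite mulr1 (ms_al1 ms).
  + move=> [w c] [[/= cw wM wn] /= fc].
    exists ((fun g => ((w (al (c^-1)%g g))^*)%R), (c^-1)%g).
      split=> /=; last exact: fixV.
      split.
      * exact: (continuous_conj (@continuous_al (c^-1)%g w cw)).
      * by move=> x y; rewrite (alM _ _ _ (fixV _ fc)) wM conjM.
      * by move=> x; rewrite norm_conjC.
    split; congr pair; rewrite /= ?mulVg ?mulgV //; apply/funext => g.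
      by rewrite -(ms_alM ms) mulVg (ms_al1 ms) mulrC -normCK wn expr1n.
    by rewrite -normCK wn expr1n.
Qed.


Lemma intrinsic_group_isomorphism :
  group_isomorphism (@sd_left R Gam G be) (@sd_left_mul R Gam G al)
    (intrinsic_group t Delta) (fun v w : A => v * w) (fun p => u p.2 * a p.1).
Proof.
have bij : set_bij (@sd_left R Gam G be) (intrinsic_group t Delta) (fun p => u p.2 * a p.1).
  split; first by move=> p /int_group_like.
    move=> [w c] [w' c'] /set_mem [[/= cw wM wn] /= fc] /set_mem [[/= cw' wM' wn'] /= fc'] /= e.
    (* The coefficient at c recovers w; if c and c' differed, w would vanish, against |w| = 1. *)
    have key g : w g = if c == c' then w' g else 0.
      by rewrite -(coef_gen g c c' cw') -e (coef_gen g c c cw) eqxx.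
    case: (eqVneq c c') key => [->|_] key; first by congr pair; apply/funext.
    by have := wn 1%g; rewrite key normr0 => /eqP; rewrite eq_sym oner_eq0.
  by move=> v [uv Dv]; have [p [Xp ->]] := group_like_form uv Dv; exists p.
have hom p q : sd_left be p -> sd_left be q ->
    u (sd_left_mul al p q).2 * a (sd_left_mul al p q).1 = (u p.2 * a p.1) * (u q.2 * a q.1).
  by move=> [[cp _ _] _] [[cq _ _] _]; rewrite (gen_mul _ _ cp cq).
split=> //; first exact: sd_left_group.
exact: group_on_transfer sd_left_group bij hom.
Qed.

(** * Characters of the crossed product *)

Section Characters.
Hypothesis Gam_discrete : forall c : Gam, open [set c].

Lemma discrete_continuous (mu : Gam -> C) : continuous mu.
Proof.
move=> c O /nbhs_singleton Oc; rewrite /nbhs /=.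
by apply: filterS (open_nbhs_nbhs (conj (Gam_discrete c) erefl)) => _ ->.
Qed.

Lemma character_ext (f f' : A -> C) : character f -> character f' ->
  (forall F : G -> C, continuous F -> f (a F) = f' (a F)) ->
  (forall c, f (u c) = f' (u c)) -> f = f'.
Proof.
move=> cf cf' ef eu; have [lf mf _ _] := cf; have [lf' mf' _ _] := cf'.
apply/funext => x; apply/eqP; rewrite -subr_eq0; apply/eqP.
apply: (gen_lfun_eq0 (L := fun x => f x - f' x) (k := 2)) => //.
- by move=> z y y'; rewrite lf lf'; ring.
- move=> y; apply: le_trans (le_normcD _ _) _; rewrite normcN.
  have h1 := state_bounded y (character_state cf).
  have h2 := state_bounded y (character_state cf'); lra.
- by move=> c F cF; rewrite mf mf' (ef _ cF) eu subrr.
Qed.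

Lemma character_u_norm (f : A -> C) c : character f -> `|f (u c)| = 1.
Proof.
case=> _ fM f1 fS; have : f (u c) * ((f (u c))^*)%R = 1 by rewrite -fS -fM u_starV.
by rewrite -normCK => /eqP; rewrite -{1}(expr1n _ 2) eqrXn2 // => /eqP.
Qed.

Lemma sd_right_character p : sd_right al p -> exists f : A -> C,
  character f /\ (forall F : G -> C, continuous F -> f (a F) = F p.1) /\
  forall c, f (u c) = p.2 c.
Proof.
case: p => g mu [/= fg [cmu muM mun]].
pose ev (F : G -> C) : C^o := F g.
have cp : covariant_pair al ev (mu : Gam -> C^o).
  split=> //.
  - move=> c; split; first by rewrite [LHS]mulrC; apply: etrans (esym (normCK _)) _; rewrite mun expr1n.
    by apply: etrans (esym (normCK _)) _; rewrite mun expr1n.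
  - move=> c F cF; rewrite /ev fg [X in X * _]mulrC -mulrA -[RHS]mulr1; congr (_ * _).
    by apply: etrans (esym (normCK _)) _; rewrite mun expr1n.
have [f [fl fM f1 fS] [fa fu]] := fcp_universal HA cp.
by exists f; split; [split|split].
Qed.

(** [character_ext] allows at most one such character, and on [sd_right al] one exists, so the
    default value only occurs outside that set. *)
Definition Psi (p : G * (Gam -> C)) : A -> C := xget (fun=> 0) [set f : A -> C |
  character f /\ (forall F : G -> C, continuous F -> f (a F) = F p.1) /\
  forall c, f (u c) = p.2 c].

Lemma PsiP p : sd_right al p -> character (Psi p) /\
  (forall F : G -> C, continuous F -> Psi p (a F) = F p.1) /\ forall c, Psi p (u c) = p.2 c.
Proof.
move=> /sd_right_character [f hf]; rewrite /Psi; case: xgetP => [f' _ //|].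
by move=> /(_ f).
Qed.

Lemma char_mul_character f g : character f -> character g ->
  character (char_mul t Delta f g).
Proof.
move=> cf cg; have [[kl kM k1 kS] _] := tensor_character_ext Ht cf cg.
have [Dl DM D1 DS] := comult_hom HD.
by split=> *; rewrite /char_mul /= ?Dl ?DM ?D1 ?DS ?kl ?kM ?k1 ?kS.
Qed.

Lemma char_mul_a f g x y (F : G -> C) : character f -> character g ->
  (forall F : G -> C, continuous F -> f (a F) = F x) ->
  (forall F : G -> C, continuous F -> g (a F) = F y) -> continuous F ->
  char_mul t Delta f g (a F) = F (x * y)%g.
Proof.
move=> cf cg fx gy cF; rewrite /char_mul /=.
have [ck kE] := tensor_character_ext Ht cf cg; set k := tensor_character t f g in ck kE *.
have [aa haa [aaE aaD]] := comult_functions HD.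
have pk := state_positive (character_state ck).
have [_ _ k1 _] := ck; have [_ _ f1 _] := cf; have [_ _ g1 _] := cg.
have ky F' : continuous F' -> k (t 1 (a F')) = F' y * k 1.
  by move=> cF'; rewrite kE f1 mul1r (gy _ cF') k1 mulr1.
rewrite (aaD F cF) -[aa _]mul1r.
rewrite (comult_evaluation (ms_hausdorff ms) (ms_compact ms) haa ha aaE 1 pk ky cF).
by rewrite mul1r kE g1 mulr1 (fx _ (@continuous_translate R G y F cF)).
Qed.

(** As f evaluates functions at x, only the indicator of r = beta_x(c) survives in the orbit sum;
    this is the origin of the twist in [sd_right_mul]. *)
Lemma char_mul_u f g x c : character f -> character g ->
  (forall F : G -> C, continuous F -> f (a F) = F x) ->
  char_mul t Delta f g (u c) = f (u c) * g (u (be x c)).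
Proof.
move=> cf cg fx; rewrite /char_mul /=.
have [ck kE] := tensor_character_ext Ht cf cg; set k := tensor_character t f g in ck kE *.
have [kl _ _ _] := ck; have [_ fM _ _] := cf.
rewrite Delta_u (lfun_sum kl).
rewrite (big_fsetD1 (be x c)) /=; last by rewrite orbit_set; apply/asboolP; exists x.
rewrite big_seq big1 => [|r]; rewrite kE fM (fx _ (@orbit_indicator_continuous c _)) orbit_indicatorE.
  by rewrite eqxx mulr1 addr0.
by rewrite !inE eq_sym => /andP[/negbTE ->]; rewrite mulr0 mul0r.
Qed.

Lemma sd_right_group : group_on (@sd_right R Gam G al) (@sd_right_mul R Gam G be).
Proof.
have beM g c d : fixed_alpha al g -> be g (c * d)%g = (be g c * be g d)%g.
  by move=> fg; rewrite (ms_beMr ms) fg.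
have fixV g : fixed_alpha al g -> fixed_alpha al (g^-1)%g.
  move=> fg c; apply: (mulIg g).
  (* With c written as beta_g(d), the product rule for alpha_d applied to g g^-1 = 1 yields g
     alpha_c(g^-1) = 1. *)
  have [d ->] : exists d, c = be g d.
    by exists (be (g^-1)%g c); rewrite -(ms_beM ms) mulVg (ms_be1 ms).
  have := ms_alMr ms d g (g^-1)%g; rewrite mulgV (ms_al1r ms) fg => e.
  by apply: (mulgI g); rewrite mulgA -e mul1g mulVg mulg1.
split.
- move=> [g mu] [h nu] [/= fg [cmu muM mun]] [/= fh [cnu nuM nun]]; split=> /=.
    by move=> c /=; rewrite (ms_alMr ms) fg fh.
  split; first exact: discrete_continuous.
    by move=> c d; rewrite beM // muM nuM mulrACA.
  by move=> c; rewrite normrM mun nun mulr1.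
- move=> [g mu] [h nu] [k rho] _ _ _; congr pair; first exact: mulgA.
  by apply/funext => c /=; rewrite (ms_beM ms) mulrA.
- exists (1%g, (fun=> 1)); split.
  + split=> /=; first exact: (ms_al1r ms).
    split; first exact: discrete_continuous.
      by move=> c d; rewrite mulr1.
    by move=> c; rewrite normr1.
  + move=> [g mu] _; split; congr pair; rewrite /= ?mul1g ?mulg1 //.
      by apply/funext => c; rewrite mul1r (ms_be1 ms).
    by apply/funext => c; rewrite mulr1.
  + move=> [g mu] [/= fg [cmu muM mun]].
    exists ((g^-1)%g, fun c => ((mu (be (g^-1)%g c))^*)%R).
      split=> /=; first exact: fixV.
      split; first exact: discrete_continuous.
        by move=> c d; rewrite (beM _ _ _ (fixV _ fg)) muM conjM.
      by move=> c; rewrite norm_conjC.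
    split; congr pair; rewrite /= ?mulVg ?mulgV //; apply/funext => c.
      by rewrite mulrC -normCK mun expr1n.
    by rewrite -(ms_beM ms) mulgV (ms_be1 ms) -normCK mun expr1n.
Qed.

(* If no point evaluation agreed with [f] on C(G), then by compactness some
   strictly positive, hence invertible, function would be killed by [f]. *)
Lemma character_evaluation (f : A -> C) : character f ->
  exists g, forall F : G -> C, continuous F -> f (a F) = F g.
Proof.
move=> [fl fM f1 fS]; apply: contrapT => /forallNP nf.
pose good (P : G -> R) :=
  [/\ continuous P, forall x, 0 <= P x & f (a (fun x => (P x)%:C%C)) = 0].
have goodD P Q : good P -> good Q -> good (fun x => P x + Q x).
  move=> [cP P0 fP] [cQ Q0 fQ]; split.
  - by move=> x; apply: cvgD; [exact: cP|exact: cQ].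
  - by move=> x; rewrite addr_ge0.
  - have -> : (fun x => (P x + Q x)%:C%C) = (fun x => 1 * ((P x)%:C%C : C) + (Q x)%:C%C).
      by apply/funext => x; rewrite rmorphD mul1r.
    by rewrite (a_linear 1 (continuous_real cP) (continuous_real cQ)) fl fP fQ mulr0 addr0.
have good0 : good (fun=> 0).
  by split=> [x|x|]; [exact: cvg_cst| |rewrite a_0 (lfun0 fl)].
have point g : exists P, good P /\ 0 < P g.
  have /existsNP [F /not_implyP [cF nF]] := nf g.
  pose F' x := 1 * F x + - f (a F).
  have cc : continuous (fun _ : G => - f (a F)) by exact: continuous_const.
  have cF' : continuous F' by exact: (continuous_linear cF cc).
  have fc (z : C) : f (a (fun=> z)) = z.
    have := a_linear z (@continuous_const R G 1) (@continuous_const R G 0).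
    have -> : (fun x : G => z * 1 + 0) = (fun=> z) by apply/funext => x; rewrite mulr1 addr0.
    by move=> ->; rewrite fl a_1 f1 a_0 (lfun0 fl) mulr1 addr0.
  have fF' : f (a F') = 0 by rewrite (a_linear 1 cF cc) fl fc mul1r subrr.
  (* Subtracting the constant f (a F) puts F' in the kernel of f, and F' g is nonzero by the choice
     of F. *)
  exists (fun x => normc (F' x) ^+ 2); split; last first.
    rewrite lt_def sqr_ge0 andbT sqrf_eq0; apply/eqP => /eq0_normc.
    by rewrite /F' mul1r => /eqP; rewrite subr_eq0 => /eqP e; apply: nF.
  split; first by move=> x; apply: cvgM; exact: continuous_normc.
    by move=> x; exact: sqr_ge0.
  by rewrite -(star_hom_sqr ha cF') fM fF' mulr0.
(* Good functions are directed upwards through sums, so near-covering compactness turns local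
   positivity into a single good function positive on all of G. *)
pose FF : set_system (G -> R) :=
  filter_from good (fun P0 => [set P : G -> R | forall x, P0 x <= P x]).
have fFF : Filter FF.
  apply: filter_from_filter; first by exists (fun=> 0).
  move=> P Q gP gQ; exists (fun x => P x + Q x); first exact: goodD.
  move=> S hS; case: gP gQ => _ P0 _ [_ Q0 _].
  by split=> x; apply: le_trans (hS x); rewrite ?lerDl ?lerDr.
have := ms_compact ms => /compact_near_coveringP /(_ _ FF (fun P x => 0 < P x) fFF).
case=> [g _|P gP hP].
  have [P [gP Pg]] := point g; have [cP _ _] := gP.
  exists ([set x | 0 < P x], [set Q : G -> R | forall x, P x <= Q x]) => /=.
    split; last by exists P.
    exact: (cP g [set r | 0 < r] (open_nbhs_nbhs (conj (@open_gt _ 0) Pg))).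
  by move=> [x Q] /= [Px PQ]; exact: lt_le_trans Px (PQ x).
have Ppos x : 0 < P x by apply: (hP P) => // y.
have [cP _ fP] := gP.
have cPV : continuous (fun x => (P x)^-1).
  by move=> x; apply: cvgV; [rewrite gt_eqF|exact: cP].
have := f1; rewrite -a_1.
have -> : (fun _ : G => 1 : C) = (fun x => (P x)%:C%C * ((P x)^-1)%:C%C).
  by apply/funext => x; rewrite -rmorphM mulfV ?gt_eqF.
rewrite (a_mul (continuous_real cP) (continuous_real cPV)) fM fP mul0r => /eqP.
by rewrite eq_sym oner_eq0.
Qed.

Lemma character_sd_right f : character f -> exists2 p, sd_right al p & Psi p = f.
Proof.
move=> cf; have [g fg] := character_evaluation cf.
have [fl fM f1 fS] := cf.
have Xp : sd_right al (g, fun c => f (u c)).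
  split=> /=.
    (* Covariance multiplies f (a F) by |f (u c^-1)|^2 = 1, so F takes the same value at g and
       alpha_c(g) for every continuous F. *)
    move=> c; apply: (continuous_functions_separate (R := R) (ms_hausdorff ms) (ms_compact ms)) => F cF.
    rewrite -(fg _ (@continuous_al c F cF)) -(fg F cF).
    have := cov_conj cov (c^-1)%g cF; rewrite invgK => <-.
    by rewrite !fM mulrAC fS -normCK character_u_norm // expr1n mul1r.
  split; first exact: discrete_continuous.
    by move=> c d; rewrite (cov_mul cov) fM.
  by move=> c; exact: character_u_norm.
exists (g, fun c => f (u c)) => //; have [cP [Pa Pu]] := PsiP Xp.
apply: character_ext => //; first by move=> F cF; rewrite Pa // fg.
Qed.

Lemma Psi_inj p q : sd_right al p -> sd_right al q -> Psi p = Psi q -> p = q.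
Proof.
move=> Xp Xq e; have [_ [pa pu]] := PsiP Xp; have [_ [qa qu]] := PsiP Xq.
case: p q {Xp Xq} e pa pu qa qu => g mu [h nu] /= e pa pu qa qu; congr pair.
  apply: (continuous_functions_separate (R := R) (ms_hausdorff ms) (ms_compact ms)) => F cF.
  by rewrite -(pa F cF) e qa.
by apply/funext => c; rewrite -pu e qu.
Qed.

Lemma Psi_bij : set_bij (@sd_right R Gam G al) (@character R A) Psi.
Proof.
split; first by move=> p /PsiP [].
  by move=> p q /set_mem Xp /set_mem Xq; exact: Psi_inj.
by move=> f /character_sd_right [p Xp <-]; exists p.
Qed.

Lemma character_group_isomorphism : group_isomorphism (@sd_right R Gam G al)
  (@sd_right_mul R Gam G be) (@character R A) (char_mul t Delta) Psi.
Proof.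
have hom p q : sd_right al p -> sd_right al q ->
    Psi (sd_right_mul be p q) = char_mul t Delta (Psi p) (Psi q).
  move=> Xp Xq; have [cp [pa pu]] := PsiP Xp; have [cq [qa qu]] := PsiP Xq.
  have [mX _ _] := sd_right_group; have [c [ra ru]] := PsiP (mX p q Xp Xq).
  apply: character_ext => // [|F cF|d]; first exact: char_mul_character.
    by rewrite (ra _ cF) (char_mul_a cp cq pa qa cF).
  by rewrite ru (char_mul_u _ cp cq pa) pu qu.
split=> //; [exact: sd_right_group|exact: group_on_transfer sd_right_group Psi_bij hom|exact: Psi_bij].
Qed.

(** * The homeomorphism between the semi-direct product and the characters *)

Local Notation S := (G * {compact-open, Gam -> C})%type.

(** Characters are contractive, so pointwise convergence need only be checked on [gen_span]; at
    [u c * a F] the value is p.2 c F(p.1). *)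
Lemma Psi_continuous : {within (@sd_right R Gam G al : set S),
  continuous (Psi : S -> {ptws A -> C})}.
Proof.
apply/subspace_continuousP => p0 Xp0; apply: ptws_cvg => x.
apply/cvg_normcP => e e0.
pose near_eq (y : A) := forall e : R, 0 < e ->
  \forall p \near within (@sd_right R Gam G al : set S) (nbhs (p0 : S)),
    normc (Psi p y - Psi p0 y) < e.
have lin p : sd_right al p -> forall (z : C) y y', Psi p (z *: y + y') = z * Psi p y + Psi p y'.
  by case/PsiP => -[].
have inX : \forall p \near within (@sd_right R Gam G al : set S) (nbhs (p0 : S)), sd_right al p.
  exact: withinT.
have gen c (F : G -> C) : continuous F -> near_eq (u c * a F).
  move=> cF d d0.
  have cvg1 : (fun p : S => F p.1) @ nbhs (p0 : S) --> F p0.1.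
    by apply: (@continuous_comp _ _ _ fst F p0); [exact: cvg_fst|exact: cF].
  have cvg2 : (fun p : S => p.2 c : C) @ nbhs (p0 : S) --> (p0.2 c : C).
    apply: (@continuous_comp _ _ _ snd (fun mu : {compact-open, Gam -> C} => mu c : C) p0).
      exact: cvg_snd.
    move=> O; rewrite nbhsE => -[U [oU Uc] UO].
    have /compact_open_cvgP : nbhs (p0.2 : {compact-open, Gam -> C}) --> (p0.2 : {compact-open, Gam -> C}) by [].
    have imU : [set p0.2 x | x in [set c]] `<=` U by move=> _ [_ -> <-].
    (* Evaluation at c is continuous for the compact-open topology because a singleton is
       compact. *)
    move=> /(_ [set c] U (@compact_set1 _ c) oU imU) h.
    have sub : [set mu : {compact-open, Gam -> C} | mu @` [set c] `<=` U] `<=`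
        (fun mu => mu c) @^-1` O by move=> mu hmu; apply: UO; apply: hmu; exists c.
    exact: (filterS sub h).
  have /cvg_normcP /(_ d d0) : (fun p : S => p.2 c * F p.1) @ nbhs (p0 : S) --> p0.2 c * F p0.1.
    exact: (cvgM cvg2 cvg1).
  apply: filterS => p hp Xp.
  have [[_ fM _ _] [pa pu]] := PsiP Xp; have [[_ fM0 _ _] [pa0 pu0]] := PsiP Xp0.
  by rewrite fM fM0 (pa _ cF) (pa0 _ cF) pu pu0.
have span y : gen_span y -> near_eq y.
  move=> hy; apply: (hy near_eq) => //; split.
    move=> d d0; apply: filterS inX => p Xp.
    by rewrite !(lfun0 (lin _ _)) // subrr normc0.
  move=> z y1 y2 h1 h2 d d0.
  have z1 : 0 < 2 * (normc z + 1) by rewrite mulr_gt0 // ltr_wpDl // normc_ge0.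
  have k0 : 0 < d / (2 * (normc z + 1)) by rewrite divr_gt0.
  apply: filterS3 inX (h1 _ k0) (h2 _ k0) => p Xp; set k := d / _ in k0 * => k1 k2.
  rewrite !lin //.
  have -> : z * Psi p y1 + Psi p y2 - (z * Psi p0 y1 + Psi p0 y2) =
     z * (Psi p y1 - Psi p0 y1) + (Psi p y2 - Psi p0 y2) by ring.
  apply: le_lt_trans (le_normcD _ _) _; rewrite normcM.
  have -> : d = k * (2 * (normc z + 1)) by rewrite /k divfK // gt_eqF.
  have : normc z * normc (Psi p y1 - Psi p0 y1) <= normc z * k.
    by rewrite ler_wpM2l ?normc_ge0 // ltW.
  have : 0 <= normc z * k by rewrite mulr_ge0 ?normc_ge0 // ltW.
  lra.
have e3 : 0 < e / 3 by rewrite divr_gt0.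
have [y Sy hy] := gen_span_dense x e3.
apply: filterS2 inX (span y Sy _ e3) => p Xp hp.
rewrite /preimage /from_subspace /=.
have [cp _] := PsiP Xp; have [cp0 _] := PsiP Xp0.
have -> : Psi p x - Psi p0 x = Psi p (x - y) - Psi p0 (x - y) + (Psi p y - Psi p0 y).
  by rewrite !(lfunB (lin _ _)) //; ring.
have h1 := le_normcD (Psi p (x - y) - Psi p0 (x - y)) (Psi p y - Psi p0 y).
have h2 := le_normcD (Psi p (x - y)) (- Psi p0 (x - y)); rewrite normcN in h2.
have h3 := state_bounded (x - y) (character_state cp).
have h4 := state_bounded (x - y) (character_state cp0).
lra.
Qed.

Definition Psi_inv (f : A -> C) : S :=
  xget (1%g, fun=> 0) [set p : S | sd_right al p /\ Psi p = f].

Lemma Psi_invK p : sd_right al p -> Psi_inv (Psi p) = p.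
Proof.
move=> Xp; rewrite /Psi_inv; case: xgetP => [q _ [Xq /esym e]|/(_ p)[]//].
exact: (esym (Psi_inj Xp Xq e)).
Qed.

Lemma Psi_inv_continuous : {within (@character R A : set {ptws A -> C}),
  continuous (Psi_inv : {ptws A -> C} -> S)}.
Proof.
apply/subspace_continuousP => f0 /character_sd_right [p0 Xp0 <-].
rewrite /from_subspace Psi_invK //.
have eval x (e : R) : 0 < e -> \forall f \near within (@character R A : set {ptws A -> C})
    (nbhs (Psi p0 : {ptws A -> C})), normc (f x - Psi p0 x) < e.
  move=> e0; have /cvg_normcP /(_ e e0) : (fun f : {ptws A -> C} => f x : C) @ nbhs (Psi p0 : {ptws A -> C}) --> (Psi p0 x : C).
    exact: (@proj_continuous A (fun=> C) x (Psi p0)).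
  by apply: filterS => f hf _.
have inY : \forall f \near within (@character R A : set {ptws A -> C})
    (nbhs (Psi p0 : {ptws A -> C})), character f by exact: withinT.
have [_ [pa0 pu0]] := PsiP Xp0.
have cvg1 : (fun f : {ptws A -> C} => (Psi_inv f).1) @
    within (@character R A : set {ptws A -> C}) (nbhs (Psi p0 : {ptws A -> C})) --> p0.1.
  (* A function [th] that is 0 at p0.1 and 1 off U detects U: a character whose value at a(th) is
     below 1 has its point in U. *)
  move=> U Up0; have [th [cth th_ge0 th0 th1]] := urysohn_point R (ms_hausdorff ms) (ms_compact ms) Up0.
  apply: filterS2 inY (eval (a (fun g => (th g)%:C%C)) 1 ltr01) => f.
  case/character_sd_right => p Xp <-; have [_ [pa pu]] := PsiP Xp.
  rewrite /preimage /= Psi_invK // (pa _ (continuous_real cth)) (pa0 _ (continuous_real cth)).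
  rewrite th0 subr0 normc_real ger0_norm // => lt1.
  by apply: contrapT => /th1 e; rewrite e ltxx in lt1.
have cvg2 : (fun f : {ptws A -> C} => (Psi_inv f).2 : {compact-open, Gam -> C}) @
    within (@character R A : set {ptws A -> C}) (nbhs (Psi p0 : {ptws A -> C}))
    --> (p0.2 : {compact-open, Gam -> C}).
  apply/compact_open_cvgP => K O cK oO KO.
  (* Compact subsets of a discrete group are finite, so a compact-open condition reduces to finitely
     many evaluations at the unitaries [u c]. *)
  have /finite_fsetP [D eD] := compact_discrete_finite Gam_discrete cK.
  have pt c : K c -> \forall f \near within (@character R A : set {ptws A -> C})
      (nbhs (Psi p0 : {ptws A -> C})), O ((Psi_inv f).2 c).
    move=> Kc; have Oc : O (Psi p0 (u c)) by rewrite pu0; apply: KO; exists c.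
    have cv : (fun f : {ptws A -> C} => f (u c) : C) @
        within (@character R A : set {ptws A -> C}) (nbhs (Psi p0 : {ptws A -> C}))
        --> (Psi p0 (u c) : C).
      by apply/cvg_normcP => e e0; exact: eval.
    apply: filterS2 inY (cv O (open_nbhs_nbhs (conj oO Oc))) => f.
    by case/character_sd_right => p Xp <-; have [_ [_ pu]] := PsiP Xp; rewrite /= Psi_invK // pu.
  have all_pt (r : seq Gam) : (forall c, c \in r -> K c) ->
      \forall f \near within (@character R A : set {ptws A -> C})
        (nbhs (Psi p0 : {ptws A -> C})), forall c, c \in r -> O ((Psi_inv f).2 c).
    elim: r => [|c r IH] Kr; first by apply: filterS inY.
    have IHr := IH (fun d dr => Kr d (mem_behead (s := c :: r) dr)).
    apply: filterS2 IHr (pt c (Kr c (mem_head c r))) => f hr hc d.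
    by rewrite inE => /predU1P[->//|]; exact: hr.
  have memD c : (c \in D) -> K c by move=> cD; rewrite eD.
  apply: filterS (all_pt D memD) => f hf _ [c Kc <-]; apply: hf.
  by rewrite eD in Kc.
have -> : Psi_inv = (fun f => ((Psi_inv f).1, (Psi_inv f).2)).
  by apply/funext => f; case: (Psi_inv f).
rewrite (surjective_pairing p0); exact: cvg_pair cvg1 cvg2.
Qed.

End Characters.

End Bicrossed.

Theorem proposition3p8 (R : realType)
  (H Gam G : topologicalGroupType) (iGam : Gam -> H) (iG : G -> H)
  (Hmatched : matched_pair R iGam iG)
  (Gam_countable : countable [set: Gam])
  (Gam_discrete : forall c : Gam, open [set c])
  (G_compact : compact [set: G])
  (al : Gam -> G -> G) (be : G -> Gam -> Gam)
  (Hactions : matched_actions iGam iG al be)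
  (Cm : cstarAlgType R) (a : (G -> Cplx R) -> Cm) (u : Gam -> Cm)
  (HCm : is_full_crossed_product al a u)
  (CmCm : cstarAlgType R) (t : Cm -> Cm -> CmCm) (Ht : is_min_tensor t)
  (Delta : Cm -> CmCm) (HDelta : is_bicrossed_comult be a u t Delta) :
  group_isomorphism
    (@sd_left R Gam G be) (@sd_left_mul R Gam G al)
    (intrinsic_group t Delta) (fun v w : Cm => v * w)
    (fun p => u p.2 * a p.1)
  /\
  exists Psi : G * (Gam -> Cplx R) -> (Cm -> Cplx R),
    [/\ forall p, sd_right al p ->
          (forall F : G -> Cplx R, continuous F -> Psi p (a F) = F p.1) /\
          (forall c : Gam, Psi p (u c) = p.2 c),
        group_isomorphism
          (@sd_right R Gam G al) (@sd_right_mul R Gam G be)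
          (@character R Cm) (char_mul t Delta) Psi &
        homeomorphism_on
          (sd_right al : set (G * {compact-open, Gam -> Cplx R}))
          (@character R Cm : set {ptws Cm -> Cplx R}) Psi].
Proof.
have ms := matched_pair_system Hmatched Gam_discrete G_compact Hactions.
have bounded (F : G -> Cplx R) : continuous F -> exists M, forall g, normc (F g) <= M.
  exact: compact_bounded_fun.
have /choice[coef coefP] := coefficients (ms_al1 ms) (ms_alM ms) HCm
  (ms_al_continuous ms) bounded.
split.
  apply: (@intrinsic_group_isomorphism R Gam G al be ms Cm a u HCm coef _ _ _ _
    CmCm t Delta Ht HDelta) => g; by case: (coefP g).
exists (Psi a u); split.
- by move=> p /(PsiP HCm)[].
- exact: (character_group_isomorphism ms HCm Ht HDelta Gam_discrete).
- split; first exact: (Psi_bij ms HCm Gam_discrete).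
    exact: (Psi_continuous ms HCm).
  exists (Psi_inv al a u); first by move=> p; exact: (Psi_invK ms HCm).
  exact: (Psi_inv_continuous ms HCm Gam_discrete).
Qed.
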